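(* Let $(\Omega,\mathcal{B},\mu,\sigma,X,\|\cdot\|,L)$ be either a strongly measurable random dynamical system or a $\mu$-continuous random dynamical system. Let $\mathcal{C}\subset X$ be a nice cone such that $L(1,\omega)\mathcal{C}\subset\mathcal{C}$ for all $\omega$. Suppose that $$n_P(\omega)=\inf\{k\ge1:\operatorname{diam}_\theta(L(k,\omega)\mathcal{C})<\infty\}$$ is finite on a set of positive measure. Then $n_P$ is finite $\mu$-almost everywhere, and there exist a positive measure subset $G_P$ of $\Omega$, a positive integer $k_P$, and a positive real number $D_P$ such that for all $\omega\in G_P$, $$\operatorname{diam}_\theta(L(k_P,\omega)\mathcal{C})\le D_P.$$ Thus, if in addition $\log^+\|L(1,\cdot)\|\in L^1(\mu)$, then the cocycle Perron–Frobenius theorem applies, that is, there exists a $\sigma$-invariant set of full measure $\tilde\Omega\subset\Omega$ on which the following statements are true. (1) There exist a unique function $v:\tilde\Omega\to\mathcal{C}$ and a positive measurable function $\phi:\tilde\Omega\to\mathbb{R}_{>0}$ such that $\|v(\omega)\|=1$, $\log^+(\phi)\in L^1(\mu)$, and $L(1,\omega)v(\omega)=\phi(\omega)v(\sigma(\omega))$. (2) There exists a family of bounded linear functionals $\omega\mapsto\eta(\omega,\cdot):\tilde\Omega\to X^*$ such that $\eta(\omega,\cdot)$ is strictly positive with respect to $\mathcal{C}$; $\eta(\sigma(\omega),L(1,\omega)x)=\phi(\omega)\eta(\omega,x)$ for all $x\in X$ and $\omega\in\tilde\Omega$; and $\eta(\omega,v(\omega))=1$. Thus $X=\operatorname{span}_{\mathbb{R}}\{v(\omega)\}\oplus\ker(\eta(\omega,\cdot))$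 is an equivariant decomposition of $X$ with respect to $L(n,\omega)$, and $\pi_\omega:X\to X$ given by $\pi_\omega(x)=\eta(\omega,x)v(\omega)$ is the continuous projection onto $\operatorname{span}_{\mathbb{R}}\{v(\omega)\}$ (along $\ker(\eta(\omega,\cdot))$). (3) If the system is strongly measurable, then: $v$ is measurable from $\mathcal{B}$ to the Borel $\sigma$-algebra of the norm on $X$; $\eta(\omega,\cdot)$ is strongly measurable; the projection operators $\pi_\omega$ and $I-\pi_\omega$ are strongly measurable; and $\omega\mapsto\operatorname{span}_{\mathbb{R}}\{v(\omega)\}$ is measurable from $\mathcal{B}$ to the Borel $\sigma$-algebra of the distance $d$ on the Grassmannian. If the system is $\mu$-continuous, then: $v$ is $\mu$-continuous with respect to $\|\cdot\|$; $\eta(\omega,\cdot)$ is $\mu$-continuous with respect to $\|\cdot\|_{X^*}$; $\pi_\omega$ and $I-\pi_\omega$ are $\mu$-continuous with respect to the operator norm; and $\operatorname{span}_{\mathbb{R}}\{v(\omega)\}$ and $\ker(\eta(\omega,\cdot))$ are $\mu$-continuous with respect to the distance on the Grassmannian. (4) The Lyapunov exponent for $v(\omega)$ is $$\lim_{n\to\infty}\frac1n\log\|L(n,\omega)v(\omega)\|=\lim_{n\to\infty}\frac1n\sum_{i=0}^{n-1}\log(\phi(\sigma^i(\omega)))=\lambda_1=\lim_{n\to\infty}\frac1n\log\|L(n,\omega)\|,$$ where $\lambda_1$ is the maximal Lyapunov exponent for $L(n,\omega)$ (possibly $-\infty$), and $$\limsup_{n\to\infty}\left(\frac1n\log\left\|L(n,\omega)|_{\ker(\eta(\omega,\cdot))}\right\|-\frac1n\sum_{i=0}^{n-1}\log(\phi(\sigma^i(\omega)))\right)\le-\frac{\mu(G_P)}{k_P}\log\left(\frac{1}{\tanh(D_P/4)}\right)<0.$$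 If $\lambda_1>-\infty$, then $\lambda_1$ has multiplicity $1$ with $\lambda_1=\int_\Omega\log\phi\,d\mu$, and the projection operators $\pi_\omega$ and $I-\pi_\omega$ are norm-tempered in $\omega$.
   Context: Nice cones. Let $(X,\|\cdot\|)$ be a real Banach space. A cone is a set $\mathcal{C}\subset X$ with $\lambda\mathcal{C}\subset\mathcal{C}$ for all $\lambda>0$. It is a nice cone if: it is convex; $0\notin\mathcal{C}$; $\mathcal{C}\cap(-\mathcal{C})=\emptyset$; $\mathcal{C}\cup\{0\}$ is closed; $\mathcal{C}-\mathcal{C}=X$ (generating); and it is $D$-adapted for some real $D\ge1$, i.e. for $x\in X$, $y\in\mathcal{C}$, if $y+x$ and $y-x$ both lie in $\mathcal{C}\cup\{0\}$ then $\|x\|\le D\|y\|$. Write $x\preceq y$ iff $y-x\in\mathcal{C}\cup\{0\}$. A functional is strictly positive with respect to $\mathcal{C}$ if it takes positive values on $\mathcal{C}$. Projective metric. For $v,w\in\mathcal{C}$: $\alpha(v,w)=\sup\{\lambda\ge0:\lambda v\preceq w\}$, $\beta(v,w)=\inf\{\mu\ge0:w\preceq\mu v\}$ ($+\infty$ if there is no such $\mu$), $\theta(v,w)=\log(\beta(v,w)/\alpha(v,w))\in[0,\infty]$ ($=\infty$ if $\alpha=0$ or $\beta=\infty$). For $S\subset\mathcal{C}$, $\operatorname{diam}_\theta(S)=\sup_{v,w\in S}\theta(v,w)$. Random dynamical systems. $(\Omega,\mathcal{B},\mu,\sigma)$ is an ergodic, invertible, probability-preserving transformation, $\mathcal{B}(X)$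 is the space of bounded linear operators on $X$, $X^*$ is the dual of $X$, $L:\Omega\to\mathcal{B}(X)$ is a map with $L(1,\omega)=L(\omega)$, and $L(n,\omega)=L(1,\sigma^{n-1}(\omega))\cdots L(1,\omega)$. - A family of operators in $\mathcal{B}(X)$ or functionals in $X^*$ indexed by $\Omega$ is strongly measurable if it is measurable for the Borel $\sigma$-algebra of the topology of pointwise convergence (strong operator topology, respectively weak-* topology). - The tuple is a strongly measurable random dynamical system if $X$ is separable and $L$ is strongly measurable (equivalently, $\omega\mapsto L(\omega)x$ is Borel measurable for each $x\in X$). - The tuple is a $\mu$-continuous random dynamical system if $\Omega$ is (homeomorphic to) a Borel subset of a Polish space, $\mu$ is a Borel measure, $\sigma$ is a homeomorphism, and $L$ is $\mu$-continuous for the operator norm topology ($X$ need not be separable). A map $f$ from $\Omega$ to a topological space is $\mu$-continuous if there is an increasing sequence of compact sets $K_n\subset\Omega$ with $\mu(\bigcup_nK_n)=1$ such that $f$ is continuous on each $K_n$. Other terms. The decomposition is equivariant if $L(1,\omega)$ maps each of the two subspaces at $\omega$ into the corresponding subspace at $\sigma(\omega)$. The Grassmannian is the set of closed complemented subspaces of $X$, with its usual distance $d$ (Hausdorff distance between closed unit balls of subspaces). $\lambda_1$ has multiplicity $1$ means that the equivariant space along which nonzero vectors grow at rate $\lambda_1$ is one-dimensional, namely $\operatorname{span}_{\mathbb{R}}\{v(\omega)\}$. A function $f:\Omega\to\mathbb{R}$ is tempered if $\lim_{n\to\pm\infty}\frac1n\log|f(\sigma^n(\omega))|=0$; a family of operators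 is norm-tempered if its norm is a tempered function of $\omega$.
   Formalization: Norm-temperedness of I − π_ω is claimed only when dim X ≠ 1; if dim X = 1 then I − π_ω = 0, so (1/n) log‖I − π_ω‖ = −∞ and the claim fails as stated. *)

(* Defs.v *)
From HB Require Import structures.
From mathcomp Require Import all_boot all_order all_algebra.
From mathcomp Require Import all_classical all_reals all_analysis.

Set Implicit Arguments.
Unset Strict Implicit.
Unset Printing Implicit Defensive.

Import Order.TTheory GRing.Theory Num.Theory.
Import numFieldNormedType.Exports.

Local Open Scope classical_set_scope.
Local Open Scope ring_scope.

(* No compatibility between the two structures is built in: the sigma-algebra
   is only required to be the Borel one in [mu_continuous_rds] below. *)
#[short(type="measurableTopologicalType")]
HB.structure Definition MeasurableTopological d :=
  {T of Measurable d T & Topological T}.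

(** ** Bounded operators and closed complemented subspaces *)

Definition bounded_operator (R : realType) (X Y : normedModType R)
    (f : X -> Y) : Prop :=
  linear f /\ exists M : R, forall x, `|f x| <= M * `|x|.

Definition unit_ball_of (R : realType) (X : normedModType R) (E : set X) :
    set X :=
  [set x | E x /\ `|x| <= 1].

(* [sup] is the supremum in R, so this is meaningful for bounded f only. *)
Definition opnorm_on (R : realType) (X Y : normedModType R) (E : set X)
    (f : X -> Y) : R :=
  sup [set `|f x| | x in unit_ball_of E].

Definition opnorm (R : realType) (X Y : normedModType R) (f : X -> Y) : R :=
  opnorm_on setT f.

Definition opdist (R : realType) (X Y : normedModType R) (f g : X -> Y) : R :=
  opnorm (fun x => f x - g x).

Definition normdist (R : realType) (X : normedModType R) (x y : X) : R :=
  `|x - y|.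

Definition subspace_set (R : realType) (X : normedModType R) (E : set X) :
    Prop :=
  E 0 /\ forall (a : R) (x y : X), E x -> E y -> E (a *: x + y).

Definition closed_direct_sum (R : realType) (X : normedModType R)
    (E F : set X) : Prop :=
  [/\ subspace_set E /\ closed E, subspace_set F /\ closed F,
      E `&` F = [set 0] &
      forall x, exists y z, [/\ E y, F z & x = y + z]].

Definition grassmannian (R : realType) (X : normedModType R) : set (set X) :=
  [set E | exists F, closed_direct_sum E F].

Definition dist_to (R : realType) (X : normedModType R) (x : X) (A : set X) :
    R :=
  inf [set `|x - a| | a in A].

Definition hausdorff_dist (R : realType) (X : normedModType R)
    (A B : set X) : R :=
  Num.max (sup [set dist_to a B | a in A]) (sup [set dist_to b A | b in B]).

Definition grassmannian_dist (R : realType) (X : normedModType R)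
    (E F : set X) : R :=
  hausdorff_dist (unit_ball_of E) (unit_ball_of F).

Definition grassmannian_open (R : realType) (X : normedModType R) :
    set (set (set X)) :=
  [set O | O `<=` @grassmannian R X /\
    forall E, O E -> exists2 e : R, 0 < e &
      forall F, grassmannian F -> grassmannian_dist E F < e -> O F].

Definition line (R : realType) (X : normedModType R) (x : X) : set X :=
  [set a *: x | a in [set: R]].

Definition kernel_set (R : realType) (X Y : normedModType R) (f : X -> Y) :
    set X :=
  [set x | f x = 0].

Definition has_dim (R : realType) (X : normedModType R) (E : set X)
    (m : nat) : Prop :=
  exists b : 'I_m -> X,
    (forall c : 'I_m -> R, \sum_i c i *: b i = 0 -> forall i, c i = 0) /\
    E = [set \sum_i c i *: b i | c in [set: 'I_m -> R]].

(** ** Nice cones and the projective metric *)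

Definition cone0 (R : realType) (X : normedModType R) (C : set X) : set X :=
  C `|` [set 0].

Definition cone_le (R : realType) (X : normedModType R) (C : set X)
    (x y : X) : Prop :=
  cone0 C (y - x).

Definition D_adapted (R : realType) (X : normedModType R) (C : set X)
    (D : R) : Prop :=
  forall x y : X, C y -> cone0 C (y + x) -> cone0 C (y - x) ->
    `|x| <= D * `|y|.

Record nice_cone (R : realType) (X : normedModType R) (C : set X) : Prop :=
  NiceCone {
    nice_cone_scale : forall (l : R) (x : X), 0 < l -> C x -> C (l *: x) ;
    nice_cone_convex : forall (x y : X) (t : R), C x -> C y -> 0 <= t <= 1 ->
      C (t *: x + (1 - t) *: y) ;
    nice_cone_0 : ~ C 0 ;
    nice_cone_salient : C `&` [set - x | x in C] = set0 ;
    nice_cone_closed : closed (cone0 C) ;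
    nice_cone_generating : forall x : X,
      exists y z, [/\ C y, C z & x = y - z] ;
    nice_cone_adapted : exists2 D : R, 1 <= D & D_adapted C D }.

Section projective_metric.
Local Open Scope ereal_scope.

Definition cone_alpha (R : realType) (X : normedModType R) (C : set X)
    (v w : X) : \bar R :=
  ereal_sup [set l%:E | l in [set l : R | (0 <= l)%R /\
                                          cone_le C (l *: v)%R w]].

Definition cone_beta (R : realType) (X : normedModType R) (C : set X)
    (v w : X) : \bar R :=
  ereal_inf [set l%:E | l in [set l : R | (0 <= l)%R /\
                                          cone_le C w (l *: v)%R]].

Definition cone_theta (R : realType) (X : normedModType R) (C : set X)
    (v w : X) : \bar R :=
  if (cone_alpha C v w == 0) || (cone_beta C v w == +oo) then +oo
  else lne (cone_beta C v w / cone_alpha C v w).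

Definition diam_theta (R : realType) (X : normedModType R) (C S : set X) :
    \bar R :=
  ereal_sup [set cone_theta C p.1 p.2 | p in S `*` S].

End projective_metric.

(** ** Measurability, mu-continuity and integrability classes *)

Definition borel_measurable d (Omega : measurableType d) (T : topologicalType)
    (D : set Omega) (f : Omega -> T) : Prop :=
  forall B : set T, <<s @open T >> B -> measurable (D `&` f @^-1` B).

(* The strong operator (or weak-star) topology is the subspace topology that
   the bounded operators (or functionals) inherit from [{ptws X -> Y}], hence
   its Borel sets are the traces of those of [{ptws X -> Y}]. *)
Definition strongly_measurable (R : realType) d (Omega : measurableType d)
    (X Y : normedModType R) (D : set Omega) (A : Omega -> X -> Y) : Prop :=
  borel_measurable D (A : Omega -> {ptws X -> Y}).

Definition grassmannian_measurable (R : realType) d (Omega : measurableType d)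
    (X : normedModType R) (D : set Omega) (E : Omega -> set X) : Prop :=
  (forall w, D w -> grassmannian (E w)) /\
  forall B : set (set X),
    <<s @grassmannian R X, @grassmannian_open R X >> B ->
    measurable (D `&` E @^-1` B).

(* mu-continuity on D of a map into a space whose topology is given by the
   distance [dist]. *)
Definition mu_continuous (R : realType) d (Omega : measurableTopologicalType d)
    (mu : {measure set Omega -> \bar R}) (T : Type) (dist : T -> T -> R)
    (D : set Omega) (f : Omega -> T) : Prop :=
  exists K : nat -> set Omega,
    [/\ forall n, compact (K n) /\ measurable (K n),
        forall n, K n `<=` K n.+1,
        forall n, K n `<=` D,
        mu (\bigcup_n K n) = 1%E &
        forall n w, K n w -> forall e : R, 0 < e ->
          \forall w' \near within (K n) (nbhs w), dist (f w) (f w') < e].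

Definition log_plus (R : realType) (x : R) : R := Num.max 0 (ln x).

(* f only has to agree almost everywhere with a measurable integrable
   function. *)
Definition in_L1 (R : realType) d (Omega : measurableType d)
    (mu : {measure set Omega -> \bar R}) (D : set Omega) (f : Omega -> R) :
    Prop :=
  exists2 g : Omega -> R, mu.-integrable D (EFin \o g) & ae_eq mu D f g.

(** ** Random dynamical systems *)

(* sigmaV is the inverse of sigma. *)
Record ergodic_invertible (R : realType) d (Omega : measurableType d)
    (mu : {measure set Omega -> \bar R}) (sigma sigmaV : Omega -> Omega) :
    Prop := ErgodicInvertible {
  ergodic_cancel : cancel sigma sigmaV ;
  ergodic_cancelV : cancel sigmaV sigma ;
  ergodic_measurable : measurable_fun setT sigma ;
  ergodic_measurableV : measurable_fun setT sigmaV ;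
  ergodic_preserving : forall A, measurable A -> mu (sigma @^-1` A) = mu A ;
  ergodic_trivial : forall A, measurable A -> sigma @^-1` A = A ->
    mu A = 0%E \/ mu A = 1%E }.

Definition separable (T : topologicalType) : Prop :=
  exists2 S : set T, countable S & dense S.

(* A Polish space is presented by one of its complete metrics. *)
Definition borel_subset_of_polish (R : realType) (T : topologicalType) :
    Prop :=
  exists (P : completePseudoMetricType R) (i : T -> P),
    [/\ hausdorff_space P /\ separable P,
        injective i,
        <<s @open P >> (range i) &
        forall U : set T, open U <-> exists2 V : set P, open V & U = i @^-1` V].

Definition strongly_measurable_rds (R : realType) d
    (Omega : measurableType d) (X : completeNormedModType R)
    (L : Omega -> X -> X) : Prop :=
  separable X /\ strongly_measurable setT L.

Definition mu_continuous_rds (R : realType) d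
    (Omega : measurableTopologicalType d)
    (mu : {measure set Omega -> \bar R}) (sigma sigmaV : Omega -> Omega)
    (X : completeNormedModType R) (L : Omega -> X -> X) : Prop :=
  [/\ borel_subset_of_polish R Omega,
      (@measurable d Omega : set (set Omega)) = <<s @open Omega >>,
      continuous sigma /\ continuous sigmaV &
      mu_continuous mu (@opdist R X X) setT L].

Fixpoint cocycle (Omega X : Type) (sigma : Omega -> Omega)
    (L : Omega -> X -> X) (n : nat) (w : Omega) : X -> X :=
  if n is m.+1 then L (iter m sigma w) \o cocycle sigma L m w else id.

Definition cone_diam (R : realType) (Omega : Type) (X : normedModType R)
    (sigma : Omega -> Omega) (L : Omega -> X -> X) (C : set X) (n : nat)
    (w : Omega) : \bar R :=
  diam_theta C (cocycle sigma L n w @` C).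

Definition nP (R : realType) (Omega : Type) (X : normedModType R)
    (sigma : Omega -> Omega) (L : Omega -> X -> X) (C : set X) (w : Omega) :
    \bar R :=
  ereal_inf [set (k%:R : R)%:E | k in
    [set k : nat | (1 <= k)%N /\ (cone_diam sigma L C k w < +oo)%E]].

Definition equivariant (R : realType) (Omega : Type) (X : normedModType R)
    (sigma : Omega -> Omega) (L : Omega -> X -> X) (D : set Omega)
    (E : Omega -> set X) : Prop :=
  forall w, D w -> L w @` E w `<=` E (sigma w).

(* The sequence (1/n) log (u n); the logarithm of 0 is -oo. *)
Definition log_rate (R : realType) (u : nat -> R) (n : nat) : \bar R :=
  ((n%:R^-1)%:E * lne (u n)%:E)%E.

Definition log_average (R : realType) (Omega : Type) (sigma : Omega -> Omega)
    (phi : Omega -> R) (w : Omega) (n : nat) : R :=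
  n%:R^-1 * \sum_(i < n) ln (phi (iter i sigma w)).

Definition tempered (R : realType) (Omega : Type)
    (sigma sigmaV : Omega -> Omega) (D : set Omega) (f : Omega -> R) : Prop :=
  forall w, D w ->
    (log_rate (fun n => `|f (iter n sigma w)|) @ \oo --> 0%E) /\
    (log_rate (fun n => `|f (iter n sigmaV w)|) @ \oo --> 0%E).

Definition norm_tempered (R : realType) (Omega : Type)
    (X Y : normedModType R) (sigma sigmaV : Omega -> Omega) (D : set Omega)
    (A : Omega -> X -> Y) : Prop :=
  tempered sigma sigmaV D (fun w => opnorm (A w)).

(* lambda is a top Lyapunov exponent of multiplicity m with equivariant space
   E: the nonzero vectors of E grow exactly at rate lambda, and E has an
   equivariant closed complement on which growth is strictly slower. The slow
   space, hence m, is determined by L and lambda: it is the set of all vectors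
   of growth rate < lambda, and m is its codimension. *)
Definition top_exponent_multiplicity (R : realType) (Omega : Type)
    (X : normedModType R) (sigma : Omega -> Omega) (L : Omega -> X -> X)
    (D : set Omega) (lambda : \bar R) (m : nat) (E : Omega -> set X) : Prop :=
  exists F : Omega -> set X,
    [/\ forall w, D w -> closed_direct_sum (E w) (F w) /\ has_dim (E w) m,
        equivariant sigma L D E,
        equivariant sigma L D F,
        forall w x, D w -> E w x -> x <> 0 ->
          log_rate (fun n => `|cocycle sigma L n w x|) @ \oo --> lambda &
        forall w x, D w -> F w x ->
          (limn_esup (log_rate (fun n => `|cocycle sigma L n w x|%R))
             < lambda)%E].

Definition tanh (R : realType) (x : R) : R :=
  (expR x - expR (- x)) / (expR x + expR (- x)).

(** ** The conclusion *)

Definition perron_frobenius_pair (R : realType) d (Omega : measurableType d)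
    (mu : {measure set Omega -> \bar R}) (X : normedModType R)
    (sigma : Omega -> Omega) (L : Omega -> X -> X) (C : set X)
    (D : set Omega) (v : Omega -> X) (phi : Omega -> R) : Prop :=
  [/\ forall w, D w -> C (v w) /\ `|v w| = 1,
      forall w, D w -> 0 < phi w,
      measurable_fun D phi,
      in_L1 mu D (fun w => log_plus (phi w)) &
      forall w, D w -> L w (v w) = phi w *: v (sigma w)].

Definition rank_one_proj (R : realType) (Omega : Type) (X : normedModType R)
    (v : Omega -> X) (eta : Omega -> X -> R^o) (w : Omega) (x : X) : X :=
  (eta w x : R) *: v w.

Definition rank_one_coproj (R : realType) (Omega : Type)
    (X : normedModType R) (v : Omega -> X) (eta : Omega -> X -> R^o)
    (w : Omega) (x : X) : X :=
  x - rank_one_proj v eta w x.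

(* f is the continuous projection onto E along F. *)
Definition continuous_projection (R : realType) (X : normedModType R)
    (f : X -> X) (E F : set X) : Prop :=
  [/\ bounded_operator f, forall x, f (f x) = f x, range f = E &
      kernel_set f = F].

(* Main.v *)
(* Comparing x and y in C through a x <= y <= (1 + d) a x turns a finite
   projective diameter into a statement about the order only. If L(k,w) C has
   projective diameter at most D, then L(k,w) shrinks every order interval
   [a u, b u] around x by the factor tanh(D/4) (Birkhoff, Hopf). By ergodicity
   the orbit of almost every w visits G_P with frequency p = mu(G_P), forwards
   and backwards, and disjoint windows of length k_P contract, so the diameter
   of L(n,w) C decays like tanh(D_P/4)^(n p / k_P). Hence the normalized vectors
   L(n, sigma^-n w) x0 form a Cauchy sequence with limit v(w), and L(n,w) x is
   asymptotic to eta(w,x) L(n,w) v(w), first for x in C and then for every x,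
   because a generating closed cone decomposes vectors with control of the norms
   (Krein-Smulian). The growth rate of L(n,w) v(w) is the Birkhoff average of
   log phi, and on ker eta(w,.) the growth is slower by the factor above.
   Temperedness holds because log |eta| has increments along orbits bounded above
   by an integrable function and is bounded on a recurrent set. *)
Require Import Defs.
From mathcomp Require Import all_boot all_order all_algebra.
From mathcomp Require Import all_classical all_reals all_analysis.
From mathcomp Require Import measurable_realfun.
From mathcomp Require Import ring lra zify.

Set Implicit Arguments.
Unset Strict Implicit.
Unset Printing Implicit Defensive.

Import Order.TTheory GRing.Theory Num.Theory.
Import numFieldNormedType.Exports.

Local Open Scope classical_set_scope.
Local Open Scope ring_scope.

(** The diameter of an image cone is never treated as a measurable function. Only the condition that
    it is at most a given constant is used, and this condition is stable under limits of the
    vectors. That makes it testable on countable data when X is separable, and relatively closed in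
    the compact sets where the cocycle is continuous otherwise. From there on everything is driven
    by one explicit measurable sequence, [contraction_rate]: a constant times a power of r, with r
    ^+ k = tanh (D / 4) and the number of visits as exponent. Crediting each visit with a factor r,
    instead of selecting disjoint windows, yields the exponent mu(G) / k directly. All limits
    converge at a rate given by this sequence, so measurability is inherited from the
    approximations, and mu-continuity follows from uniform convergence off small sets. The integral
    of log phi may be -oo, which is why the ergodic theorem is also proved for functions with
    integrable positive part only; the same version serves for log |eta|, which is not known to be
    integrable. *)

Section module_equations.
Variables (R : comPzRingType) (V : lmodType R).

Inductive vexpr :=
  | VVar of nat | VZero | VAdd of vexpr & vexpr | VOpp of vexpr
  | VScale of R & vexpr.

Fixpoint veval (env : seq V) (e : vexpr) : V :=
  match e with
  | VVar i => nth 0 env i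
  | VZero => 0
  | VAdd a b => veval env a + veval env b
  | VOpp a => - veval env a
  | VScale k a => k *: veval env a
  end.

Fixpoint vcoef (e : vexpr) (i : nat) : R :=
  match e with
  | VVar j => if i == j then 1 else 0
  | VZero => 0
  | VAdd a b => vcoef a i + vcoef b i
  | VOpp a => - vcoef a i
  | VScale k a => k * vcoef a i
  end.

Lemma vevalE env e :
  veval env e = \sum_(i < size env) vcoef e i *: nth 0 env i.
Proof.
elim: e => [j||a IHa b IHb|a IH|k a IH] /=.
- have [jn|nj] := ltnP j (size env); last first.
    rewrite nth_default // big1 // => i _.
    by rewrite ifN ?scale0r // neq_ltn (leq_trans (ltn_ord i) nj).
  rewrite (bigD1 (Ordinal jn)) //= eqxx scale1r big1 ?addr0 // => i ij.
  by rewrite ifN ?scale0r //; exact: ij.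
- by rewrite big1 // => i _; rewrite scale0r.
- by rewrite IHa IHb -big_split; apply: eq_bigr => i _; rewrite scalerDl.
- by rewrite IH -sumrN; apply: eq_bigr => i _; rewrite scaleNr.
- by rewrite IH scaler_sumr; apply: eq_bigr => i _; rewrite scalerA.
Qed.

(** A conjunction by recursion instead of a quantifier: on a concrete list of atoms it computes to
    finitely many scalar goals. *)
Fixpoint vcoef_eq (n : nat) (a b : vexpr) : Prop :=
  if n is m.+1 then vcoef a m = vcoef b m /\ vcoef_eq m a b else True.

Lemma veval_eq env a b : vcoef_eq (size env) a b -> veval env a = veval env b.
Proof.
move=> h; rewrite !vevalE; apply: eq_bigr => i _; congr (_ *: _).
have := ltn_ord i; move: (nat_of_ord i) => j.
move: h; elim: (size env) => [|n IH]; first by rewrite ltn0.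
by case=> h1 h2; rewrite ltnS leq_eqVlt => /orP[/eqP ->|]; [|exact: IH].
Qed.

End module_equations.

(** Atoms are compared up to unification. The inner [match constr:(Set)] runs [unify] for its effect
    inside a tactic that has to return a term; the outer one backtracks to the tail of the list when
    unification fails. *)
Ltac vindex x l :=
  lazymatch l with
  | ?a :: ?l' =>
    match constr:(Set) with
    | _ => let _ := match constr:(Set) with _ => unify x a end in
           constr:(0%N)
    | _ => let n := vindex x l' in constr:(S n)
    end
  end.

Ltac vatoms e l :=
  lazymatch e with
  | (?a + ?b)%R => let l1 := vatoms a l in vatoms b l1
  | (- ?a)%R => vatoms a l
  | (?k *: ?a)%R => vatoms a l
  | 0%R => l
  | _ => match constr:(Set) with
         | _ => let _ := vindex e l in l
         | _ => constr:(e :: l)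
         end
  end.

Ltac vreify R l e :=
  lazymatch e with
  | (?a + ?b)%R =>
    let x := vreify R l a in let y := vreify R l b in constr:(@VAdd R x y)
  | (- ?a)%R => let x := vreify R l a in constr:(@VOpp R x)
  | (?k *: ?a)%R => let x := vreify R l a in constr:(@VScale R k x)
  | 0%R => constr:(@VZero R)
  | _ => let n := vindex e l in constr:(@VVar R n)
  end.

(* Reduces an equation between linear combinations of vectors to the equations
   between the coefficients. *)
Ltac linear_eq K :=
  lazymatch goal with
  | |- @eq ?V ?a ?b =>
    let l0 := constr:(@nil V) in
    let l1 := vatoms a l0 in
    let l := vatoms b l1 in
    let x := vreify K l a in
    let y := vreify K l b in
    change (veval l x = veval l y);
    apply: veval_eq; cbn [size vcoef_eq vcoef eqn]; 
    repeat split; rewrite /= ?eqxx /=; try ring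
  end.

(** * Cones *)

Lemma linear_funD (R : realType) (V W : lmodType R) (f : V -> W) x y :
  linear f -> f (x + y) = f x + f y.
Proof. by move=> /(_ 1 x y); rewrite !scale1r. Qed.

Lemma linear_fun0 (R : realType) (V W : lmodType R) (f : V -> W) :
  linear f -> f 0 = 0.
Proof. by move=> /(_ (-1) 0 0); rewrite !scaleN1r oppr0 addr0 addNr. Qed.

Lemma linear_funZ (R : realType) (V W : lmodType R) (f : V -> W) a x :
  linear f -> f (a *: x) = a *: f x.
Proof. by move=> lf; rewrite -[a *: x]addr0 lf (linear_fun0 lf) !addr0. Qed.

Lemma linear_funB (R : realType) (V W : lmodType R) (f : V -> W) x y :
  linear f -> f (x - y) = f x - f y.
Proof.
by move=> lf; rewrite linear_funD// -scaleN1r linear_funZ// scaleN1r.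
Qed.

(** Compactness of a segment, in the form in which [order_ratio_closed] extracts a limit
    coefficient: recurrent closeness to c, without a subsequence. *)
Lemma cluster_point_seq (R : realType) (a : nat -> R) (lo hi : R) :
  (forall n, lo <= a n <= hi) ->
  exists2 c, lo <= c <= hi &
    forall e, 0 < e -> forall N, exists2 n, (N <= n)%N & `|c - a n| < e.
Proof.
move=> aB; have /= aF : (a @ \oo) `[lo, hi]%classic.
  by exists 0%N => // n _; rewrite /= in_itv /= aB.
have [] := @segment_compact R lo hi (a @ \oo) _ aF.
move=> c [/=]; rewrite in_itv /= => cB cl; exists c => // e e0 N.
have /cl : (a @ \oo) [set a n | n in [set n | (N <= n)%N]].
  by exists N => // n /= Nn; exists n.
move=> /(_ (ball c e) (nbhsx_ballx _ _ e0)) [_ [[n /= Nn <-] can]].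
by exists n.
Qed.

Section cone.
Variables (R : realType) (X : normedModType R) (C : set X).
Hypothesis hC : nice_cone C.
Implicit Types (x y z u : X) (a b : R).

Local Notation "x <=c y" := (cone_le C x y) (at level 70, y at next level).

(** The excess d, rather than the logarithm of 1 + d, is the parameter because the distance of the
    normalized vectors is linear in it. *)
Definition order_ratio (d : R) (x y : X) : Prop :=
  exists2 a, 0 < a & a *: x <=c y /\ y <=c ((1 + d) * a) *: x.

(* For d = expR D - 1 this bounds the projective diameter of T C by D. *)
Definition ratio_diam (d : R) (T : X -> X) : Prop :=
  forall x y, C x -> C y -> order_ratio d (T x) (T y).

Lemma cone_neq0 x : C x -> x != 0.
Proof. by move=> Cx; apply: contraPneq Cx => ->; exact: nice_cone_0 hC. Qed.

Lemma cone_norm_gt0 x : C x -> 0 < `|x|.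
Proof. by move=> /cone_neq0; rewrite normr_gt0. Qed.

Lemma cone0_0 : cone0 C 0. Proof. by right. Qed.

Lemma cone_cone0 x : C x -> cone0 C x. Proof. by left. Qed.

Lemma cone0_neq0 x : cone0 C x -> x != 0 -> C x.
Proof. by case=> // ->; rewrite eqxx. Qed.

Lemma cone0_norm_gt0 x : cone0 C x -> 0 < `|x| -> C x.
Proof. by move=> Cx; rewrite normr_gt0; exact: cone0_neq0. Qed.

Lemma cone0Z a x : 0 <= a -> cone0 C x -> cone0 C (a *: x).
Proof.
rewrite le_eqVlt => /predU1P[<- _|a0 [Cx|->]].
- by rewrite scale0r; exact: cone0_0.
- by left; exact: nice_cone_scale hC _ _ a0 Cx.
- by rewrite scaler0; exact: cone0_0.
Qed.

Lemma coneD x y : C x -> C y -> C (x + y).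
Proof.
move=> Cx Cy.
have h : 0 <= (2^-1 : R) <= 1 by lra.
have := nice_cone_scale hC (ltr0n _ 2) (nice_cone_convex hC Cx Cy h).
by congr (C _); linear_eq R; field.
Qed.

Lemma cone0D x y : cone0 C x -> cone0 C y -> cone0 C (x + y).
Proof.
move=> [Cx|->] [Cy|->]; rewrite ?addr0 ?add0r; last exact: cone0_0.
- by left; exact: coneD.
- by left.
- by left.
Qed.

Lemma coneDl x y : C x -> cone0 C y -> C (x + y).
Proof. by move=> Cx [Cy|->]; rewrite ?addr0 //; exact: coneD. Qed.

Lemma coneN x : C x -> ~ cone0 C (- x).
Proof.
move=> Cx [CNx|/eqP]; last by rewrite oppr_eq0 (negPf (cone_neq0 Cx)).
suff: (C `&` [set - z | z in C]) x by rewrite (nice_cone_salient hC).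
by split => //; exists (- x) => //; rewrite opprK.
Qed.

Lemma cone_le_refl x : x <=c x.
Proof. by rewrite /cone_le subrr; exact: cone0_0. Qed.

Lemma cone_le_trans y x z : x <=c y -> y <=c z -> x <=c z.
Proof.
move=> xy yz; have := cone0D xy yz; rewrite /cone_le.
by congr (cone0 C _); linear_eq R.
Qed.

Lemma cone_leZ a x y : 0 <= a -> x <=c y -> a *: x <=c a *: y.
Proof. by move=> a0 xy; rewrite /cone_le -scalerBr; exact: cone0Z. Qed.

Lemma cone_leZr a b u : cone0 C u -> a <= b -> a *: u <=c b *: u.
Proof.
by move=> Cu ab; rewrite /cone_le -scalerBl; apply: cone0Z; rewrite ?subr_ge0.
Qed.

Lemma cone_leZr_inv a b u : C u -> a *: u <=c b *: u -> a <= b.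
Proof.
move=> Cu; rewrite /cone_le -scalerBl => h; rewrite leNgt; apply/negP => ba.
apply: (@coneN ((a - b) *: u)); last by rewrite -scaleNr opprB.
by apply: (nice_cone_scale hC) => //; rewrite subr_gt0.
Qed.

Lemma cone0_approx p :
  (forall e, 0 < e -> exists2 z, cone0 C z & `|p - z| < e) -> cone0 C p.
Proof.
move=> h; apply: (nice_cone_closed hC) => B /nbhs_ballP[e /= e0 eB].
by have [z Cz pz] := h _ e0; exists z; split => //; apply: eB; rewrite -ball_normE.
Qed.

Section positive_operators.
Variables (T : X -> X).
Hypotheses (linT : linear T) (posT : T @` C `<=` C).

Lemma pos_cone x : C x -> C (T x). Proof. by move=> Cx; apply: posT; exists x. Qed.

Lemma pos_cone0 x : cone0 C x -> cone0 C (T x).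
Proof.
by case=> [/pos_cone|->]; [left|rewrite linear_fun0//; exact: cone0_0].
Qed.

Lemma pos_le x y : x <=c y -> T x <=c T y.
Proof. by move=> xy; rewrite /cone_le -(linear_funB _ _ linT); exact: pos_cone0. Qed.

End positive_operators.

Lemma order_ratioZ d x y s t : 0 < s -> 0 < t -> order_ratio d x y ->
  order_ratio d (s *: x) (t *: y).
Proof.
move=> s0 t0 [a a0 [h1 h2]]; exists (t * a / s); first by rewrite divr_gt0 ?mulr_gt0.
have ns : s != 0 by rewrite gt_eqF.
have h1' := cone_leZ (ltW t0) h1; have h2' := cone_leZ (ltW t0) h2.
split; [move: h1'|move: h2']; rewrite !scalerA; congr (cone_le C (_ *: _) (_ *: _));
  by field.
Qed.

Lemma order_ratio_le d d' x y : d <= d' -> cone0 C x -> order_ratio d x y ->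
  order_ratio d' x y.
Proof.
move=> dd Cx [a a0 [h1 h2]]; exists a => //; split => //.
apply: (cone_le_trans h2); apply: cone_leZr => //; rewrite ler_wpM2r ?(ltW a0)//.
by rewrite lerD2l.
Qed.

Section adapted.
Variable Dc : R.
Hypotheses (Dc1 : 1 <= Dc) (hDc : D_adapted C Dc).

Let Dc0 : 0 < Dc. Proof. exact: lt_le_trans Dc1. Qed.

(** [D_adapted] asks for both y - x and y + x; for x in the cone the second is automatic. When y =
    0, salience forces x = 0. *)
Lemma cone_le_norm x y : cone0 C x -> cone0 C y -> x <=c y -> `|x| <= Dc * `|y|.
Proof.
move=> Cx [Cy|->] xy.
  by apply: hDc => //; left; exact: coneDl.
case: Cx xy => [Cx|-> _]; last by rewrite normr0 mulr0.
by rewrite /cone_le sub0r => /(coneN Cx).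
Qed.

Lemma cone_le_norm_sym x y e : 0 <= e -> C y -> (- e) *: y <=c x ->
  x <=c e *: y -> `|x| <= Dc * e * `|y|.
Proof.
rewrite le_eqVlt => /predU1P[<-|e0] Cy h1 h2.
  move: h1 h2; rewrite oppr0 scale0r /cone_le subr0 sub0r => h1 h2.
  case: h1 => [Cx|->]; first by have := coneN Cx h2.
  by rewrite normr0 mulr0 mul0r.
have := normrZ e y; rewrite (gtr0_norm e0) -mulrA => <-; apply: hDc.
- exact: nice_cone_scale hC _ _ e0 Cy.
- by move: h1; rewrite /cone_le scaleNr opprK addrC.
- exact: h2.
Qed.

(** The vector y - a x lies between 0 and d a x, so its norm is at most Dc d a. As x and y have norm
    1, the same number bounds |1 - a|, and a is at most Dc. The two errors add up to the
    constant. *)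
Lemma order_ratio_dist d x y : 0 <= d -> C x -> C y -> `|x| = 1 -> `|y| = 1 ->
  order_ratio d x y -> `|x - y| <= 2 * Dc ^+ 2 * d.
Proof.
move=> d0 Cx Cy nx ny [a a0 [h1 h2]].
have Cax : cone0 C (a *: x) by apply: cone0Z; [exact: ltW|left].
have aD : a <= Dc.
  have := cone_le_norm Cax (cone_cone0 Cy) h1.
  by rewrite normrZ nx ny !mulr1 gtr0_norm.
have yax : `|y - a *: x| <= Dc * (d * a).
  have := @cone_le_norm (y - a *: x) ((d * a) *: x) h1.
  rewrite normrZ nx mulr1 ger0_norm ?mulr_ge0 ?(ltW a0)//; apply.
    by apply: cone0Z; rewrite ?mulr_ge0 ?(ltW a0)//; left.
  move: h2; rewrite /cone_le; congr (cone0 C _); linear_eq R.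
have a1 : `|1 - a| <= Dc * (d * a).
  apply: le_trans yax; rewrite -[1 in leLHS]ny -[a in leLHS]mulr1 -nx.
  by rewrite -[a in leLHS](gtr0_norm a0) -normrZ ler_dist_dist.
have -> : x - y = (1 - a) *: x - (y - a *: x) by linear_eq R.
apply: (le_trans (ler_normB _ _)); rewrite normrZ nx mulr1.
apply: (le_trans (lerD a1 yax)).
have : Dc * (d * a) <= Dc * (d * Dc) by rewrite !ler_wpM2l// ltW.
by rewrite expr2; lra.
Qed.

(** The coefficients of the approximating pairs stay between two positive constants, so they have a
    positive cluster point; closedness of the cone carries both inequalities to it. Both
    measurability arguments for the contracting sets rest on this. *)
Lemma order_ratio_closed d x y : 0 <= d -> C x -> C y ->
  (forall e, 0 < e -> exists x' y', [/\ C x', C y', `|x - x'| < e,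
     `|y - y'| < e & order_ratio (d + e) x' y']) -> order_ratio d x y.
Proof.
move=> d0 Cx Cy H.
have nx := cone_norm_gt0 Cx; have ny := cone_norm_gt0 Cy.
pose e0 := Num.min 1 (Num.min (`|x| / 2) (`|y| / 2)).
have e0_gt0 : 0 < e0 by rewrite /e0 !lt_min ltr01 !divr_gt0.
have e01 : e0 <= 1 by rewrite /e0 ge_min lexx.
have e0x : e0 <= `|x| / 2 by rewrite /e0 !ge_min lexx !orbT.
have e0y : e0 <= `|y| / 2 by rewrite /e0 !ge_min lexx !orbT.
pose e (n : nat) := e0 / n.+1%:R.
have e_gt0 n : 0 < e n by rewrite divr_gt0.
have e_le n : e n <= e0 by rewrite ler_pdivrMr// ler_peMr ?(ltW e0_gt0)// ler1n.
have e_to0 c : 0 < c -> exists N, forall n, (N <= n)%N -> e n < c.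
  move=> c0; exists (Num.truncn (e0 / c)) => n Nn.
  rewrite ltr_pdivrMr// mulrC -ltr_pdivrMr//.
  apply: (lt_le_trans (truncnS_gt _)); rewrite ler_nat ltnS//.
clearbody e.
have /choice[s hs] : forall n, exists s : X * X * R, [/\ C s.1.1 /\ C s.1.2,
    `|x - s.1.1| < e n, `|y - s.1.2| < e n, 0 < s.2 &
     s.2 *: s.1.1 <=c s.1.2 /\ s.1.2 <=c ((1 + (d + e n)) * s.2) *: s.1.1].
  move=> n; have [x' [y' [Cx' Cy' xx' yy' [a a0 [h1 h2]]]]] := H _ (e_gt0 n).
  by exists (x', y', a).
(* Both bounds come from [cone_le_norm] applied to the two inequalities, with the norms of the
   approximating vectors replaced by those of x and y up to the factors that [e0] allows. *)
pose lo := `|y| / (6 * Dc * (2 + d) * `|x|); pose hi := 3 * Dc * `|y| / `|x|.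
have sB n : lo <= (s n).2 <= hi.
  have [[Cx' Cy'] xx' yy' a0 [h1 h2]] := hs n.
  move: (s n) Cx' Cy' xx' yy' a0 h1 h2 => [[x' y'] a] /= Cx' Cy' xx' yy' a0 h1 h2.
  have x1 : `|x| / 2 <= `|x'|.
    have := ler_normD (x - x') x'; rewrite subrK.
    by move: (e_le n) e0x xx'; lra.
  have x2 : `|x'| <= 2 * `|x|.
    have := ler_normB x (x - x'); rewrite opprB addrC subrK.
    by move: (e_le n) e0x xx'; lra.
  have y1 : `|y| / 2 <= `|y'|.
    have := ler_normD (y - y') y'; rewrite subrK.
    by move: (e_le n) e0y yy'; lra.
  have y2 : `|y'| <= 3 / 2 * `|y|.
    have := ler_normB y (y - y'); rewrite opprB addrC subrK.
    by move: (e_le n) e0y yy'; lra.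
  have Cax : cone0 C (a *: x') by apply: cone0Z; [exact: ltW|left].
  have de : 0 <= 1 + (d + e n) by have := e_gt0 n; lra.
  have de2 : 1 + (d + e n) <= 2 + d by have := e_le n; lra.
  have h1n := cone_le_norm Cax (cone_cone0 Cy') h1.
  have /(cone_le_norm (cone_cone0 Cy'))/(_ h2) h2n :
    cone0 C (((1 + (d + e n)) * a) *: x').
    by apply: cone0Z; [rewrite mulr_ge0 ?(ltW a0)|left].
  move: h1n h2n; rewrite !normrZ !ger0_norm ?(ltW a0)// => h1n h2n.
  apply/andP; split.
    rewrite /lo ler_pdivrMr; last by rewrite !mulr_gt0//; lra.
    have : Dc * ((1 + (d + e n)) * a * `|x'|) <= Dc * ((2 + d) * a * (2 * `|x|)).
      rewrite ler_wpM2l ?(ltW Dc0)// ler_pM ?mulr_ge0 ?(ltW a0)//.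
      by rewrite ler_wpM2r ?(ltW a0).
    have : 0 <= Dc * a * (2 + d) * `|x|.
      by rewrite !mulr_ge0 ?(ltW a0) ?(ltW Dc0)//; lra.
    by move: y1 h2n; lra.
  rewrite /hi ler_pdivlMr//.
  have : a * (`|x| / 2) <= a * `|x'| by rewrite ler_wpM2l ?(ltW a0).
  have : Dc * `|y'| <= Dc * (3 / 2 * `|y|) by rewrite ler_wpM2l ?(ltW Dc0).
  by move: h1n; lra.
have [c /andP[cl ch] hc] := cluster_point_seq sB.
have lo0 : 0 < lo by rewrite /lo divr_gt0// !mulr_gt0//; lra.
have c0 : 0 < c by exact: lt_le_trans cl.
exists c => //.
have near r : 0 < r -> exists n, [/\ e n < r, `|c - (s n).2| < r & True].
  move=> r0; have [N hN] := e_to0 r r0; have [n Nn cn] := hc r r0 N.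
  by exists n; split => //; exact: hN.
have sx n : `|(s n).1.1| <= 2 * `|x|.
  have [_ xx' _ _ _] := hs n.
  have := ler_normB x (x - (s n).1.1); rewrite opprB addrC subrK.
  by move: (e_le n) e0x xx'; lra.
split.
- apply: cone0_approx => r r0.
  (* K is the sum of the factors of the three error terms, so that precision r / K in each of them
     gives r in total. The K of the second inequality is found in the same way. *)
  pose K := 1 + c + 2 * `|x|; have K0 : 0 < K by rewrite /K; have := nx; lra.
  have [n [en cn _]] := near (r / K) (divr_gt0 r0 K0).
  have [_ xx' yy' _ [h1 _]] := hs n.
  exists ((s n).1.2 - (s n).2 *: (s n).1.1) => //.
  have -> : y - c *: x - ((s n).1.2 - (s n).2 *: (s n).1.1) =
    (y - (s n).1.2) - c *: (x - (s n).1.1) - (c - (s n).2) *: (s n).1.1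
    by linear_eq R.
  apply: (le_lt_trans (ler_normB _ _)); rewrite normrZ.
  apply: (le_lt_trans (lerD (ler_normB _ _) (lexx _))); rewrite normrZ (gtr0_norm c0).
  have -> : r = r / K + c * (r / K) + (r / K) * (2 * `|x|).
    by rewrite /K; field; rewrite -/K gt_eqF.
  rewrite ltr_leD//; last by rewrite ler_pM// ltW.
  rewrite ltrD//; first exact: lt_trans en.
  by rewrite ltr_pM2l//; exact: lt_trans en.
- apply: cone0_approx => r r0.
  pose K := 1 + (1 + d) * c + (3 + d + hi) * (2 * `|x|).
  have hi0 : 0 <= hi by apply: le_trans ch; exact: ltW.
  have K0 : 0 < K.
    have : 0 <= (1 + d) * c by rewrite mulr_ge0 ?(ltW c0)//; lra.
    have : 0 <= (3 + d + hi) * (2 * `|x|) by rewrite mulr_ge0//; lra.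
    by rewrite /K; lra.
  have [n [en cn _]] := near (r / K) (divr_gt0 r0 K0).
  have [_ xx' yy' a0 [_ h2]] := hs n.
  have /andP[_ ahi] := sB n.
  exists (((1 + (d + e n)) * (s n).2) *: (s n).1.1 - (s n).1.2) => //.
  have -> : ((1 + d) * c) *: x - y - (((1 + (d + e n)) * (s n).2) *: (s n).1.1 - (s n).1.2) =
    ((1 + d) * c) *: (x - (s n).1.1) - (y - (s n).1.2)
      + ((1 + d) * (c - (s n).2) - e n * (s n).2) *: (s n).1.1
    by linear_eq R.
  apply: (le_lt_trans (ler_normD _ _)).
  apply: (le_lt_trans (lerD (ler_normB _ _) (lexx _))).
  rewrite (normrZ _ (x - _)) (normrZ _ (s n).1.1).
  have dc : 0 < (1 + d) * c by rewrite mulr_gt0//; lra.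
  rewrite (gtr0_norm dc).
  have -> : r = (1 + d) * c * (r / K) + r / K
    + ((1 + d) * (r / K) + (r / K) * (2 + hi)) * (2 * `|x|).
    by rewrite /K; field; rewrite -/K gt_eqF.
  rewrite ltr_leD//.
    rewrite ltrD//; last exact: lt_trans en.
    by rewrite ltr_pM2l//; exact: lt_trans en.
  rewrite ler_pM//; apply: (le_trans (ler_normB _ _)).
  rewrite !normrM (gtr0_norm (e_gt0 n)) (gtr0_norm a0) lerD//.
    by rewrite ger0_norm ?ler_wpM2l ?(ltW cn)//; lra.
  rewrite ler_pM ?(ltW a0) ?(ltW (e_gt0 n)) ?(ltW en)//.
  by apply: (le_trans ahi); lra.
Qed.

End adapted.
End cone.

Section tanh.
Variable R : realType.

(** With q = expR (D / 2) the factor is (q - 1) / (q + 1), the form in which Hopf's estimate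
    produces it. *)
Lemma tanh_quarterE (D : R) :
  Defs.tanh (D / 4) = (expR (D / 2) - 1) / (expR (D / 2) + 1).
Proof.
rewrite /Defs.tanh expRN; set s := expR (D / 4).
have s0 : 0 < s by exact: expR_gt0.
have -> : D / 2 = D / 4 + D / 4 by field.
rewrite expRD -/s; field; rewrite !gt_eqF ?addr_gt0 ?mulr_gt0//.
Qed.

Lemma tanh_quarter_gt0 (D : R) : 0 < D -> 0 < Defs.tanh (D / 4).
Proof.
move=> D0; rewrite tanh_quarterE; have : 1 < expR (D / 2) by rewrite expR_gt1 divr_gt0.
by move=> h; rewrite divr_gt0; lra.
Qed.

Lemma tanh_quarter_lt1 (D : R) : Defs.tanh (D / 4) < 1.
Proof.
rewrite tanh_quarterE; have := expR_gt0 (D / 2) => h.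
by rewrite ltr_pdivrMr; lra.
Qed.

End tanh.

(** * Hopf's contraction estimate and its link with the projective metric *)

Section contraction.
Variables (R : realType) (X : normedModType R) (C : set X).
Hypothesis hC : nice_cone C.
Implicit Types (x y z u : X) (a b : R).

Local Notation "x <=c y" := (cone_le C x y) (at level 70, y at next level).

(* Hopf's argument: T (x - a u) and T (b u - x) are comparable up to expR D,
   and their sum is (b - a) T u. *)
Lemma hopf_contraction (T : X -> X) u x a b (D : R) : linear T -> 0 < D ->
  ratio_diam C (expR D - 1) T -> C u -> C (T u) -> a *: u <=c x -> x <=c b *: u ->
  exists a' b', [/\ a <= a', a' <= b', b' <= b,
    b' - a' <= Defs.tanh (D / 4) * (b - a) &
    a' *: T u <=c T x /\ T x <=c b' *: T u].
Proof.
move=> lT D0 hT Cu CTu h1 h2.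
have ab : a <= b by apply: (cone_leZr_inv hC Cu); exact: cone_le_trans h2.
have t0 : 0 <= Defs.tanh (D / 4) * (b - a).
  by rewrite mulr_ge0 ?subr_ge0// ltW// tanh_quarter_gt0.
(* At an endpoint of the interval one of the two differences is 0, which is not in C, so
   [ratio_diam] does not apply to it; but then T x is a multiple of T u and the interval
   collapses. *)
case: h1 => [Cp|xa]; last first.
  have -> : x = a *: u by apply/eqP; rewrite -subr_eq0 xa.
  exists a, a; rewrite lexx ab subrr (linear_funZ _ _ lT); split => //.
  by split; exact: cone_le_refl.
case: h2 => [Cq|xb]; last first.
  have -> : x = b *: u by apply/eqP; rewrite -subr_eq0 -oppr_eq0 opprB xb.
  exists b, b; rewrite lexx ab subrr (linear_funZ _ _ lT); split => //.
  by split; exact: cone_le_refl.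
have [c c0 [h1 h2]] := hT _ _ Cq Cp.
pose q := expR (D / 2).
have q1 : 1 < q by rewrite expR_gt1 divr_gt0.
have qE : expR D = q ^+ 2 by rewrite expr2 -expRD; congr expR; field.
move: h2; rewrite (_ : 1 + (expR D - 1) = q ^+ 2); last by rewrite qE; ring.
move=> h2.
have e0 : 0 < q ^+ 2 * c by rewrite mulr_gt0// exprn_gt0//; lra.
(* From c T (b u - x) <= T (x - a u) one gets (a + c b) T u <= (1 + c) T x, and a' is the quotient
   (a + c b) / (1 + c). The other comparison gives b' with q^2 c in place of c. *)
pose a' := a + c / (1 + c) * (b - a).
pose b' := a + q ^+ 2 * c / (1 + q ^+ 2 * c) * (b - a).
have n1 : 1 + c != 0 by rewrite gt_eqF//; lra.
have n2 : 1 + q ^+ 2 * c != 0 by rewrite gt_eqF//; lra.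
have TE := linear_funB _ _ lT.
have TZ := linear_funZ _ _ lT.
exists a', b'; split.
- by rewrite /a' lerDl mulr_ge0 ?subr_ge0// divr_ge0; lra.
- rewrite lerD2l ler_wpM2r ?subr_ge0// ler_pdivrMr; last lra.
  rewrite mulrAC ler_pdivlMr; last lra.
  have : c <= q ^+ 2 * c by rewrite ler_peMl ?(ltW c0)// exprn_ege1// ltW.
  by lra.
- have : q ^+ 2 * c / (1 + q ^+ 2 * c) * (b - a) <= b - a.
    by rewrite ler_piMl ?subr_ge0// ler_pdivrMr; lra.
  by rewrite /b'; lra.
- rewrite tanh_quarterE -/q.
  have -> : b' - a' = (q ^+ 2 * c / (1 + q ^+ 2 * c) - c / (1 + c)) * (b - a).
    by rewrite /a' /b'; ring.
  rewrite ler_wpM2r ?subr_ge0//.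
  (* As a function of c the width is largest at c = 1 / q, with value (q - 1) / (q + 1); the
     identity displays the defect as a square. *)
  have -> : q ^+ 2 * c / (1 + q ^+ 2 * c) - c / (1 + c) =
    (q - 1) / (q + 1) - (q - 1) * (q * c - 1) ^+ 2 /
       ((q + 1) * (1 + c) * (1 + q ^+ 2 * c)).
    by field; rewrite n1 n2 /= gt_eqF//; lra.
  rewrite gerBl divr_ge0//; first by rewrite mulr_ge0 ?sqr_ge0//; lra.
  by rewrite !mulr_ge0//; lra.
- split.
  + have c1 : 0 <= (1 + c)^-1 by rewrite invr_ge0; lra.
    have := cone0Z hC c1 h1; rewrite /cone_le; congr (cone0 C _).
    by rewrite !TE !TZ; linear_eq R; rewrite /a'; field.
  + have c1 : 0 <= (1 + q ^+ 2 * c)^-1 by rewrite invr_ge0; lra.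
    have := cone0Z hC c1 h2; rewrite /cone_le; congr (cone0 C _).
    by rewrite !TE !TZ; linear_eq R; rewrite /b'; field.
Qed.

Lemma cone_alpha_ge x y a : 0 <= a -> a *: x <=c y -> (a%:E <= cone_alpha C x y)%E.
Proof. by move=> a0 h; apply: ereal_sup_ubound; exists a. Qed.

Lemma cone_beta_le x y b : 0 <= b -> y <=c b *: x -> (cone_beta C x y <= b%:E)%E.
Proof. by move=> a0 h; apply: ereal_inf_lbound; exists b. Qed.

(** Both alpha and beta lie between a and expR D * a: their quotient is at most expR D, and neither
    exceptional branch of [cone_theta] is taken. *)
Lemma order_ratio_theta x y (D : R) : C x -> 0 <= D ->
  order_ratio C (expR D - 1) x y -> (cone_theta C x y <= D%:E)%E.
Proof.
move=> Cx D0 [a a0 [h1]]; rewrite (_ : 1 + (expR D - 1) = expR D); last by ring.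
move=> h2.
have e0 : 0 <= expR D * a by rewrite mulr_ge0 ?(ltW a0)// expR_ge0.
have al1 := cone_alpha_ge (ltW a0) h1; have be1 := cone_beta_le e0 h2.
have al2 : (cone_alpha C x y <= (expR D * a)%:E)%E.
  apply: ge_ereal_sup => _ [l [l0 hl] <-]; rewrite lee_fin.
  by apply: (cone_leZr_inv hC Cx); exact: cone_le_trans h2.
have be2 : (a%:E <= cone_beta C x y)%E.
  apply: le_ereal_inf_tmp => _ [l [l0 hl] <-]; rewrite lee_fin.
  by apply: (cone_leZr_inv hC Cx); exact: cone_le_trans hl.
rewrite /cone_theta.
case: (cone_alpha C x y) al1 al2 => [r||]; rewrite ?leeNe_eq ?leye_eq // !lee_fin.
move=> al1 al2.
case: (cone_beta C x y) be1 be2 => [s||]; rewrite ?leeNe_eq ?leye_eq // !lee_fin.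
move=> be1 be2.
have r0 : 0 < r by exact: lt_le_trans al1.
rewrite orbF eqe gt_eqF// inver gt_eqF// -EFinM lne_EFin; last first.
  by rewrite divr_gt0//; exact: lt_le_trans be2.
rewrite lee_fin -[leRHS]expRK ler_ln ?posrE ?expR_gt0//; last first.
  by rewrite divr_gt0//; exact: lt_le_trans be2.
rewrite ler_pdivrMr// (le_trans be1)// ler_wpM2l ?expR_ge0//.
Qed.

(** The slack D' - D allows near-optimal coefficients in place of the extremal ones: one half is
    spent on the supremum alpha, the other on the infimum beta. *)
Lemma theta_order_ratio x y (D D' : R) : C x -> C y -> D < D' ->
  (cone_theta C x y <= D%:E)%E -> order_ratio C (expR D' - 1) x y.
Proof.
have [Dc Dc1 hDc] := nice_cone_adapted hC.
move=> Cx Cy DD'; rewrite /cone_theta; case: ifPn; first by rewrite leye_eq.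
rewrite negb_or => /andP[al0 be0].
have al_ge0 : (0 <= cone_alpha C x y)%E.
  by apply: cone_alpha_ge => //; left; rewrite scale0r subr0.
have al_fin : (cone_alpha C x y <= (Dc * `|y| / `|x|)%:E)%E.
  apply: ge_ereal_sup => _ [l [l0 hl] <-]; rewrite lee_fin.
  rewrite ler_pdivlMr ?(cone_norm_gt0 hC Cx)//.
  have Clx : cone0 C (l *: x) by apply: (cone0Z hC) => //; left.
  have := cone_le_norm hC hDc Clx (cone_cone0 Cy) hl.
  by rewrite normrZ ger0_norm.
have be_ge0 : (0 <= cone_beta C x y)%E.
  by apply: le_ereal_inf_tmp => _ [l [l0 hl] <-]; rewrite lee_fin.
have al_lt := @ereal_sup_gt _ [set l%:E | l in [set l : R | 0 <= l /\ l *: x <=c y]].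
have be_lt := @ereal_inf_lt _ [set l%:E | l in [set l : R | 0 <= l /\ y <=c l *: x]].
rewrite -/(cone_alpha C x y) in al_lt; rewrite -/(cone_beta C x y) in be_lt.
case: (cone_alpha C x y) al0 al_ge0 al_fin al_lt => [r||] //.
rewrite eqe lee_fin => r_neq0 r_ge0 _ al_lt.
have r0 : 0 < r by rewrite lt_neqAle eq_sym r_neq0.
case: (cone_beta C x y) be0 be_ge0 be_lt => [s||] //; rewrite lee_fin => _ s0 be_lt.
rewrite inver gt_eqF// -EFinM => h.
pose h2 := (D' - D) / 2; have h20 : 0 < h2 by rewrite divr_gt0// subr_gt0.
have e1 : expR (- h2) < 1 by rewrite expR_lt1 oppr_lt0.
have srD : s <= expR D * r.
  move: s0; rewrite le_eqVlt => /predU1P[<-|s0]; first by rewrite mulr_ge0 ?expR_ge0.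
  move: h; rewrite lne_EFin ?divr_gt0// lee_fin -[ln _ <= D]ler_expR lnK ?posrE ?divr_gt0//.
  by rewrite ler_pdivrMr.
have /al_lt[_ [a [a0 ha] <-]] : ((expR (- h2) * r)%:E < r%:E)%E.
  by rewrite lte_fin gtr_pMl.
rewrite lte_fin => ra.
have a_gt0 : 0 < a by apply: le_lt_trans ra; rewrite mulr_ge0// expR_ge0.
have : (s%:E < (expR (D + h2) * r)%:E)%E.
  rewrite lte_fin (le_lt_trans srD)// ltr_pM2r// ltr_expR.
  by rewrite ltrDl.
move=> /be_lt[_ [b [b0 hb] <-]]; rewrite lte_fin => rb.
exists a => //; split => //.
apply: (cone_le_trans hC hb); apply: (cone_leZr hC (cone_cone0 Cx)).
rewrite (_ : 1 + (expR D' - 1) = expR D'); last by ring.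
apply: (le_trans (ltW rb)).
have -> : expR (D + h2) * r = expR D' * (expR (- h2) * r).
  by rewrite mulrA -expRD; congr (expR _ * _); rewrite /h2; field.
by rewrite ler_wpM2l ?expR_ge0// ltW.
Qed.

Lemma ratio_diam_theta (T : X -> X) (D : R) : T @` C `<=` C -> 0 <= D ->
  ratio_diam C (expR D - 1) T -> (diam_theta C (T @` C) <= D%:E)%E.
Proof.
move=> posT D0 h; apply: ge_ereal_sup => _ [[_ _] [[x Cx <-] [y Cy <-]] <-] /=.
apply: order_ratio_theta => //; last exact: h.
exact: (pos_cone posT).
Qed.

Lemma diam_theta_ratio (T : X -> X) (D D' : R) : T @` C `<=` C -> D < D' ->
  (diam_theta C (T @` C) <= D%:E)%E -> ratio_diam C (expR D' - 1) T.
Proof.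
move=> posT DD' h x y Cx Cy.
apply: theta_order_ratio DD' _; [exact: (pos_cone posT)|exact: (pos_cone posT)|].
apply: le_trans h; apply: ereal_sup_ubound.
by exists (T x, T y) => //; split; [exists x|exists y].
Qed.

(** An integer bound leaves countably many conditions, so that one of them can be found to hold on a
    set of positive measure. *)
Lemma diam_theta_lty_ratio (T : X -> X) : T @` C `<=` C ->
  (diam_theta C (T @` C) < +oo)%E ->
  exists n : nat, ratio_diam C (expR n%:R - 1) T.
Proof.
move=> posT h.
have [D hD] : exists D : R, (diam_theta C (T @` C) <= D%:E)%E.
  case: (diam_theta C (T @` C)) h => [r _||_] //; first by exists r.
  by exists 0; rewrite leNye.
exists (Num.truncn `|D|).+1; apply: diam_theta_ratio hD => //.
by apply: (le_lt_trans (ler_norm D)); exact: truncnS_gt.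
Qed.

End contraction.

Lemma lt_exp2_truncn (R : realType) (a : R) : a < 2 ^+ (Num.truncn a).+1.
Proof.
apply: (lt_trans (truncnS_gt _)).
have -> : (2 : R) ^+ (Num.truncn a).+1 = (2 ^ (Num.truncn a).+1)%:R.
  by rewrite natrX.
by rewrite ltr_nat ltn_expl.
Qed.

Lemma cauchy_rate_limit (R : realType) (X : completeNormedModType R)
    (u : nat -> X) (b : nat -> R) :
  (forall n m, (n <= m)%N -> `|u n - u m| <= b n) ->
  (forall e, 0 < e -> exists n, b n < e) ->
  exists l, forall n, `|u n - l| <= b n.
Proof.
move=> ub b0.
have : cvgn u.
  apply/cauchy_cvgP; apply: cauchy_exP => e e0.
  have [n bn] := b0 e e0; exists (u n).
  exists n => // m /= nm; rewrite -ball_normE /=.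
  exact: le_lt_trans (ub _ _ nm) bn.
move=> /cvg_ex[l ul]; exists l => n; apply/ler_addgt0Pr => e e0.
have /cvgrPdist_lt/(_ e e0)[N _ hN] := ul.
have := hN (maxn n N) (leq_maxr _ _); rewrite distrC => h.
have -> : u n - l = (u n - u (maxn n N)) + (u (maxn n N) - l) by linear_eq R.
apply: (le_trans (ler_normD _ _)); apply: lerD (ltW h).
exact: ub (leq_maxl _ _).
Qed.

(* Krein-Smulian: the Baire category theorem makes the decomposition given by a
   generating closed cone bounded. *)
Section cone_decomposition.
Variables (R : realType) (X : completeNormedModType R) (C : set X).
Hypothesis hC : nice_cone C.

Let A (n : nat) : set X := [set x | exists y z, [/\ cone0 C y, cone0 C z,
  `|y| <= n%:R, `|z| <= n%:R & x = y - z]].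

Lemma cone_difference_ball : exists n p, exists2 r : R, 0 < r &
  forall x, `|p - x| < r -> closure (A n) x.
Proof.
apply: contrapT => H.
have : dense (\bigcap_n (~` closure (A n))).
  apply: Baire => n; split; first exact/closed_openC/closed_closure.
  move=> O [p Op] oO; apply/set0P/eqP => O0; apply: H.
  have [r /= r0 rO] := (nbhs_ballP _ _).1 (open_nbhs_nbhs (conj oO Op)).
  exists n, p, r => // x px; apply: contrapT => nA.
  suff: (O `&` ~` closure (A n)) x by rewrite O0.
  by split => //; apply: rO; rewrite -ball_normE.
move=> /(_ setT) []; [by exists 0|exact: openT|].
move=> x [_ hx]; have [y [z [Cy Cz xyz]]] := nice_cone_generating hC x.
have [n hn] : exists n : nat, `|y| <= n%:R /\ `|z| <= n%:R.
  exists (maxn (Num.truncn `|y|).+1 (Num.truncn `|z|).+1); split.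
    by rewrite (le_trans (ltW (truncnS_gt _)))// ler_nat leq_maxl.
  by rewrite (le_trans (ltW (truncnS_gt _)))// ler_nat leq_maxr.
apply: (hx n I); apply: subset_closure.
by exists y, z; split => //; [left|left|case: hn|case: hn].
Qed.

(** The ball given by Baire's theorem is centred at an unknown p. Decomposing p + s x and p - s x
    and subtracting eliminates p; the positive part of one point is then grouped with the negative
    part of the other. *)
Lemma cone_approx_decomposition : exists2 k : R, 0 < k &
  forall x, exists y z, [/\ cone0 C y, cone0 C z, `|y| <= k * `|x|,
    `|z| <= k * `|x| & `|x - (y - z)| <= `|x| / 2].
Proof.
have [n [p [r r0 hr]]] := cone_difference_ball.
(* The successor keeps the constant positive, since n may be 0. *)
exists ((2 * n.+1%:R) / r); first by rewrite divr_gt0// mulr_gt0.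
move=> x; have [->|x0] := eqVneq x 0.
  by exists 0, 0; rewrite subrr subr0 !normr0 !mulr0 mul0r; split => //; right.
have nx : 0 < `|x| by rewrite normr_gt0.
pose s := r / (2 * `|x|); have s0 : 0 < s by rewrite divr_gt0// mulr_gt0.
have nsx : `|s *: x| = r / 2.
  by rewrite normrZ gtr0_norm// /s; field; rewrite gt_eqF.
have approx q : `|p - q| < r -> exists y z, [/\ cone0 C y, cone0 C z,
    `|y| <= n.+1%:R, `|z| <= n.+1%:R & `|q - (y - z)| < r / 4].
  move=> /hr /(_ (ball q (r / 4))) [|_ [[y [z [Cy Cz yn zn ->]]]]].
    by apply: nbhsx_ballx; rewrite divr_gt0.
  rewrite -ball_normE /= => h; exists y, z; split => //.
    by rewrite (le_trans yn)// ler_nat.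
  by rewrite (le_trans zn)// ler_nat.
have [|y1 [z1 [Cy1 Cz1 ny1 nz1 h1]]] := approx (p + s *: x).
  by rewrite opprD addrA subrr sub0r normrN nsx; lra.
have [|y2 [z2 [Cy2 Cz2 ny2 nz2 h2]]] := approx (p - s *: x).
  by rewrite opprB addrC subrK nsx; lra.
have is0 : 0 < (2 * s)^-1 by rewrite invr_gt0 mulr_gt0.
exists ((2 * s)^-1 *: (y1 + z2)), ((2 * s)^-1 *: (z1 + y2)).
have sE : (2 * s)^-1 = `|x| / r by rewrite /s; field; rewrite !gt_eqF.
have bnd a b : `|a| <= n.+1%:R -> `|b| <= n.+1%:R ->
    `|(2 * s)^-1 *: (a + b : X)| <= (2 * n.+1%:R) / r * `|x|.
  move=> na nb; rewrite normrZ (gtr0_norm is0) sE.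
  have -> : 2 * n.+1%:R / r * `|x| = `|x| / r * (n.+1%:R + n.+1%:R) by ring.
  rewrite ler_wpM2l ?divr_ge0 ?(ltW r0)//.
  by apply: (le_trans (ler_normD _ _)); exact: lerD.
split.
- by apply: (cone0Z hC); [exact: ltW|exact: cone0D].
- by apply: (cone0Z hC); [exact: ltW|exact: cone0D].
- exact: bnd.
- exact: bnd.
- have -> : x - ((2 * s)^-1 *: (y1 + z2) - (2 * s)^-1 *: (z1 + y2)) =
    (2 * s)^-1 *: ((p + s *: x - (y1 - z1)) - (p - s *: x - (y2 - z2))).
    by linear_eq R; field; rewrite gt_eqF.
  rewrite normrZ (gtr0_norm is0) sE.
  have -> : `|x| / 2 = `|x| / r * (r / 4 + r / 4) by field; rewrite gt_eqF.
  rewrite ler_wpM2l ?divr_ge0 ?(ltW r0)//.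
  by apply: (le_trans (ler_normB _ _)); rewrite lerD// ltW.
Qed.

(** The approximate decomposition is iterated on the remainder, whose norm is at least halved each
    time. The two series of cone vectors converge geometrically, and their sums stay in the closed
    cone; summing 2^-n doubles the constant. *)
Lemma cone_decomposition : exists2 k : R, 0 < k &
  forall x, exists y z, [/\ cone0 C y, cone0 C z, `|y| <= k * `|x|,
    `|z| <= k * `|x| & x = y - z].
Proof.
have [k k0 hk] := cone_approx_decomposition.
exists (2 * k); first by rewrite mulr_gt0.
have /choice[Y /choice[Z hYZ]] := hk.
move=> x; pose r := fix r n := if n is m.+1 then r m - (Y (r m) - Z (r m)) else x.
have nr n : `|r n| <= `|x| / 2 ^+ n.
  elim: n => [|n IH]; first by rewrite expr0 divr1.
  have [_ _ _ _ h] := hYZ (r n); apply: (le_trans h).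
  by rewrite exprS invfM mulrA (mulrAC _ 2^-1) ler_pM2r// invr_gt0.
have sum_limit (S : X -> X) :
    (forall z, cone0 C (S z) /\ `|S z| <= k * `|z|) ->
    exists l, [/\ cone0 C l, `|l| <= 2 * k * `|x| &
      forall n, `|\sum_(i < n) S (r i) - l| <= 2 * k * `|x| / 2 ^+ n].
  move=> hS; have CS n : cone0 C (\sum_(i < n) S (r i)).
    elim: n => [|n IH]; first by rewrite big_ord0; exact: cone0_0.
    by rewrite big_ord_recr /=; apply: (cone0D hC) => //; case: (hS (r n)).
  have e0 e : 0 < e -> exists n, 2 * k * `|x| / 2 ^+ n < e.
    move=> e_gt0; exists (Num.truncn (2 * k * `|x| / e)).+1.
    rewrite ltr_pdivrMr ?exprn_gt0// [ltRHS]mulrC -ltr_pdivrMr//.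
    exact: lt_exp2_truncn.
  have [|l hl] := @cauchy_rate_limit _ _ (fun n => \sum_(i < n) S (r i))
      (fun n => 2 * k * `|x| / 2 ^+ n) _ e0.
    move=> n m nm.
    (* The bound is sharpened to a telescoping one, since the bound that ignores m would not survive
       the induction on m - n. *)
    suff : `|\sum_(i < n) S (r i) - \sum_(i < m) S (r i)| <=
        2 * k * `|x| / 2 ^+ n - 2 * k * `|x| / 2 ^+ m.
      move=> /le_trans; apply; rewrite gerBl divr_ge0 ?exprn_ge0//.
      by rewrite !mulr_ge0// ltW.
    rewrite -(subnKC nm); elim: (m - n)%N => [|j IH].
      by rewrite addn0 !subrr normr0.
    rewrite addnS big_ord_recr /= opprD addrA.
    apply: (le_trans (ler_normB _ _)); apply: (le_trans (lerD IH (lexx _))).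
    have [_ h] := hS (r (n + j)%N).
    have : `|S (r (n + j)%N)| <= k * (`|x| / 2 ^+ (n + j)).
      by apply: (le_trans h); rewrite ler_wpM2l ?(ltW k0).
    rewrite exprS invfM; set q := (2 ^+ (n + j))^-1.
    have -> : 2 * k * `|x| * (2^-1 * q) = k * `|x| * q by field.
    by lra.
  exists l; split => //.
    apply: (cone0_approx hC) => e /e0[n hn].
    by exists (\sum_(i < n) S (r i)) => //; rewrite distrC (le_lt_trans (hl n)).
  by have := hl 0%N; rewrite big_ord0 sub0r normrN expr0 divr1.
have [|y [Cy ny hy]] := sum_limit Y.
  by move=> z; have [] := hYZ z.
have [|z [Cz nz hz]] := sum_limit Z.
  by move=> w; have [] := hYZ w.
exists y, z; split => //.
apply/eqP; rewrite -subr_eq0 -normr_le0; apply/ler_addgt0Pr => e e0.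
have rE n : r n = x - (\sum_(i < n) Y (r i) - \sum_(i < n) Z (r i)).
  elim: n => [|n IH]; first by rewrite !big_ord0 subrr subr0.
  have -> : r n.+1 = r n - (Y (r n) - Z (r n)) by [].
  have SE S : \sum_(i < n.+1) S (r i) = \sum_(i < n) S (r i) + S (r n) :> X.
    by rewrite big_ord_recr.
  rewrite !SE; move: (Y (r n)) (Z (r n)) => Yn Zn; rewrite IH.
  by linear_eq R.
pose n := (Num.truncn ((1 + 4 * k) * `|x| / e)).+1.
have : (1 + 4 * k) * `|x| / 2 ^+ n < e.
  rewrite ltr_pdivrMr ?exprn_gt0// [ltRHS]mulrC -ltr_pdivrMr//.
  exact: lt_exp2_truncn.
have -> : x - (y - z) = r n + (\sum_(i < n) Y (r i) - y)
  - (\sum_(i < n) Z (r i) - z) by rewrite rE; linear_eq R.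
move=> h; rewrite add0r; apply: (le_trans _ (ltW h)).
apply: (le_trans (ler_normB _ _)); apply: (le_trans (lerD (ler_normD _ _) (lexx _))).
apply: (le_trans (lerD (lerD (nr n) (hy n)) (hz n))).
by rewrite -!mulrDl ler_wpM2r ?invr_ge0 ?exprn_ge0//; lra.
Qed.

End cone_decomposition.

(** * The ergodic theorem *)

Lemma measurable_set_lt d (Omega : measurableType d) (R : realType)
    (D : set Omega) (f g : Omega -> R) : measurable D ->
  measurable_fun D f -> measurable_fun D g ->
  measurable (D `&` [set w | f w < g w]).
Proof.
move=> mD mf mg; have mt : measurable [set true] by [].
have := measurable_fun_ltr mf mg mD mt.
by congr (measurable (_ `&` _)); apply/seteqP.
Qed.

Lemma measurable_set_le d (Omega : measurableType d) (R : realType)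
    (D : set Omega) (f g : Omega -> R) : measurable D ->
  measurable_fun D f -> measurable_fun D g ->
  measurable (D `&` [set w | f w <= g w]).
Proof.
move=> mD mf mg; have mt : measurable [set true] by [].
have := measurable_fun_ler mf mg mD mt.
by congr (measurable (_ `&` _)); apply/seteqP.
Qed.

Lemma measurable_iter d (Omega : measurableType d) (f : Omega -> Omega) n :
  measurable_fun setT f -> measurable_fun setT (iter n f).
Proof.
move=> mf; elim: n => [|n IH]; first exact: measurable_id.
exact: (measurableT_comp mf IH).
Qed.

Section birkhoff_sums.
Variables (R : realType) (Omega : Type) (T : Omega -> Omega).

Definition birkhoff_sum (f : Omega -> R) (n : nat) (w : Omega) : R :=
  \sum_(i < n) f (iter i T w).

Lemma birkhoff_sum0 f w : birkhoff_sum f 0 w = 0.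
Proof. by rewrite /birkhoff_sum big_ord0. Qed.

Lemma birkhoff_sumS f n w :
  birkhoff_sum f n.+1 w = f w + birkhoff_sum f n (T w).
Proof.
rewrite /birkhoff_sum big_ord_recl; congr (_ + _).
by apply: eq_bigr => i _; rewrite -iterSr.
Qed.

Lemma birkhoff_sumSr f n w :
  birkhoff_sum f n.+1 w = birkhoff_sum f n w + f (iter n T w).
Proof. by rewrite /birkhoff_sum big_ord_recr. Qed.

(* The maximum of the Birkhoff sums of length at most n. *)
Fixpoint birkhoff_max (f : Omega -> R) (n : nat) (w : Omega) : R :=
  if n is m.+1 then Num.max 0 (f w + birkhoff_max f m (T w)) else 0.

Lemma birkhoff_max_ge0 f n w : 0 <= birkhoff_max f n w.
Proof. by case: n => //= n; rewrite le_max lexx. Qed.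

Lemma birkhoff_maxS f n w : birkhoff_max f n w <= birkhoff_max f n.+1 w.
Proof.
elim: n w => [|n IH] w; first exact: birkhoff_max_ge0.
by rewrite /= le_max2 // lerD2l; exact: IH.
Qed.

Lemma birkhoff_sum_le_max f n w : birkhoff_sum f n w <= birkhoff_max f n w.
Proof.
elim: n w => [|n IH] w; first by rewrite birkhoff_sum0.
by rewrite birkhoff_sumS /= le_max lerD2l IH orbT.
Qed.

End birkhoff_sums.

Section measure_preserving.
Variables (R : realType) (d : measure_display) (Omega : measurableType d).
Variable mu : probability Omega R.
Variables T TV : Omega -> Omega.
Hypothesis hT : ergodic_invertible mu T TV.

Let mT : measurable_fun setT T. Proof. exact: ergodic_measurable hT. Qed.

Lemma measurable_birkhoff_sum (f : Omega -> R) n : measurable_fun setT f ->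
  measurable_fun setT (birkhoff_sum T f n).
Proof.
move=> mf; apply: measurable_sum => i.
exact: (measurableT_comp mf (measurable_iter i mT)).
Qed.

Lemma ergodic_inverse : ergodic_invertible mu TV T.
Proof.
split.
- exact: ergodic_cancelV hT.
- exact: ergodic_cancel hT.
- exact: ergodic_measurableV hT.
- exact: ergodic_measurable hT.
- move=> A mA; rewrite -(ergodic_preserving hT).
    by congr (mu _); apply/seteqP; split => w /=; rewrite (ergodic_cancel hT).
  by rewrite -[X in measurable X]setTI; exact: ergodic_measurableV hT _ _ mA.
- move=> A mA AT; apply: (ergodic_trivial hT) => //.
  rewrite -{1}AT; apply/seteqP; split => w /=; rewrite (ergodic_cancel hT) //.
Qed.

Lemma preserving_integrable (f : Omega -> R) :
  mu.-integrable setT (EFin \o f) -> mu.-integrable setT (EFin \o (f \o T)).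
Proof.
move=> /integrableP[/measurable_EFinP mf foo].
apply/integrableP; split.
  by apply/measurable_EFinP; exact: measurableT_comp mf mT.
have := foo; rewrite (@eq_measure_integral _ _ _ setT (pushforward mu T)); last first.
  by move=> A mA _; rewrite /pushforward; exact/esym/(ergodic_preserving hT).
by rewrite ge0_integral_pushforward//; apply: measurableT_comp => //; exact/measurable_EFinP.
Qed.

Lemma preserving_integral (f : Omega -> R) :
  mu.-integrable setT (EFin \o f) ->
  (\int[mu]_w (f (T w))%:E = \int[mu]_w (f w)%:E)%E.
Proof.
move=> fi; have /integrableP[mf _] := fi.
rewrite [RHS](@eq_measure_integral _ _ _ setT (pushforward mu T)); last first.
  by move=> A mA _; rewrite /pushforward; exact/esym/(ergodic_preserving hT).
rewrite (integral_pushforward mT mf)//; exact: preserving_integrable.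
Qed.

Lemma preserving_ae (P : Omega -> Prop) :
  {ae mu, forall w, P w} -> {ae mu, forall w, P (T w)}.
Proof.
move=> [N [mN N0 PN]]; exists (T @^-1` N); split.
- by rewrite -[X in measurable X]setTI; exact: mT.
- by rewrite -N0; exact: (ergodic_preserving hT).
- by move=> w /= h; apply: PN.
Qed.

Lemma measurable_birkhoff_max (f : Omega -> R) n : measurable_fun setT f ->
  measurable_fun setT (birkhoff_max T f n).
Proof.
move=> mf; elim: n => [|n IH] /=; first exact: measurable_cst.
apply: measurable_maxr; first exact: measurable_cst.
by apply: measurable_funD => //; exact: measurableT_comp IH mT.
Qed.

Lemma integrable_birkhoff_max (f : Omega -> R) n :
  mu.-integrable setT (EFin \o f) ->
  mu.-integrable setT (EFin \o birkhoff_max T f n).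
Proof.
move=> fi; have /integrableP[/measurable_EFinP mf _] := fi.
elim: n => [|n IH].
  exact: (@finite_measure_integrable_cst _ _ _ mu setT 0).
have h := integrableD measurableT fi (preserving_integrable IH).
apply: le_integrable h => //; first exact/measurable_EFinP/measurable_birkhoff_max.
move=> w _ /=; rewrite lee_fin.
by rewrite /Num.max; case: ifP => //; rewrite normr0.
Qed.

(** The maximal ergodic argument. The set A where the maxima F n are unbounded is invariant. If it
    had full measure, F n.+1 - F n \o T = max (- F n \o T, f) would tend to f almost everywhere
    under the majorant |f|. Its integral is that of F n.+1 - F n, hence nonnegative, which
    contradicts the sign of the integral of f. *)
Lemma birkhoff_bounded (f : Omega -> R) : mu.-integrable setT (EFin \o f) ->
  (\int[mu]_w (f w)%:E < 0)%E ->
  {ae mu, forall w, exists M : R, forall n, birkhoff_sum T f n w <= M}.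
Proof.
move=> fi f0; have /integrableP[/measurable_EFinP mf _] := fi.
pose F := birkhoff_max T f.
have mF n : measurable_fun setT (F n) by exact: measurable_birkhoff_max.
pose A := \bigcap_(M : nat) \bigcup_(n : nat) [set w | (M%:R < F n w)].
have mA : measurable A.
  apply: bigcap_measurable => // M _; apply: bigcup_measurable => n _.
  rewrite -[X in measurable X]setTI; apply: measurable_set_lt => //.
have AT : T @^-1` A = A.
  apply/seteqP; split => w /= hw M _.
    have [n _ /= hn] := hw (Num.truncn (M%:R - f w)).+1 I.
    exists n.+1 => //=; rewrite lt_max; apply/orP; right.
    rewrite -ltrBlDl; apply: lt_trans hn; exact: truncnS_gt.
  have [n _ /= hn] := hw (Num.truncn (M%:R + `|f w|)).+1 I.
  have := lt_trans (truncnS_gt _) hn.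
  case: n {hn} => [|n] /=.
    by rewrite ltNge addr_ge0.
  rewrite lt_max ltNge addr_ge0//= => h; exists n => //=.
  have {}h : M%:R + `|f w| < f w + F n (T w) := h; have := ler_norm (f w).
 lra.
have [A0|A1] := ergodic_trivial hT mA AT.
  exists A; split => // w /= hw M _; apply: contrapT => hM; apply: hw.
  exists M%:R => n; apply: (le_trans (birkhoff_sum_le_max _ _ _ _)).
  by rewrite leNgt; apply/negP => h; apply: hM; exists n.
have Aae : {ae mu, forall w, A w}.
  exists (~` A); split => //; first exact: measurableC.
  by rewrite probability_setC// A1 subee.
have FM n m w : (n <= m)%N -> F n w <= F m w.
  move=> nm; rewrite -(subnKC nm); elim: (m - n)%N => [|j IH].
    by rewrite addn0.
  by rewrite addnS (le_trans IH)//; exact: birkhoff_maxS.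
pose g n w : \bar R := (F n.+1 w - F n (T w))%:E.
have gE n w : F n.+1 w - F n (T w) = Num.max (- F n (T w)) (f w).
  by rewrite /F /= -/F addr_maxl sub0r addrK.
have [] := @dominated_convergence _ _ _ mu setT measurableT g (EFin \o f)
  (EFin \o (fun w => `|f w|)).
- move=> n; apply/measurable_EFinP; apply: measurable_funB => //.
  exact: measurableT_comp (mF n) mT.
- exact/measurable_EFinP.
- apply: filterS Aae => w; rewrite -AT /= => Aw _.
  have [n _ /= hn] := Aw (Num.truncn `|f w|).+1 I.
  apply: cvg_near_cst; exists n => // m /= nm; apply/eqP.
  rewrite /g gE (max_idPr _) //.
  have := FM n m (T w) nm; have := truncnS_gt `|f w|.
  have := lerNnormlW (lexx `|f w|). lra.
- exact: integrable_norm fi.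
- apply: aeW => w n _; rewrite /g gE /= lee_fin.
  have F0 : 0 <= F n (T w) by exact: birkhoff_max_ge0.
  rewrite /Num.max; case: ifPn => //; rewrite -leNgt => h1.
  by rewrite normrN (ger0_norm F0); have := lerNnormlW (lexx `|f w|); lra.
move=> _ _ /= glim.
suff : (0 <= \int[mu]_w (f w)%:E)%E by rewrite leNgt f0.
apply: (@closed_cvg _ _ _ _ _ (fun v => (0 <= v)%E) _ _ _ glim).
  exact: closed_ereal_le_ereal.
apply: nearW => n.
have Fi := integrable_birkhoff_max n fi; have FSi := integrable_birkhoff_max n.+1 fi.
have -> : (\int[mu]_w g n w =
    \int[mu]_w (F n.+1 w)%:E - \int[mu]_w (F n (T w))%:E)%E.
  rewrite -integralB//; last exact: preserving_integrable Fi.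
rewrite (preserving_integral Fi) sube_ge0; last first.
  by apply/orP; left; exact: integrable_fin_num.
apply: le_integral => // w _; rewrite lee_fin; exact: birkhoff_maxS.
Qed.

Lemma birkhoff_upper (f : Omega -> R) (c : R) : mu.-integrable setT (EFin \o f) ->
  (\int[mu]_w (f w)%:E < c%:E)%E ->
  {ae mu, forall w, exists M : R, forall n, birkhoff_sum T f n w <= n%:R * c + M}.
Proof.
move=> fi fc.
have ci := @finite_measure_integrable_cst _ _ _ mu setT c measurableT.
have fci : mu.-integrable setT (EFin \o (fun w => f w - c)).
  by have := integrableB measurableT fi ci; congr (mu.-integrable _ _).
have := birkhoff_bounded fci; have -> : (\int[mu]_w (f w - c)%:E < 0)%E.
  have -> : (\int[mu]_w (f w - c)%:E = \int[mu]_w (f w)%:E - \int[mu]_w (cst c w)%:E)%E.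
    by rewrite -integralB.
  have -> : (\int[mu]_w (cst c w)%:E = c%:E)%E.
    rewrite (integral_cst mu measurableT c%:E).
    by rewrite -[RHS]mule1; congr (_ * _)%E; exact: probability_setT.
  by rewrite lteBlDr// add0e.
move=> /(_ isT); apply: filterS => w [M hM]; exists M => n.
have := hM n; rewrite /birkhoff_sum big_split /= sumrN sumr_const card_ord.
by rewrite -mulr_natl; lra.
Qed.

End measure_preserving.

Section ergodic_theorem.
Variables (R : realType) (d : measure_display) (Omega : measurableType d).
Variable mu : probability Omega R.
Variables T TV : Omega -> Omega.
Hypothesis hT : ergodic_invertible mu T TV.

Lemma birkhoff_sumN (f : Omega -> R) n w :
  birkhoff_sum T (fun w => - f w) n w = - birkhoff_sum T f n w.
Proof. by rewrite /birkhoff_sum sumrN. Qed.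

Lemma average_le_cvg (u : nat -> R) (m : R) :
  (forall k : nat, exists M : R, forall n, `|u n - n%:R * m| <= n%:R / k.+1%:R + M) ->
  n%:R^-1 * u n @[n --> \oo] --> m.
Proof.
move=> H; apply/cvgrPdist_lt => e e0.
have [k hk] : exists k : nat, k.+1%:R^-1 < e / 2.
  exists (Num.truncn (e / 2)^-1); rewrite invf_plt ?posrE ?divr_gt0//.
  exact: truncnS_gt.
have [M hM] := H k.
exists (Num.truncn (`|M| / (e / 2))).+1 => // n /= hn.
have n0 : 0 < n%:R :> R by rewrite ltr0n; exact: leq_ltn_trans hn.
have -> : m - n%:R^-1 * u n = - (n%:R^-1 * (u n - n%:R * m)).
  by rewrite mulrBr mulKf ?gt_eqF// opprB.
rewrite normrN normrM gtr0_norm ?invr_gt0// mulrC ltr_pdivrMr//.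
apply: (le_lt_trans (hM n)).
have : `|M| / (e / 2) < n%:R.
  by apply: (lt_le_trans (truncnS_gt _)); rewrite ler_nat.
rewrite ltr_pdivrMr ?divr_gt0// => h.
have : n%:R / k.+1%:R < n%:R * (e / 2) by rewrite ltr_pM2l.
have := ler_norm M.
move: (n%:R / k.+1%:R) h => q h h1 h2.
have -> : e * n%:R = n%:R * (e / 2) + n%:R * (e / 2) by field.
lra.
Qed.

(** The one-sided bound is applied to f and to - f with slack 1 / (k + 1); only countably many
    slacks occur, so the exceptional set stays null. *)
Theorem birkhoff (f : Omega -> R) : mu.-integrable setT (EFin \o f) ->
  {ae mu, forall w, n%:R^-1 * birkhoff_sum T f n w @[n --> \oo] -->
    fine (\int[mu]_w (f w)%:E)}.
Proof.
move=> fi; set m := fine _.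
have mE : (\int[mu]_w (f w)%:E = m%:E)%E by rewrite fineK// integrable_fin_num.
have up (g : Omega -> R) c (k : nat) : mu.-integrable setT (EFin \o g) ->
    (\int[mu]_w (g w)%:E = c%:E)%E ->
    {ae mu, forall w, exists M : R, forall n,
      birkhoff_sum T g n w <= n%:R * (c + k.+1%:R^-1) + M}.
  move=> gi gE; apply: (birkhoff_upper hT) => //.
  by rewrite gE lte_fin ltrDl invr_gt0.
have Nfi : mu.-integrable setT (EFin \o (fun w => - f w)).
  exact: (integrableN fi).
have NE : (\int[mu]_w (- f w)%:E = (- m)%:E)%E.
  by under eq_integral do rewrite EFinN; rewrite integralN ?mE// integrable_add_def.
have up1 : {ae mu, forall w (k : nat), exists M : R, forall n,
    birkhoff_sum T f n w <= n%:R * (m + k.+1%:R^-1) + M}.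
  by apply/ae_foralln => k; exact: up.
have up2 : {ae mu, forall w (k : nat), exists M : R, forall n,
    birkhoff_sum T (fun w => - f w) n w <= n%:R * (- m + k.+1%:R^-1) + M}.
  by apply/ae_foralln => k; exact: up.
apply: filterS2 up1 up2 => w h1 h2; apply: average_le_cvg => k.
have [M1 hM1] := h1 k; have [M2 hM2] := h2 k.
exists (Num.max M1 M2) => n; have := hM1 n; have := hM2 n.
rewrite birkhoff_sumN ler_norml => h3 h4.
have h5 : M1 <= Num.max M1 M2 by rewrite le_max lexx.
have h6 : M2 <= Num.max M1 M2 by rewrite le_max lexx orbT.
move: k.+1%:R^-1 h3 h4 => q; rewrite !mulrDr mulrN => h3 h4.
by apply/andP; split; lra.
Qed.

(* The integral of f may be -oo here. *)
Theorem birkhoff_quasi_integrable (f : Omega -> R) : measurable_fun setT f ->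
  mu.-integrable setT (EFin \o (fun w => Num.max 0 (f w))) ->
  {ae mu, forall w, (n%:R^-1 * birkhoff_sum T f n w)%:E @[n --> \oo] -->
    (\int[mu]_w (f w)%:E)%E}.
Proof.
move=> mf fp.
have [fi|nfi] := pselect (mu.-integrable setT (EFin \o f)).
  have := birkhoff fi; apply: filterS => w h.
  rewrite -[X in _ --> X]fineK ?integrable_fin_num//.
  by apply: cvg_EFin => //; exact: nearW.
pose p w := Num.max 0 (f w); pose q w := Num.max 0 (- f w).
have fpq w : f w = p w - q w.
  by rewrite /p /q; case: (leP 0 (f w)); case: (leP 0 (- f w)); lra.
have mq : measurable_fun setT q.
  by apply: measurable_maxr => //; exact: measurable_funN.
have q0 w : 0 <= q w by rewrite le_max lexx.
have qoo : (\int[mu]_w (q w)%:E = +oo)%E.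
  apply/eqP; rewrite -leye_eq leNgt; apply/negP => qfin; apply: nfi.
  have qi : mu.-integrable setT (EFin \o q).
    apply/integrableP; split; first exact/measurable_EFinP.
    rewrite (eq_integral (fun w => (q w)%:E)) // => w _.
    by rewrite /= ger0_norm.
  have := integrableB measurableT fp qi; congr (mu.-integrable _ _).
  by apply/funext => w; exact/esym/(congr1 EFin (fpq w)).
have fNy : (\int[mu]_w (f w)%:E = -oo)%E.
  rewrite integralE.
  rewrite (_ : (\int[mu]_x (fun w => (f w)%:E)^\- x)%E = +oo%E); last first.
    rewrite -qoo; apply: eq_integral => w _; rewrite funenegE -EFinN -EFin_max.
    by rewrite maxC.
  rewrite (_ : (\int[mu]_x (fun w => (f w)%:E)^\+ x = \int[mu]_w (p w)%:E)%E).
    by rewrite -[X in (X - _)%E]fineK// integrable_fin_num.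
  by apply: eq_integral => w _; rewrite funeposE -EFin_max maxC.
(* Cutting the negative part at M gives integrable majorants p - qM of f, to which the ergodic
   theorem applies; their integrals tend to -oo by monotone convergence. *)
pose qM (M : nat) w := Num.min (q w) M%:R.
have mqM M : measurable_fun setT (qM M) by exact: measurable_minr.
have qM0 M w : 0 <= qM M w by rewrite /qM le_min q0 ler0n.
have qMi M : mu.-integrable setT (EFin \o qM M).
  apply: le_integrable (@finite_measure_integrable_cst _ _ _ mu setT M%:R measurableT) => //.
    exact/measurable_EFinP.
  by move=> w _ /=; rewrite lee_fin !ger0_norm// /qM ge_min lexx orbT.
have qMlim : ((\int[mu]_w (qM n w)%:E) @[n --> \oo] --> (+oo : \bar R))%E.
  rewrite -qoo; rewrite (_ : (\int[mu]_w (q w)%:E)%E =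
      (\int[mu]_w (limn (fun n => (qM n w)%:E)))%E); last first.
    apply: eq_integral => w _; apply/esym/cvg_lim => //.
    apply: cvg_near_cst; exists (Num.truncn (q w)).+1 => // n /= hn.
    rewrite /qM (min_idPl _) //.
    by apply/ltW/(lt_le_trans (truncnS_gt _)); rewrite ler_nat.
  apply: cvg_monotone_convergence => //.
  - by move=> n; exact/measurable_EFinP.
  - by move=> n w _; rewrite lee_fin.
  - move=> w _ n m nm; rewrite lee_fin /qM le_min ge_min lexx /=.
    by rewrite ge_min ler_nat nm orbT.
have up M : {ae mu, forall w, n%:R^-1 * birkhoff_sum T (fun w => p w - qM M w) n w
    @[n --> \oo] --> fine (\int[mu]_w (p w - qM M w)%:E)}.
  by apply: birkhoff; have := integrableB measurableT fp (qMi M);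
    congr (mu.-integrable _ _).
have {}up : {ae mu, forall w M, n%:R^-1 * birkhoff_sum T (fun w => p w - qM M w) n w
    @[n --> \oo] --> fine (\int[mu]_w (p w - qM M w)%:E)}.
  exact/ae_foralln.
apply: filterS up => w h; rewrite fNy; apply/cvgeNyPle => A.
pose P := fine (\int[mu]_w (p w)%:E).
have /cvgeyPge/(_ (P - A + 1))[M _ /(_ M (leqnn M))/= hM] := qMlim.
have intE : fine (\int[mu]_w (p w - qM M w)%:E) =
    P - fine (\int[mu]_w (qM M w)%:E).
  rewrite (_ : (\int[mu]_w (p w - qM M w)%:E =
     \int[mu]_w (p w)%:E - \int[mu]_w (qM M w)%:E)%E); last first.
    by rewrite -integralB//; exact: qMi.
  by rewrite fineB//; apply: integrable_fin_num => //; exact: qMi.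
have := h M; rewrite intE => /cvgrPdist_lt/(_ 1 ltr01).
apply: filterS => n; rewrite lee_fin => hn.
have h1 : n%:R^-1 * birkhoff_sum T f n w <=
    n%:R^-1 * birkhoff_sum T (fun w => p w - qM M w) n w.
  rewrite ler_wpM2l ?invr_ge0// ler_sum// => i _.
  by rewrite fpq lerD2l lerN2 /qM ge_min lexx.
have h2 : P - A + 1 <= fine (\int[mu]_w (qM M w)%:E).
  by rewrite -lee_fin fineK//; apply: integrable_fin_num => //; exact: qMi.
by move: hn; rewrite ltr_norml => /andP[]; lra.
Qed.

End ergodic_theorem.

(** * Bounded operators and cocycles *)

Section opnorm.
Variables (R : realType) (X Y : normedModType R).
Implicit Types (f g : X -> Y) (E : set X).

Lemma opnorm_on_ub f E (M : R) : E 0 -> 0 <= M ->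
  (forall x, E x -> `|f x| <= M * `|x|) -> opnorm_on E f <= M.
Proof.
move=> E0 M0 h; apply: ge_sup.
  by exists `|f 0|, 0 => //; split => //; rewrite normr0.
move=> _ [x [Ex x1] <-]; apply: (le_trans (h _ Ex)).
by rewrite ler_piMr.
Qed.

Lemma opnorm_on_le f E x : bounded_operator f ->
  (forall (a : R) y, E y -> E (a *: y)) -> E x -> `|f x| <= opnorm_on E f * `|x|.
Proof.
move=> [lf [M hM]] EZ Ex; have [->|x0] := eqVneq x 0.
  by rewrite (linear_fun0 lf) !normr0 mulr0.
have nx : 0 < `|x| by rewrite normr_gt0.
rewrite -ler_pdivrMr// -[leLHS]mulrC.
have -> : `|x|^-1 * `|f x| = `|f (`|x|^-1 *: x)|.
  by rewrite (linear_funZ _ _ lf) normrZ ger0_norm// invr_ge0.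
apply: ub_le_sup.
  exists `|M| => _ [y [Ey y1] <-]; apply: (le_trans (hM y)).
  apply: (le_trans (ler_norm _)); rewrite normrM normr_id.
  by rewrite ler_piMr.
exists (`|x|^-1 *: x) => //; split; first exact: EZ.
by rewrite normrZ ger0_norm ?invr_ge0// mulVf// gt_eqF.
Qed.

Lemma opnorm_on_ge0 f E : E 0 -> bounded_operator f -> 0 <= opnorm_on E f.
Proof.
move=> E0 [lf [M hM]]; apply: (le_trans (normr_ge0 (f 0))); apply: ub_le_sup.
  exists `|M| => _ [y [Ey y1] <-]; apply: (le_trans (hM y)).
  apply: (le_trans (ler_norm _)); rewrite normrM normr_id.
  by rewrite ler_piMr.
by exists 0 => //; split => //; rewrite normr0.
Qed.

Lemma opnorm_ub f (M : R) : 0 <= M -> (forall x, `|f x| <= M * `|x|) ->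
  opnorm f <= M.
Proof. by move=> M0 h; apply: opnorm_on_ub => // x _; exact: h. Qed.

Lemma opnorm_le f x : bounded_operator f -> `|f x| <= opnorm f * `|x|.
Proof. by move=> bf; exact: opnorm_on_le. Qed.

Lemma opnorm_ge0 f : bounded_operator f -> 0 <= opnorm f.
Proof. exact: opnorm_on_ge0. Qed.

Lemma bounded_operatorB f g : bounded_operator f -> bounded_operator g ->
  bounded_operator (fun x => f x - g x).
Proof.
move=> bf bg; split.
  move=> a x y; case: bf => lf _; case: bg => lg _; rewrite lf lg.
  by linear_eq R.
exists (opnorm f + opnorm g) => x; apply: (le_trans (ler_normB _ _)).
by rewrite mulrDl lerD// opnorm_le.
Qed.

Lemma opdist_le f g x : bounded_operator f -> bounded_operator g ->
  `|f x - g x| <= opdist f g * `|x|.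
Proof. by move=> bf bg; apply: opnorm_le; exact: bounded_operatorB. Qed.

Lemma opdist_ub f g (M : R) : 0 <= M -> (forall x, `|f x - g x| <= M * `|x|) ->
  opdist f g <= M.
Proof. exact: opnorm_ub. Qed.

Lemma bounded_operator_continuous f : bounded_operator f -> continuous f.
Proof.
move=> bf x; apply/cvgrPdist_lt => e e0.
have p : 0 < opnorm f + 1 by have := opnorm_ge0 bf; lra.
have : \forall y \near x, `|x - y| < e / (opnorm f + 1).
  by apply: cvgr_dist_lt => //; rewrite divr_gt0.
apply: filterS => y; rewrite ltr_pdivlMr// => h.
case: (bf) => lf _; rewrite -(linear_funB _ _ lf).
apply: (le_lt_trans (opnorm_le _ bf)); apply: le_lt_trans h.
by rewrite mulrC ler_wpM2l//; lra.
Qed.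

End opnorm.

Lemma bounded_operator_comp (R : realType) (X Y Z : normedModType R)
    (g : Y -> Z) (f : X -> Y) :
  bounded_operator g -> bounded_operator f -> bounded_operator (g \o f).
Proof.
move=> bg bf; split.
  by move=> a x y /=; case: bf => lf _; case: bg => lg _; rewrite lf lg.
exists (opnorm g * opnorm f) => x /=; apply: (le_trans (opnorm_le _ bg)).
by rewrite -mulrA ler_wpM2l ?opnorm_ge0// opnorm_le.
Qed.

Lemma bounded_operator_id (R : realType) (X : normedModType R) :
  bounded_operator (id : X -> X).
Proof. by split => //; exists 1 => x; rewrite mul1r. Qed.

(** * Visits to the contracting set and contraction along the cocycle *)

Section visits.
Variables (Omega : Type) (sigma : Omega -> Omega) (G : set Omega).

Definition visits (n : nat) (w : Omega) : nat :=
  \sum_(i < n) `[< G (iter i sigma w) >].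

Lemma visits0 w : visits 0 w = 0%N. Proof. by rewrite /visits big_ord0. Qed.

Lemma visitsS n w : visits n.+1 w = (`[< G w >] + visits n (sigma w))%N.
Proof.
rewrite /visits big_ord_recl; congr (_ + _)%N.
by apply: eq_bigr => i _; rewrite -iterSr.
Qed.

Lemma visitsD n m w :
  visits (n + m) w = (visits n w + visits m (iter n sigma w))%N.
Proof.
elim: n w => [|n IH] w; first by rewrite visits0.
by rewrite addSn !visitsS IH addnA iterSr.
Qed.

Lemma visits_le n w : (visits n w <= n)%N.
Proof.
by elim: n w => [|n IH] w; rewrite ?visits0// visitsS -add1n leq_add// leq_b1.
Qed.

Lemma visits_mono n m w : (n <= m)%N -> (visits n w <= visits m w)%N.
Proof. by move=> /subnKC <-; rewrite visitsD leq_addr. Qed.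

(** A window of length k that ends by time n starts before n.+1 - k; the later starting times
    account for at most k visits. *)
Lemma visits_window n k w : (visits n w <= visits (n.+1 - k) w + k)%N.
Proof.
have nk : (n <= n.+1 - k + k)%N by lia.
by rewrite (leq_trans (visits_mono w nk))// visitsD leq_add2l visits_le.
Qed.

End visits.

Section cocycle.
Variables (R : realType) (Omega : Type) (X : normedModType R).
Variables (sigma : Omega -> Omega) (L : Omega -> X -> X) (C : set X).
Hypothesis hL : forall w, bounded_operator (L w).
Hypothesis hLC : forall w, L w @` C `<=` C.
Hypothesis hC : nice_cone C.

Local Notation A := (cocycle sigma L).
Local Notation "x <=c y" := (cone_le C x y) (at level 70, y at next level).

Lemma cocycleS n w x : A n.+1 w x = L (iter n sigma w) (A n w x).
Proof. by []. Qed.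

Lemma cocycleD n m w x : A (n + m) w x = A m (iter n sigma w) (A n w x).
Proof.
elim: m => [|m IH]; first by rewrite addn0.
by rewrite addnS !cocycleS IH -iterD addnC.
Qed.

Lemma cocycleSl n w x : A n.+1 w x = A n (sigma w) (L w x).
Proof. by rewrite -add1n cocycleD. Qed.

Lemma cocycle_bounded n w : bounded_operator (A n w).
Proof.
elim: n => [|n IH]; first exact: bounded_operator_id.
exact: bounded_operator_comp.
Qed.

Lemma cocycle_linear n w : linear (A n w).
Proof. by case: (cocycle_bounded n w). Qed.

Lemma cocycle_cone n w : A n w @` C `<=` C.
Proof.
elim: n => [|n IH] _ [x Cx <-] //=.
by apply: hLC; exists (A n w x) => //; apply: IH; exists x.
Qed.

Lemma cocycle_C n w x : C x -> C (A n w x).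
Proof. by move=> Cx; apply: (cocycle_cone (n := n) (w := w)); exists x. Qed.

Lemma cocycle_le n w x y : x <=c y -> A n w x <=c A n w y.
Proof. by apply: pos_le; [exact: cocycle_linear|exact: cocycle_cone]. Qed.

Section windows.
Variables (G : set Omega) (k : nat) (D r : R).
Hypotheses (k0 : (0 < k)%N) (D0 : 0 < D) (r0 : 0 < r) (r1 : r <= 1).
Hypothesis rk : r ^+ k = Defs.tanh (D / 4).
Hypothesis hG : forall w, G w -> ratio_diam C (expR D - 1) (A k w).

Local Notation visits := (visits sigma G).

(** A window contains at most k visits, so its contraction r ^+ k pays a factor r for each of them.
    This is how overlapping windows are accounted for without being selected. *)
Let factor_step n w : (k <= n)%N -> G w ->
  r ^+ k * r ^+ visits ((n - k).+1 - k) (iter k sigma w) <=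
  r ^+ visits (n.+1 - k) w.
Proof.
move=> kn Gw; rewrite -exprD ler_wiXn2l ?(ltW r0)//.
have [nk|nk] := leqP k (n.+1 - k).
  have -> : (n.+1 - k = k + ((n - k).+1 - k))%N by lia.
  by rewrite visitsD leq_add2r visits_le.
apply: (leq_trans (visits_le _ _ _ _)).
by apply: (leq_trans (ltnW nk)); exact: leq_addr.
Qed.

(** Strong induction on n. At a point of G a whole window is used and Hopf's estimate shrinks the
    interval; elsewhere one step is taken, and positivity alone keeps the interval. For n < k no
    window fits, and the exponent is 0. *)
Lemma interval_contraction n w u x a b : C u -> a *: u <=c x -> x <=c b *: u ->
  exists a' b', [/\ a <= a', a' <= b', b' <= b,
    b' - a' <= r ^+ visits (n.+1 - k) w * (b - a) &
    a' *: A n w u <=c A n w x /\ A n w x <=c b' *: A n w u].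
Proof.
elim/ltn_ind: n w u x a b => n IH w u x a b Cu h1 h2.
have ab : a <= b by apply: (cone_leZr_inv hC Cu); exact: (cone_le_trans hC h1).
have AZ m v c y := linear_funZ c y (cocycle_linear m v).
have [nk|kn] := ltnP n k.
  exists a, b; rewrite lexx ab lexx; split => //.
    by rewrite (_ : n.+1 - k = 0)%N ?visits0 ?expr0 ?mul1r//; lia.
  by rewrite -!AZ; split; exact: cocycle_le.
have [Gw|nGw] := pselect (G w).
  have [a' [b' [aa ab' bb t [h1' h2']]]] := hopf_contraction hC
    (cocycle_linear k w) D0 (hG Gw) Cu (cocycle_C k w Cu) h1 h2.
  have nk : (n - k < n)%N by rewrite ltn_subrL k0 (leq_trans k0 kn).
  have [a2 [b2 [aa2 ab2 bb2 t2 [h3 h4]]]] :=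
    IH _ nk (iter k sigma w) _ _ _ _ (cocycle_C k w Cu) h1' h2'.
  exists a2, b2; split.
  - exact: le_trans aa2.
  - by [].
  - exact: le_trans bb.
  - apply: (le_trans t2); rewrite -rk in t.
    apply: (le_trans (ler_wpM2l _ t)); first by rewrite exprn_ge0// ltW.
    rewrite mulrA ler_wpM2r ?subr_ge0// mulrC; exact: factor_step.
  - by rewrite -[n in A n](subnKC kn) !cocycleD.
case: n IH kn => [|n] IH kn; first by move: kn; rewrite leqn0 => /eqP kE; move: k0; rewrite kE.
have LP := pos_le (T := L w) (hL w).1 (hLC (w := w)).
have LZ c y := linear_funZ c y (hL w).1.
have [||a2 [b2 [aa2 ab2 bb2 t2 [h3 h4]]]] :=
    IH n (ltnSn n) (sigma w) (L w u) (L w x) a b (pos_cone (hLC (w := w)) Cu).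
- by rewrite -LZ; exact: LP.
- by rewrite -LZ; exact: LP.
exists a2, b2; split => //; last by rewrite !cocycleSl.
by rewrite subSn// visitsS asboolF.
Qed.

(** The first window that is met produces the finite ratio expR D - 1 and contracts nothing. Its
    visits are nevertheless counted in the exponent, which the division by tanh (D / 4) = r ^+ k
    makes up for. *)
Definition contraction_rate n w : R :=
  (expR D - 1) / Defs.tanh (D / 4) * r ^+ visits (n.+1 - k) w.

Lemma contraction_rate_ge0 n w : 0 <= contraction_rate n w.
Proof.
rewrite mulr_ge0 ?exprn_ge0 ?(ltW r0)// divr_ge0 ?(ltW (tanh_quarter_gt0 D0))//.
by rewrite subr_ge0 ltW// expR_gt1.
Qed.

Lemma ratio_diam_cocycle n w : (0 < visits (n.+1 - k) w)%N ->
  ratio_diam C (contraction_rate n w) (A n w).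
Proof.
elim/ltn_ind: n w => n IH w vn.
have kn : (k <= n)%N.
  by rewrite leqNgt; apply/negP => nk; move: vn; rewrite (_ : n.+1 - k = 0)%N ?visits0//; lia.
have [Gw|nGw] := pselect (G w).
  move=> x y Cx Cy; have [a a0 [h1 h2]] := hG Gw Cx Cy.
  have [a2 [b2 [aa2 ab2 bb2 t2 [h3 h4]]]] :=
    interval_contraction (n - k) (iter k sigma w) (cocycle_C k w Cx) h1 h2.
  have a20 : 0 < a2 by exact: lt_le_trans aa2.
  have cn z : A n w z = A (n - k) (iter k sigma w) (A k w z).
    by rewrite -cocycleD subnKC.
  exists a2 => //; rewrite !cn; split => //.
  apply: (cone_le_trans hC h4); apply: (cone_leZr hC).
    by left; do 2 apply: cocycle_C.
  have e1 : 0 <= expR D - 1 by rewrite subr_ge0 ltW// expR_gt1.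
  have t0 := tanh_quarter_gt0 D0.
  have := factor_step kn Gw; rewrite -/(visits _ _) /contraction_rate rk.
  move: t2 bb2.
  move: (r ^+ visits ((n - k).+1 - k) (iter k sigma w)) (r ^+ visits (n.+1 - k) w) => s q.
  move=> t2 bb2 sq.
  have h : (expR D - 1) * s <= (expR D - 1) / Defs.tanh (D / 4) * q.
    by rewrite -mulrA ler_wpM2l// ler_pdivlMl.
  have s0 : 0 <= s * (expR D - 1) * a.
    by apply: le_trans (_ : b2 - a2 <= _); rewrite ?subr_ge0//; lra.
  (* The width was measured relative to a; the ratio needs it relative to the new lower coefficient
     a2, which is larger. *)
  have h5 : s * (expR D - 1) * a <= s * (expR D - 1) * a2.
    rewrite ler_wpM2l//; move: s0; rewrite pmulr_lge0//.
  have h6 : (expR D - 1) * s * a2 <= (expR D - 1) / Defs.tanh (D / 4) * q * a2.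
    by rewrite ler_wpM2r// ltW.
  lra.
case: n IH kn vn => [|n] IH kn vn; first by move: kn; rewrite leqn0 => /eqP kE; move: k0; rewrite kE.
rewrite /contraction_rate subSn// visitsS asboolF// add0n in vn *.
move=> x y Cx Cy; rewrite !cocycleSl; apply: IH => //.
- exact: (pos_cone (hLC (w := w))).
- exact: (pos_cone (hLC (w := w))).
Qed.

End windows.
End cocycle.

(** * The equivariant vector and functional *)

Lemma normalized_norm (R : realType) (X : normedModType R) (x : X) :
  x != 0 -> `| `|x|^-1 *: x | = 1.
Proof.
by move=> x0; rewrite normrZ normfV normr_id mulVf// normr_eq0.
Qed.

Section perron.
Variables (R : realType) (Omega : Type) (X : completeNormedModType R).
Variables (sigma sigmaV : Omega -> Omega) (L : Omega -> X -> X) (C : set X).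
Hypothesis sigmaK : cancel sigma sigmaV.
Hypothesis sigmaVK : cancel sigmaV sigma.
Hypothesis hL : forall w, bounded_operator (L w).
Hypothesis hLC : forall w, L w @` C `<=` C.
Hypothesis hC : nice_cone C.
Variables (Dc : R).
Hypotheses (Dc1 : 1 <= Dc) (hDc : D_adapted C Dc).
(* [delta n w] controls the diameter of A n w C as soon as it is < c0. *)
Variables (delta : nat -> Omega -> R) (c0 : R).
Hypothesis c0_gt0 : 0 < c0.
Hypothesis delta_ge0 : forall n w, 0 <= delta n w.

Local Notation A := (cocycle sigma L).
Local Notation "x <=c y" := (cone_le C x y) (at level 70, y at next level).
Local Notation back n w := (iter n sigmaV w).

Hypothesis hdelta : forall n w, delta n w < c0 -> ratio_diam C (delta n w) (A n w).

Let Dc0 : 0 < Dc. Proof. exact: lt_le_trans Dc1. Qed.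

Let A_C n w x : C x -> C (A n w x). Proof. exact: cocycle_C. Qed.

Let A_gt0 n w x : C x -> 0 < `|A n w x|.
Proof. by move=> Cx; apply: (cone_norm_gt0 hC); exact: A_C. Qed.

Lemma iter_backK n w : iter n sigma (back n w) = w.
Proof. by elim: n w => [|n IH] w //; rewrite iterSr [iter n.+1 _ _]iterS sigmaVK IH. Qed.

Lemma iter_back_sub n m w : (n <= m)%N -> iter (m - n) sigma (back m w) = back n w.
Proof. by move=> nm; rewrite -{2}(subnK nm) iterD iter_backK. Qed.

Lemma cocycle_back n m w x : (n <= m)%N ->
  A m (back m w) x = A n (back n w) (A (m - n) (back m w) x).
Proof. by move=> nm; rewrite -{1}(subnK nm) cocycleD iter_back_sub. Qed.

Lemma normalized_dist n w x y : C x -> C y -> delta n w < c0 ->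
  `| `|A n w x|^-1 *: A n w x - `|A n w y|^-1 *: A n w y | <=
  2 * Dc ^+ 2 * delta n w.
Proof.
move=> Cx Cy dn; have h := hdelta dn Cx Cy.
have p z : C z -> 0 < `|A n w z|^-1 by move=> Cz; rewrite invr_gt0 A_gt0.
have q z : C z -> C (`|A n w z|^-1 *: A n w z).
  by move=> Cz; apply: (nice_cone_scale hC); [exact: p|exact: A_C].
have e z : C z -> `| `|A n w z|^-1 *: A n w z | = 1.
  by move=> Cz; apply: normalized_norm; rewrite -normr_gt0 A_gt0.
apply: (order_ratio_dist hC Dc1 hDc) => //; do ?[exact: q|exact: e].
by apply: order_ratioZ => //; exact: p.
Qed.

Section vector.
Variable x0 : X.
Hypothesis Cx0 : C x0.

Definition perron_approx (n : nat) (w : Omega) : X :=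
  `|A n (back n w) x0|^-1 *: A n (back n w) x0.

Definition perron_vector (w : Omega) : X := lim (perron_approx n w @[n --> \oo]).

Lemma perron_approx_C n w : C (perron_approx n w).
Proof.
apply: (nice_cone_scale hC); last exact: A_C.
by rewrite invr_gt0 A_gt0.
Qed.

Lemma perron_approx_norm n w : `|perron_approx n w| = 1.
Proof. by apply: normalized_norm; rewrite -normr_gt0 A_gt0. Qed.

(** The m-th approximation also comes from a vector of C at time -n, namely from the image of x0
    after m - n steps, so both vectors lie in the same image cone. *)
Lemma perron_approx_dist n m w : (n <= m)%N -> delta n (back n w) < c0 ->
  `|perron_approx n w - perron_approx m w| <= 2 * Dc ^+ 2 * delta n (back n w).
Proof.
move=> nm dn; rewrite {2}/perron_approx (cocycle_back _ _ nm).
by apply: normalized_dist => //; exact: A_C.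
Qed.

Section convergence.
Variable w : Omega.
Hypothesis hw : delta n (back n w) @[n --> \oo] --> 0.

Lemma delta_back_small e : 0 < e ->
  exists N, forall n, (N <= n)%N -> delta n (back n w) < e.
Proof.
move=> e0; have /cvgrPdist_lt/(_ e e0)[N _ hN] := hw.
by exists N => n /hN; rewrite sub0r normrN ger0_norm.
Qed.

Lemma perron_vector_cvg : perron_approx n w @[n --> \oo] --> perron_vector w.
Proof.
(* While delta is not yet below c0 nothing is known about the image cone, and 2 is the trivial bound
   for the distance of unit vectors. *)
pose b n := if delta n (back n w) < c0 then 2 * Dc ^+ 2 * delta n (back n w) else 2.
have [|e e0|l hl] := @cauchy_rate_limit _ _ (perron_approx ^~ w) b.
- move=> n m nm; rewrite /b; case: ifP => h; first exact: perron_approx_dist.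
  by apply: (le_trans (ler_normB _ _)); rewrite !perron_approx_norm.
- have K0 : 0 < 2 * Dc ^+ 2 by rewrite mulr_gt0// exprn_gt0.
  have /delta_back_small[n hn] : 0 < Num.min c0 (e / (2 * Dc ^+ 2)).
    by rewrite lt_min c0_gt0 divr_gt0.
  exists n; have := hn n (leqnn n); rewrite lt_min => /andP[h1 h2].
  by rewrite /b h1 mulrC -ltr_pdivlMr.
have bl : perron_approx n w @[n --> \oo] --> l.
  apply/cvgrPdist_lt => e e0.
  have K0 : 0 < 2 * Dc ^+ 2 by rewrite mulr_gt0// exprn_gt0.
  have /delta_back_small[N hN] : 0 < Num.min c0 (e / (2 * Dc ^+ 2)).
    by rewrite lt_min c0_gt0 divr_gt0.
  exists N => // n /= /hN; rewrite lt_min => /andP[h1 h2].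
  rewrite distrC; apply: (le_lt_trans (hl n)).
  by rewrite /b h1 mulrC -ltr_pdivlMr.
by rewrite /perron_vector (cvg_lim _ bl).
Qed.

Lemma perron_vector_norm : `|perron_vector w| = 1.
Proof.
have /cvg_norm h := perron_vector_cvg.
have h1 : `|perron_approx n w| @[n --> \oo] --> (1 : R).
  by under eq_fun do rewrite perron_approx_norm; exact: cvg_cst.
exact: (cvg_unique _ h h1).
Qed.

Lemma perron_vector_C : C (perron_vector w).
Proof.
apply: cone0_norm_gt0; last by rewrite perron_vector_norm.
apply: (closed_cvg _ (nice_cone_closed hC)) perron_vector_cvg.
by apply: nearW => n; left; exact: perron_approx_C.
Qed.

Lemma perron_vector_dist n : delta n (back n w) < c0 ->
  `|perron_approx n w - perron_vector w| <= 2 * Dc ^+ 2 * delta n (back n w).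
Proof.
move=> dn; have h : `|perron_approx n w - perron_approx m w| @[m --> \oo] -->
    `|perron_approx n w - perron_vector w|.
  by apply: cvg_norm; apply: cvgB; [exact: cvg_cst|exact: perron_vector_cvg].
rewrite -(cvg_lim _ h)//; apply: limr_le; first by apply/cvg_ex; eexists; exact: h.
by exists n => // m /= nm; exact: perron_approx_dist.
Qed.

(** The images of C under the cocycle started at time -n shrink to a single ray, so a unit vector
    lying in all of them is the limit. *)
Lemma perron_vector_unique u : `|u| = 1 ->
  (forall n, exists2 s, 0 < s & exists2 y, C y & u = s *: A n (back n w) y) ->
  u = perron_vector w.
Proof.
move=> u1 hu; apply/eqP; rewrite -subr_eq0 -normr_le0; apply/ler_addgt0Pr => e e0.
have K0 : 0 < 2 * Dc ^+ 2 by rewrite mulr_gt0// exprn_gt0.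
have /delta_back_small[N /(_ N (leqnn N))] :
    0 < Num.min c0 (e / 2 / (2 * Dc ^+ 2)) by rewrite lt_min c0_gt0 !divr_gt0.
rewrite lt_min => /andP[h1 h2].
have := perron_vector_dist h1.
have [s s0 [y Cy uE]] := hu N.
have := normalized_dist Cy Cx0 h1.
have -> : `|A N (back N w) y|^-1 *: A N (back N w) y = u.
  have := congr1 Num.norm uE; rewrite u1 normrZ gtr0_norm// => /esym E.
  rewrite uE; congr (_ *: _); have Ay := A_gt0 N (back N w) Cy.
  by apply: (mulIf (lt0r_neq0 Ay)); rewrite E mulVf// gt_eqF.
rewrite -/(perron_approx N w) => h3 h4.
have -> : u - perron_vector w = (u - perron_approx N w) + (perron_approx N w - perron_vector w).
  by linear_eq R.
apply: (le_trans (ler_normD _ _)).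
move: h2; rewrite ltr_pdivlMr// mulrC => h2; lra.
Qed.

End convergence.

(** The approximations already satisfy this with n shifted to n + 1, because going back n + 1 steps
    from sigma w is going back n steps from w. *)
Lemma perron_vector_equivariant w :
  delta n (back n w) @[n --> \oo] --> 0 ->
  delta n (back n (sigma w)) @[n --> \oo] --> 0 ->
  L w (perron_vector w) = `|L w (perron_vector w)| *: perron_vector (sigma w).
Proof.
move=> hw hsw.
have E n : L w (perron_approx n w) =
    `|L w (perron_approx n w)| *: perron_approx n.+1 (sigma w).
  have lin := (hL w).1.
  have AE : A n.+1 (back n.+1 (sigma w)) x0 = L w (A n (back n w) x0).
    by rewrite iterSr sigmaK cocycleS iter_backK.
  rewrite /perron_approx AE (linear_funZ _ _ lin) normrZ scalerA.
  rewrite ger0_norm ?invr_ge0//; congr (_ *: _).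
  rewrite mulfK// normr_eq0; apply: (cone_neq0 hC).
  exact: (pos_cone (hLC (w := w)) (A_C _ _ Cx0)).
have h1 : L w (perron_approx n w) @[n --> \oo] --> L w (perron_vector w).
  apply: continuous_cvg (perron_vector_cvg hw).
  exact: bounded_operator_continuous.
have h2 : `|L w (perron_approx n w)| *: perron_approx n.+1 (sigma w) @[n --> \oo] -->
    `|L w (perron_vector w)| *: perron_vector (sigma w).
  apply: cvgZ; first exact: cvg_norm.
  by rewrite (cvg_shiftS (perron_approx ^~ (sigma w))); exact: perron_vector_cvg.
have EE : (fun n => L w (perron_approx n w)) =
    (fun n => `|L w (perron_approx n w)| *: perron_approx n.+1 (sigma w)).
  exact/funext.
rewrite -EE in h2; exact: (cvg_unique _ h1 h2).
Qed.

End vector.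
End perron.

(** * The functional eta as an asymptotic coefficient *)

Section perron_functional.
Variables (R : realType) (Omega : Type) (X : completeNormedModType R).
Variables (sigma : Omega -> Omega) (L : Omega -> X -> X) (C : set X).
Hypothesis hL : forall w, bounded_operator (L w).
Hypothesis hLC : forall w, L w @` C `<=` C.
Hypothesis hC : nice_cone C.
Variables (Dc kappa : R).
Hypotheses (Dc1 : 1 <= Dc) (hDc : D_adapted C Dc).
Hypothesis kappa0 : 0 < kappa.
Hypothesis hkappa : forall x, exists y z, [/\ cone0 C y, cone0 C z,
  `|y| <= kappa * `|x|, `|z| <= kappa * `|x| & x = y - z].
Variables (delta : nat -> Omega -> R) (c0 : R).
Hypothesis c0_gt0 : 0 < c0.
Hypothesis delta_ge0 : forall n w, 0 <= delta n w.

Local Notation A := (cocycle sigma L).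
Local Notation "x <=c y" := (cone_le C x y) (at level 70, y at next level).

Hypothesis hdelta : forall n w, delta n w < c0 -> ratio_diam C (delta n w) (A n w).

Let Dc0 : 0 < Dc. Proof. exact: lt_le_trans Dc1. Qed.

Let A_C n w x : C x -> C (A n w x). Proof. exact: cocycle_C. Qed.

Let A_gt0 n w x : C x -> 0 < `|A n w x|.
Proof. by move=> Cx; apply: (cone_norm_gt0 hC); exact: A_C. Qed.

(* The coefficient is the supremum of the a such that a A_n u <= A_n x for some
   n: the intervals of admissible coefficients are nested and shrink. *)
Lemma cone_coefficient w x u : C x -> C u -> (exists n, delta n w < c0) ->
  exists2 c, 0 < c & forall n, delta n w < c0 ->
    `|A n w x - c *: A n w u| <= Dc * (delta n w * c) * `|A n w u| /\
    c * `|A n w u| <= (1 + delta n w) * Dc * `|A n w x|.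
Proof.
move=> Cx Cu [n0 hn0].
have AZ m v a y := linear_funZ a y (cocycle_linear sigma hL m v).
have coef n : delta n w < c0 -> exists2 a, 0 < a & a *: A n w u <=c A n w x /\
    A n w x <=c ((1 + delta n w) * a) *: A n w u.
  by move=> /hdelta/(_ u x Cu Cx).
pose S := [set a | exists n, a *: A n w u <=c A n w x].
have pushl n m a : (n <= m)%N -> a *: A n w u <=c A n w x -> a *: A m w u <=c A m w x.
  move=> nm h; rewrite -(subnKC nm) !cocycleD -AZ.
  exact: (cocycle_le sigma hL hLC).
have pushr n m a : (n <= m)%N -> A n w x <=c a *: A n w u -> A m w x <=c a *: A m w u.
  move=> nm h; rewrite -(subnKC nm) !cocycleD -AZ.
  exact: (cocycle_le sigma hL hLC).
have ubS n b : A n w x <=c b *: A n w u -> ubound S b.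
  move=> h a [m hm]; apply: (cone_leZr_inv hC (A_C (maxn n m) w Cu)).
  apply: (cone_le_trans hC (pushl _ _ _ (leq_maxr n m) hm)).
  exact: pushr (leq_maxl n m) h.
have [a1 a10 [h1 h2]] := coef n0 hn0.
have supS : has_sup S by split; [exists a1, n0|exists ((1 + delta n0 w) * a1); exact: ubS h2].
have le_c n a : a *: A n w u <=c A n w x -> a <= sup S.
  by move=> h; apply: ub_le_sup; [case: supS|exists n].
have c_gt0 : 0 < sup S by apply: (lt_le_trans a10); exact: le_c h1.
exists (sup S) => // n hn; have [a a0 [h3 h4]] := coef n hn.
have ac := le_c n a h3.
have ca : sup S <= (1 + delta n w) * a by apply: ge_sup; [case: supS|exact: ubS h4].
have CAu := A_C n w Cu; have CAx := A_C n w Cx.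
have dn := delta_ge0 n w.
split.
  apply: (cone_le_norm_sym hC hDc) => //.
  - by rewrite mulr_ge0// ltW.
  - have hle : sup S - delta n w * sup S <= a.
      have : delta n w * a <= delta n w * sup S by rewrite ler_wpM2l.
      lra.
    have := cone_le_trans hC (cone_leZr hC (cone_cone0 CAu) hle) h3.
    rewrite /cone_le; congr (cone0 C _); linear_eq R.
  - have hle : (1 + delta n w) * a <= sup S + delta n w * sup S.
      have : delta n w * a <= delta n w * sup S by rewrite ler_wpM2l.
      lra.
    have := cone_le_trans hC h4 (cone_leZr hC (cone_cone0 CAu) hle).
    rewrite /cone_le; congr (cone0 C _); linear_eq R.
have Cau : cone0 C (a *: A n w u) by apply: (cone0Z hC); [exact: ltW|left].
have := cone_le_norm hC hDc Cau (cone_cone0 CAx) h3.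
rewrite normrZ gtr0_norm// => h5; rewrite -mulrA.
apply: (@le_trans _ _ ((1 + delta n w) * a * `|A n w u|)).
  by rewrite ler_wpM2r.
by rewrite -mulrA ler_wpM2l//; lra.
Qed.

Definition relative_error w u x (c : R) (n : nat) : R :=
  `|A n w x - c *: A n w u| / `|A n w u|.

(** An intrinsic definition, for all x at once: no decomposition of x into cone vectors is chosen,
    so linearity and equivariance follow from the uniqueness of the coefficient. The default 0 is
    never met at points where delta tends to 0. *)
Definition perron_functional w u x : R^o :=
  xget 0 [set c : R | relative_error w u x c n @[n --> \oo] --> (0 : R)].

(** A bound for |eta| read off at one time n: the 2 counts the two cone vectors of a decomposition,
    kappa bounds their norms, and (1 + delta) Dc comes from [cone_coefficient]. *)
Definition functional_bound n w u : R :=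
  2 * kappa * Dc * (1 + delta n w) * opnorm (A n w) / `|A n w u|.

Section fixed_point.
Variables (w : Omega) (u : X).
Hypothesis Cu : C u.
Hypothesis hw : delta n w @[n --> \oo] --> (0 : R).

Local Notation err := (relative_error w u).
Local Notation eta := (perron_functional w u).
Local Notation B n := (functional_bound n w u).

Lemma delta_small e : 0 < e -> exists N, forall n, (N <= n)%N -> delta n w < e.
Proof.
move=> e0; have /cvgrPdist_lt/(_ e e0)[N _ hN] := hw.
by exists N => n /hN; rewrite sub0r normrN ger0_norm.
Qed.

Lemma delta_good : exists n, delta n w < c0.
Proof. by have [N /(_ N (leqnn N))] := delta_small c0_gt0; exists N. Qed.

Lemma functional_bound_ge0 n : 0 <= B n.
Proof.
rewrite /functional_bound; apply: divr_ge0 => //.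
apply: mulr_ge0; last exact/opnorm_ge0/cocycle_bounded.
by rewrite !mulr_ge0 ?(ltW kappa0) ?(ltW Dc0)//; have := delta_ge0 n w; lra.
Qed.

Lemma cone_coefficient0 y : cone0 C y ->
  exists2 c, 0 <= c & forall n, delta n w < c0 ->
    `|A n w y - c *: A n w u| <= Dc * (delta n w * c) * `|A n w u| /\
    c * `|A n w u| <= (1 + delta n w) * Dc * `|A n w y|.
Proof.
case=> [Cy|->].
  have [c c_gt0 h] := cone_coefficient Cy Cu delta_good.
  by exists c => //; exact: ltW.
exists 0 => // n _; rewrite (linear_fun0 (cocycle_linear sigma hL n w)).
by rewrite scale0r subrr normr0 mulr0 !mulr0 !mul0r.
Qed.

(** Two times are kept apart: n is a fixed time at which the size of the coefficient is bounded, m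
    goes to infinity and carries the error. *)
Lemma functional_coefficient x : exists c : R, forall n, delta n w < c0 ->
  `|c| <= B n * `|x| /\ forall m, delta m w < c0 ->
    `|A m w x - c *: A m w u| <= Dc * delta m w * (B n * `|x|) * `|A m w u|.
Proof.
have [y [z [Cy Cz ny nz xE]]] := hkappa x; subst x.
have [a a0 ha] := cone_coefficient0 Cy; have [b b0 hb] := cone_coefficient0 Cz.
exists (a - b) => n dn.
have [_ ha1] := ha n dn; have [_ hb1] := hb n dn.
have Au := A_gt0 n w Cu.
have ab : a + b <= B n * `|y - z|.
  rewrite /functional_bound mulrAC ler_pdivlMr// mulrDl.
  apply: (le_trans (lerD ha1 hb1)); rewrite -mulrDr.
  have -> : 2 * kappa * Dc * (1 + delta n w) * opnorm (A n w) * `|y - z| =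
    (1 + delta n w) * Dc * (opnorm (A n w) * (kappa * `|y - z|) +
      opnorm (A n w) * (kappa * `|y - z|)) by ring.
  have dn0 := delta_ge0 n w.
  rewrite ler_wpM2l ?mulr_ge0 ?(ltW Dc0)//; first lra.
  have bA := cocycle_bounded sigma hL n w.
  by apply: lerD; apply: (le_trans (opnorm_le _ bA)); rewrite ler_wpM2l ?opnorm_ge0.
split.
  apply: le_trans ab; apply: (le_trans (ler_normB _ _)).
  by rewrite !ger0_norm.
move=> m dm; have [ha2 _] := ha m dm; have [hb2 _] := hb m dm.
rewrite (linear_funB _ _ (cocycle_linear sigma hL m w)).
have -> : A m w y - A m w z - (a - b) *: A m w u =
  (A m w y - a *: A m w u) - (A m w z - b *: A m w u) by linear_eq R.
apply: (le_trans (ler_normB _ _)); apply: (le_trans (lerD ha2 hb2)).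
have -> : Dc * (delta m w * a) * `|A m w u| + Dc * (delta m w * b) * `|A m w u| =
  Dc * delta m w * (a + b) * `|A m w u| by ring.
by rewrite ler_wpM2r// ler_wpM2l// mulr_ge0// ltW.
Qed.

Lemma relative_error_cvg x c (K : R) :
  (forall m, delta m w < c0 ->
    `|A m w x - c *: A m w u| <= delta m w * K * `|A m w u|) ->
  err x c n @[n --> \oo] --> (0 : R).
Proof.
move=> h; apply/cvgrPdist_lt => e e0.
have K0 : 0 < `|K| + 1 by have := normr_ge0 K; lra.
have [|N hN] := delta_small (e := Num.min c0 (e / (`|K| + 1))).
  by rewrite lt_min c0_gt0 divr_gt0.
exists N => // n /= /hN; rewrite lt_min => /andP[d1 d2].
rewrite sub0r normrN /relative_error ger0_norm ?divr_ge0//.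
rewrite ltr_pdivrMr ?A_gt0//; apply: (le_lt_trans (h n d1)).
rewrite ltr_pM2r ?A_gt0//; move: d2; rewrite ltr_pdivlMr// => d2.
apply: le_lt_trans d2; rewrite ler_wpM2l//.
by have := ler_norm K; lra.
Qed.

Lemma relative_error_unique x c c' :
  err x c n @[n --> \oo] --> (0 : R) -> err x c' n @[n --> \oo] --> (0 : R) ->
  c = c'.
Proof.
move=> h h'; apply/eqP; rewrite -subr_eq0 -normr_le0; apply/ler_addgt0Pr => e e0.
have e2 : 0 < e / 2 by rewrite divr_gt0.
have /cvgrPdist_lt/(_ _ e2)[N _ hN] := h.
have /cvgrPdist_lt/(_ _ e2)[N' _ hN'] := h'.
have := hN (maxn N N') (leq_maxl _ _); have := hN' (maxn N N') (leq_maxr _ _).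
rewrite /= !sub0r !normrN /relative_error; set n := maxn N N'.
have Au := A_gt0 n w Cu.
rewrite ![`|_ / _|]ger0_norm ?divr_ge0// !ltr_pdivrMr// => h1 h2.
have : `|c - c'| * `|A n w u| <= e * `|A n w u|.
  rewrite -normrZ.
  have -> : (c - c') *: A n w u =
    (A n w x - c' *: A n w u) - (A n w x - c *: A n w u) by linear_eq R.
  by apply: (le_trans (ler_normB _ _)); lra.
by rewrite ler_pM2r// add0r.
Qed.

Lemma perron_functional_eq x (c : R) : err x c n @[n --> \oo] --> (0 : R) ->
  eta x = c.
Proof.
move=> h; apply: (@relative_error_unique x) => //.
exact: (@xgetPex _ 0 [set c : R | relative_error w u x c n @[n --> \oo] --> (0 : R)]
  (ex_intro _ c h)).
Qed.

Lemma perron_functional_bound x n : delta n w < c0 -> `|eta x| <= B n * `|x|.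
Proof.
move=> dn; have [c hc] := functional_coefficient x.
have [h1 h2] := hc n dn.
rewrite (@perron_functional_eq x c)//.
apply: (@relative_error_cvg _ _ (Dc * (B n * `|x|))) => m /h2 h.
by rewrite mulrA (mulrC _ Dc).
Qed.

Lemma perron_functional_approx x n m : delta n w < c0 -> delta m w < c0 ->
  `|A m w x - (eta x : R) *: A m w u| <=
    Dc * delta m w * (B n * `|x|) * `|A m w u|.
Proof.
move=> dn dm; have [c hc] := functional_coefficient x.
have [h1 h2] := hc n dn.
rewrite (@perron_functional_eq x c); first exact: h2.
apply: (@relative_error_cvg _ _ (Dc * (B n * `|x|))) => j /h2 h.
by rewrite mulrA (mulrC _ Dc).
Qed.

Lemma perron_functional_err x : err x (eta x) n @[n --> \oo] --> (0 : R).
Proof.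
have [n dn] := delta_good.
apply: (@relative_error_cvg _ _ (Dc * (B n * `|x|))) => m dm.
by rewrite mulrA (mulrC _ Dc); exact: perron_functional_approx.
Qed.

Lemma perron_functional_linear : linear eta.
Proof.
move=> a x y; apply: perron_functional_eq.
have h1 := perron_functional_err x; have h2 := perron_functional_err y.
have h : `|a| * err x (eta x) n + err y (eta y) n @[n --> \oo] --> (0 : R).
  rewrite (_ : 0 = `|a| * 0 + 0 :> R); last by rewrite mulr0 addr0.
  by apply: cvgD => //; apply: cvgM => //; exact: cvg_cst.
apply: (squeeze_cvgr _ (cvg_cst 0) h); apply: nearW => n.
rewrite divr_ge0//= /relative_error mulrA -mulrDl.
rewrite ler_pM2r ?invr_gt0 ?A_gt0// -normrZ (cocycle_linear sigma hL).
apply: le_trans (ler_normD _ _); rewrite le_eqVlt; apply/orP; left; apply/eqP.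
congr (`|_|); rewrite -[a *: (eta x : R^o)]/(a * eta x).
by linear_eq R.
Qed.

Lemma perron_functional_bounded : bounded_operator eta.
Proof.
split; first exact: perron_functional_linear.
have [n dn] := delta_good; exists (B n) => x; exact: perron_functional_bound.
Qed.

Lemma perron_functional_self : eta u = 1.
Proof.
apply: perron_functional_eq; apply: (@relative_error_cvg _ _ 0) => m _.
by rewrite scale1r subrr normr0 mulr0 mul0r.
Qed.

Lemma perron_functional_gt0 x : C x -> 0 < (eta x : R).
Proof.
move=> Cx; have [c c_gt0 h] := cone_coefficient Cx Cu delta_good.
rewrite (@perron_functional_eq x c)//.
apply: (@relative_error_cvg _ _ (Dc * c)) => m /h[+ _].
by rewrite mulrCA.
Qed.

End fixed_point.

(** The relative error of L w x at sigma w at time n, for the coefficient phi c, is phi times the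
    relative error of x at w at time n + 1. Uniqueness of the coefficient concludes. *)
Lemma perron_functional_equivariant w u u' (phi : R) x : C u -> C u' ->
  delta n w @[n --> \oo] --> (0 : R) ->
  delta n (sigma w) @[n --> \oo] --> (0 : R) ->
  0 < phi -> L w u = phi *: u' ->
  perron_functional (sigma w) u' (L w x) = phi * perron_functional w u x.
Proof.
move=> Cu Cu' hw hsw phi0 Lu.
apply: (perron_functional_eq Cu') => //.
have := perron_functional_err Cu hw x; rewrite -cvg_shiftS /= => h.
have : phi * relative_error w u x (perron_functional w u x) n.+1 @[n --> \oo] --> (0 : R).
  rewrite -[X in _ --> X](mulr0 phi); apply: cvgM => //; exact: cvg_cst.
apply: cvg_trans; apply: near_eq_cvg; apply: nearW => n.
have AZ := linear_funZ _ _ (cocycle_linear sigma hL n (sigma w)).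
rewrite /relative_error !cocycleSl Lu AZ normrZ gtr0_norm//.
rewrite scalerA (mulrC (perron_functional _ _ _ : R) phi).
have Au' := A_gt0 n (sigma w) Cu'.
have key (N M : R) : M != 0 -> phi * (N / (phi * M)) = N / M.
  by move=> M0; field; rewrite M0 gt_eqF.
by rewrite key// gt_eqF.
Qed.

End perron_functional.

(** * Strong measurability in separable spaces *)

Lemma count_bigcup_measurable d (Omega : measurableType d) (I : countType)
    (P : set I) (F : I -> set Omega) :
  (forall i, P i -> measurable (F i)) -> measurable (\bigcup_(i in P) F i).
Proof.
move=> mF; rewrite bigcup_mkcond; apply: countable_bigcupT_measurable => // i.
by case: ifP => //; rewrite inE; exact: mF.
Qed.

Lemma count_bigcap_measurable d (Omega : measurableType d) (I : countType)
    (F : I -> set Omega) :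
  (forall i, measurable (F i)) -> measurable (\bigcap_i F i).
Proof.
move=> mF; rewrite -[X in measurable X]setCK setC_bigcap; apply: measurableC.
by apply: count_bigcup_measurable => i _; exact/measurableC.
Qed.

Lemma measurable_preimage_generated d (Omega : measurableType d) (T : Type)
    (D : set Omega) (f : Omega -> T) (U : set T) (G : set (set T)) :
  measurable D -> (forall w, D w -> U (f w)) ->
  (forall B, G B -> measurable (D `&` f @^-1` B)) ->
  forall B, <<s U, G >> B -> measurable (D `&` f @^-1` B).
Proof.
move=> mD fU mG B /(_ [set B | measurable (D `&` f @^-1` B)]); apply.
split; last exact: mG.
split.
- by rewrite /= preimage_set0 setI0.
- move=> E /= mE; rewrite (_ : D `&` f @^-1` (U `\` E) = D `\` (D `&` f @^-1` E)).
    exact: measurableD.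
  apply/seteqP; split => w /=; first by move=> [Dw [_ nE]]; split => // -[].
  by move=> [Dw h]; split => //; split; [exact: fU|move=> Ew; exact: h].
- by move=> F /= mF; rewrite preimage_bigcup setI_bigcupr; exact: bigcupT_measurable.
Qed.

Lemma dense_sequence (R : realType) (X : normedModType R) : separable X ->
  exists s : nat -> X, forall x e, 0 < e -> exists n, `|x - s n| < e.
Proof.
move=> [S cS dS].
have [||x0 [_ Sx0]] := dS setT; [by exists 0|exact: openT|].
have /pfcard_geP[S0|[s]] := cS; first by rewrite S0 in Sx0.
exists s => x e e0; have [||y [xy Sy]] := dS (ball x e).
  by exists x; exact: ballxx.
  exact: ball_open.
have [n _ sn] := 'surj_s Sy; exists n; rewrite sn.
by move: xy; rewrite -ball_normE.
Qed.

Lemma measurable_fun_lt_sets d (Omega : measurableType d) (R : realType)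
    (D : set Omega) (f : Omega -> R) :
  (forall c, measurable (D `&` [set w | f w < c])) -> measurable_fun D f.
Proof.
move=> h mD; apply: (measurability _ (RGenInftyO.measurableE R)) => //.
by move=> /= _ [_ [a ->] <-]; rewrite preimage_itvNyo; exact: h.
Qed.

Lemma measurable_fun_lt d (Omega : measurableType d) (R : realType)
    (D : set Omega) (f : Omega -> R) c : measurable D -> measurable_fun D f ->
  measurable (D `&` [set w | f w < c]).
Proof. by move=> mD mf; apply: measurable_set_lt => //; exact: measurable_cst. Qed.

Lemma measurable_fun_le d (Omega : measurableType d) (R : realType)
    (D : set Omega) (f : Omega -> R) c : measurable D -> measurable_fun D f ->
  measurable (D `&` [set w | f w <= c]).
Proof. by move=> mD mf; apply: measurable_set_le => //; exact: measurable_cst. Qed.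

Lemma measurable_fun_ge d (Omega : measurableType d) (R : realType)
    (D : set Omega) (f : Omega -> R) c : measurable D -> measurable_fun D f ->
  measurable (D `&` [set w | c <= f w]).
Proof. by move=> mD mf; apply: measurable_set_le => //; exact: measurable_cst. Qed.

(* For separable X this is equivalent to Borel measurability. *)
Definition norm_measurable (R : realType) d (Omega : measurableType d)
    (X : normedModType R) (D : set Omega) (f : Omega -> X) : Prop :=
  forall x, measurable_fun D (fun w => `|f w - x|).

Lemma strongly_measurable_eval (R : realType) d (Omega : measurableType d)
    (X Y : normedModType R) (D : set Omega) (A : Omega -> X -> Y) x :
  strongly_measurable D A -> norm_measurable D (fun w => A w x).
Proof.
move=> mA y; apply: measurable_fun_lt_sets => c.
apply: (mA [set g : X -> Y | `|g x - y| < c]).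
apply: sub_sigma_algebra; rewrite openE => g /= gc; rewrite /interior.
have FF : Filter (nbhs (g : {ptws X -> Y})) by exact: nbhs_filter.
have gg : {ptws, nbhs (g : {ptws X -> Y}) --> g} by exact: cvg_id.
have /cvgrPdist_lt/(_ (c - `|g x - y|)) := (pointwise_cvgP g FF).1 gg x.
rewrite subr_gt0 => /(_ gc); apply: filterS => h hg.
have := ler_normD (h x - g x) (g x - y); rewrite addrA subrK.
by move: hg; rewrite distrC /=; lra.
Qed.

Definition inv_succ {R : realType} (m : nat) : R := m.+1%:R^-1.
Arguments inv_succ : simpl never.

Lemma inv_succ_gt0 (R : realType) m : 0 < inv_succ m :> R.
Proof. by rewrite /inv_succ invr_gt0. Qed.

Lemma inv_succ_lt (R : realType) (e : R) : 0 < e -> exists m, inv_succ m < e.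
Proof.
move=> e0; exists (Num.truncn e^-1); rewrite /inv_succ invf_plt ?posrE//.
exact: truncnS_gt.
Qed.

Section separable.
Variables (R : realType) (X : normedModType R).
Variable s : nat -> X.
Hypothesis hs : forall x e, 0 < e -> exists n, `|x - s n| < e.
Variables (d : measure_display) (Omega : measurableType d) (D : set Omega).
Hypothesis mD : measurable D.
Implicit Types (f : Omega -> X).

(* H w (f w) < c iff for some p, m one has H w (s i) <= c - 1/p whenever
   |f w - s i| < 1/m. *)
Lemma measurable_caratheodory f (H : Omega -> X -> R) : norm_measurable D f ->
  (forall x, measurable_fun D (H ^~ x)) -> (forall w, D w -> continuous (H w)) ->
  measurable_fun D (fun w => H w (f w)).
Proof.
move=> mf mH cH; apply: measurable_fun_lt_sets => c.
rewrite (_ : _ `&` _ = \bigcup_(p : nat) \bigcup_(m : nat) \bigcap_(i : nat)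
   ((D `&` [set w | inv_succ m <= `|f w - s i|]) `|`
    (D `&` [set w | H w (s i) <= c - inv_succ p]))).
  do 2 (apply: bigcupT_measurable => ?); apply: bigcapT_measurable => i.
  by apply: measurableU; [exact: measurable_fun_ge|exact: measurable_fun_le].
apply/seteqP; split => w.
  move=> [Dw /= hc].
  have [p hp] : exists p : nat, inv_succ p < c - H w (f w).
    by apply: inv_succ_lt; rewrite subr_gt0.
  have e0 : 0 < c - H w (f w) - inv_succ p by rewrite subr_gt0.
  have /cvgrPdist_lt/(_ _ e0)/nbhs_ballP[r /= r0 hr] := cH w Dw (f w).
  have [m hm] := inv_succ_lt r0.
  exists p => //; exists m => // i _.
  have [h|h] := leP (inv_succ m) `|f w - s i|; [by left|right; split => //=].
  have := hr (s i); rewrite -ball_normE /= => /(_ (lt_trans h hm)).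
  rewrite ltr_norml => /andP[h1 _]. lra.
move=> [p _ [m _ h]].
have Dw : D w by case: (h 0%N I) => -[].
split => //=; rewrite ltNge; apply/negP => hc.
have e0 : 0 < inv_succ p :> R by exact: inv_succ_gt0.
have /cvgrPdist_lt/(_ _ e0)/nbhs_ballP[r /= r0 hr] := cH w Dw (f w).
have mr : 0 < Num.min r (inv_succ m) by rewrite lt_min r0 inv_succ_gt0.
have [i] := hs (f w) mr; rewrite lt_min => /andP[h1 h2].
case: (h i I) => -[_ /=]; first by rewrite leNgt h2.
have := hr (s i); rewrite -ball_normE /= => /(_ h1).
by rewrite ltr_norml => /andP[h3 h4]; lra.
Qed.

Lemma norm_measurable_apply (Y : normedModType R) (F : Omega -> X -> Y) f :
  norm_measurable D f -> (forall x, norm_measurable D (F ^~ x)) ->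
  (forall w, D w -> continuous (F w)) -> norm_measurable D (fun w => F w (f w)).
Proof.
move=> mf mF cF y.
apply: (measurable_caratheodory (H := fun w x => `|F w x - y|)) => //.
  by move=> x; exact: mF.
move=> w Dw x; apply: cvg_norm; apply: cvgB; [exact: cF|exact: cvg_cst].
Qed.

Lemma norm_measurableB f g : norm_measurable D f -> norm_measurable D g ->
  norm_measurable D (fun w => f w - g w).
Proof.
move=> mf mg; apply: (norm_measurable_apply (F := fun w x => f w - x)) => //.
  move=> x y; have := mf (x + y); congr (measurable_fun _ _).
  by apply/funext => w; rewrite opprD addrA.
by move=> w Dw x; apply: cvgB; [exact: cvg_cst|exact: cvg_id].
Qed.

Lemma norm_measurable_norm f : norm_measurable D f ->
  measurable_fun D (fun w => `|f w|).
Proof. by move=> /(_ 0); congr (measurable_fun _ _); apply/funext => w; rewrite subr0. Qed.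

Lemma norm_measurable_lim (fn : nat -> Omega -> X) f :
  (forall n, norm_measurable D (fn n)) ->
  (forall w, D w -> fn n w @[n --> \oo] --> f w) -> norm_measurable D f.
Proof.
move=> mfn fnf x; apply: (measurable_fun_cvg (fun n => mfn n x)) => w Dw.
by apply: cvg_norm; apply: cvgB; [exact: fnf|exact: cvg_cst].
Qed.

Lemma norm_measurable_open f (O : set X) : norm_measurable D f -> open O ->
  measurable (D `&` f @^-1` O).
Proof.
move=> mf oO; rewrite (_ : _ `&` _ = \bigcup_(i in
    [set i : nat * nat | forall x, `|x - s i.1| < inv_succ i.2 -> O x])
  (D `&` [set w | `|f w - s i.1| < inv_succ i.2])).
  by apply: count_bigcup_measurable => i _; exact: measurable_fun_lt.
apply/seteqP; split => w /=; last first.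
  by move=> [i /= hi [Dw /= hw]]; split => //; exact: hi.
move=> [Dw Of]; have [r /= r0 hr] := (nbhs_ballP _ _).1 (open_nbhs_nbhs (conj oO Of)).
have [m hm] := inv_succ_lt (divr_gt0 r0 (ltr0n R 2)).
have m0 : 0 < inv_succ m :> R by exact: inv_succ_gt0.
have [i hi] := hs (f w) m0; exists (i, m) => //= x hx; apply: hr.
rewrite -ball_normE /=; have := ler_normD (f w - s i) (s i - x).
by rewrite addrA subrK (distrC (s i)); lra.
Qed.

Lemma norm_measurable_borel f : norm_measurable D f -> borel_measurable D f.
Proof.
move=> mf; apply: measurable_preimage_generated => // B.
exact: norm_measurable_open.
Qed.

Lemma norm_measurable_closed f (F : set X) : norm_measurable D f -> closed F ->
  measurable (D `&` f @^-1` F).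
Proof.
move=> mf cF; rewrite (_ : _ `&` _ = D `\` (D `&` f @^-1` (~` F))).
  by apply: measurableD => //; apply: norm_measurable_open => //; exact: closed_openC.
apply/seteqP; split => w /=; first by move=> [Dw Fw]; split => // -[].
by move=> [Dw h]; split => //; apply: contrapT => nF; exact: h.
Qed.

End separable.

Lemma norm_measurable_real (R : realType) d (Omega : measurableType d)
    (D : set Omega) (f : Omega -> R) : measurable_fun D f ->
  norm_measurable D (f : Omega -> R^o).
Proof.
move=> mf x; apply: measurableT_comp; first exact: normr_measurable.
by apply: measurable_funB => //; exact: measurable_cst.
Qed.

Lemma norm_measurableZ (R : realType) (X : normedModType R) d
    (Omega : measurableType d) (D : set Omega) (s : nat -> X)
    (hs : forall x e, 0 < e -> exists n, `|x - s n| < e)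
    (a : Omega -> R) (f : Omega -> X) : measurable D ->
  measurable_fun D a -> norm_measurable D f ->
  norm_measurable D (fun w => a w *: f w).
Proof.
move=> mD ma mf.
apply: (norm_measurable_apply hs mD (F := fun w x => a w *: x)) => //.
  move=> x y; apply: (@measurableT_comp _ _ _ _ _ _ (fun c : R => `|c *: x - y|) _ a) => //.
  apply: continuous_measurable_fun => c.
  by apply: cvg_norm; apply: cvgB; [apply: cvgZr_tmp; exact: cvg_id|exact: cvg_cst].
by move=> w Dw x; apply: cvgZl_tmp; exact: cvg_id.
Qed.

Section strong_measurability.
Variables (R : realType) (X Y : normedModType R).
Variables (s : nat -> X) (t : nat -> Y).
Hypothesis hs : forall x e, 0 < e -> exists n, `|x - s n| < e.
Hypothesis ht : forall y e, 0 < e -> exists n, `|y - t n| < e.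

Lemma bounded_on_dense (f : X -> Y) (M : R) : bounded_operator f -> 0 <= M ->
  (forall i, `|f (s i)| <= M * `|s i|) -> forall x, `|f x| <= M * `|x|.
Proof.
move=> bf M0 h x; apply/ler_addgt0Pr => e e0.
have p : 0 < opnorm f + M + 1 by have := opnorm_ge0 bf; lra.
have [i hi] := hs x (divr_gt0 e0 p); rewrite ltr_pdivlMr// in hi.
have := ler_normD (f x - f (s i)) (f (s i)); rewrite subrK.
have := opnorm_le (x - s i) bf; rewrite (linear_funB _ _ bf.1).
have := ler_normB x (x - s i); rewrite opprB addrC subrK => h1.
have : M * `|s i| <= M * (`|x| + `|x - s i|) by rewrite ler_wpM2l.
have := h i; rewrite mulrDr.
have := normr_ge0 (x - s i).
lra.
Qed.

Variables (d : measure_display) (Omega : measurableType d) (D : set Omega).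
Hypothesis mD : measurable D.
Variable A : Omega -> X -> Y.
Hypothesis bA : forall w, D w -> bounded_operator (A w).
Hypothesis mA : forall x, norm_measurable D (A ^~ x).

(** A bound on the dense sequence extends to all of X, so only countably many conditions occur. *)
Lemma measurable_bounded_by (M : R) : 0 <= M ->
  measurable (D `&` [set w | forall x, `|A w x| <= M * `|x|]).
Proof.
move=> M0; rewrite (_ : _ `&` _ = \bigcap_i (D `&` [set w | `|A w (s i)| <= M * `|s i|])).
  apply: bigcapT_measurable => i; apply: measurable_fun_le => //.
  exact: norm_measurable_norm.
apply/seteqP; split => w /=; first by move=> [Dw h] i _; split => //=; exact: h.
move=> h; have Dw : D w by case: (h 0%N I).
split => //; apply: bounded_on_dense => // [|i]; first exact: bA.
by case: (h i I).
Qed.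

Lemma measurable_opnorm : measurable_fun D (fun w => opnorm (A w)).
Proof.
apply: measurable_fun_lt_sets => c.
rewrite (_ : _ `&` _ = \bigcup_(p in [set p : nat | 0 <= c - inv_succ p])
    (D `&` [set w | forall x, `|A w x| <= (c - inv_succ p) * `|x|])).
  by apply: bigcup_measurable => p /= hp; exact: measurable_bounded_by.
apply/seteqP; split => w /=.
  move=> [Dw hc]; have [p hp] : exists p : nat, inv_succ p < c - opnorm (A w).
    by apply: inv_succ_lt; rewrite subr_gt0.
  have o0 := opnorm_ge0 (bA Dw).
  exists p => /=; first lra.
  split => // x; apply: (le_trans (opnorm_le _ (bA Dw))).
  by rewrite ler_wpM2r//; lra.
move=> [p /= hp [Dw h]]; split => //; apply: (le_lt_trans (opnorm_ub hp h)).
by rewrite ltrBlDr ltrDl inv_succ_gt0.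
Qed.

(** A finite list of indices encodes a basic neighbourhood for pointwise convergence; there are
    countably many such lists. *)
Let basic (T : X -> Y) (F : seq (nat * nat * nat)) : Prop :=
  forall p, p \in F -> `|T (s p.1.1) - t p.1.2| < inv_succ p.2.

Let bounded_by (M : R) (T : X -> Y) : Prop :=
  linear T /\ forall x, `|T x| <= M * `|x|.

Lemma measurable_basic F : measurable (D `&` [set w | basic (A w) F]).
Proof.
elim: F => [|p F IH].
  rewrite (_ : _ `&` _ = D)//; apply/seteqP; split => w /=; first by case.
  by move=> Dw; split.
rewrite (_ : _ `&` _ = (D `&` [set w | basic (A w) F]) `&`
  (D `&` [set w | `|A w (s p.1.1) - t p.1.2| < inv_succ p.2])).
  by apply: measurableI => //; apply: measurable_fun_lt => //; exact: mA.
apply/seteqP; split => w /=.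
  move=> [Dw h]; split; split => //.
    by move=> q qF; apply: h; rewrite inE qF orbT.
  by apply: h; rewrite inE eqxx.
move=> [[Dw h1] [_ h2]]; split => // q; rewrite inE => /orP[/eqP ->//|].
exact: h1.
Qed.

(* On a norm-bounded set of operators the topology of pointwise convergence has
   a countable basis. *)
Lemma strong_open_basis (T0 : X -> Y) (M : R) (O : set (X -> Y)) : 0 <= M ->
  bounded_by M T0 -> nbhs (T0 : {ptws X -> Y}) O ->
  exists2 F, basic T0 F & forall T, bounded_by M T -> basic T F -> O T.
Proof.
move=> M0 [lT0 bT0] nO.
pose FF := filter_from [set F | basic T0 F]
  (fun F => [set T | bounded_by M T /\ basic T F]).
have FFF : Filter FF.
  apply: filter_from_filter; first by exists [::].
  move=> F G hF hG; exists (F ++ G).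
    by move=> p; rewrite mem_cat => /orP[/hF|/hG].
  move=> T [bT hT]; split; split => // p pF; apply: hT; rewrite mem_cat pF ?orbT//.
(* Stated as convergence of the filter [FF], the claim for an arbitrary neighbourhood reduces to
   evaluations at single points. *)
have /(_ _ nO) [F hF hO] : {ptws, FF --> T0}.
  apply/pointwise_cvgP => x; apply/cvgrPdist_lt => e e0.
  have p : 0 < 4 * (M + 1) by lra.
  have [i hi] := hs x (divr_gt0 e0 p); rewrite ltr_pdivlMr// in hi.
  have [n hn] := inv_succ_lt (divr_gt0 e0 (ltr0n R 8)).
  have n0 : 0 < inv_succ n :> R by exact: inv_succ_gt0.
  have [j hj] := ht (T0 (s i)) n0.
  exists [:: (i, j, n)]; first by move=> q; rewrite inE => /eqP ->.
  move=> T [[lT bT] /(_ (i, j, n))]; rewrite inE eqxx => /(_ isT)/= h.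
  have h1 := bT (x - s i); have h2 := bT0 (x - s i).
  rewrite (linear_funB _ _ lT) in h1; rewrite (linear_funB _ _ lT0) in h2.
  have -> : T0 x - T x = (T0 x - T0 (s i)) + (T0 (s i) - t j) - (T (s i) - t j)
     - (T x - T (s i)) by linear_eq R.
  apply: (le_lt_trans (ler_normB _ _)).
  apply: (le_lt_trans (lerD (ler_normB _ _) (lexx _))).
  apply: (le_lt_trans (lerD (lerD (ler_normD _ _) (lexx _)) (lexx _))).
  have := normr_ge0 (x - s i); lra.
by exists F => // T bT hT; apply: hO.
Qed.

Lemma strongly_measurable_pointwise : strongly_measurable D A.
Proof.
apply: (measurable_preimage_generated (U := setT)) => // O oO.
rewrite (_ : _ `&` _ = \bigcup_(i in [set i : nat * seq (nat * nat * nat) |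
    forall T, bounded_by i.1%:R T -> basic T i.2 -> O T])
  ((D `&` [set w | forall x, `|A w x| <= i.1%:R * `|x|]) `&`
   (D `&` [set w | basic (A w) i.2]))).
  apply: count_bigcup_measurable => i _; apply: measurableI.
    exact: measurable_bounded_by.
  exact: measurable_basic.
apply/seteqP; split => w /=; last first.
  move=> [i /= hi [[Dw h1] [_ h2]]]; split => //; apply: hi => //.
  by split => //; case: (bA Dw).
move=> [Dw Ow]; pose M := (Num.truncn (opnorm (A w))).+1.
have bw : forall x, `|A w x| <= M%:R * `|x|.
  move=> x; apply: (le_trans (opnorm_le _ (bA Dw))).
  by rewrite ler_wpM2r// ltW// truncnS_gt.
have [//|||F hF hO] := @strong_open_basis (A w) M%:R O.
- by split => //; case: (bA Dw).
- exact: (open_nbhs_nbhs (conj oO Ow)).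
by exists (M, F).
Qed.

End strong_measurability.

(** * Measurability of the contraction condition for separable X *)

Section measurable_ratio_diam.
Variables (R : realType) (X : normedModType R) (C : set X).
Hypothesis hC : nice_cone C.
Variables (s : nat -> X).
Hypothesis hs : forall x e, 0 < e -> exists n, `|x - s n| < e.
Variables (d : measure_display) (Omega : measurableType d).
Variable T : Omega -> X -> X.
Hypothesis bT : forall w, bounded_operator (T w).
Hypothesis posT : forall w, T w @` C `<=` C.
Hypothesis mT : forall x, norm_measurable setT (T ^~ x).

(** The sequence s may miss C altogether, so for each s n and each radius 1 / (m + 1) a point of C
    within that radius is chosen, and x0 if there is none. *)
Lemma dense_sequence_in x0 : C x0 -> exists2 c : nat * nat -> X,
  forall i, C (c i) & forall x e, C x -> 0 < e -> exists i, `|x - c i| < e.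
Proof.
move=> Cx0; have /choice[c hc] : forall i : nat * nat, exists y, C y /\
    ((exists2 z, C z & `|z - s i.1| < inv_succ i.2) -> `|y - s i.1| < inv_succ i.2).
  move=> i; have [[z Cz hz]|h] := pselect (exists2 z, C z & `|z - s i.1| < inv_succ i.2).
    by exists z.
  by exists x0.
exists c; first by move=> i; case: (hc i).
move=> x e Cx e0; have [m hm] := inv_succ_lt (divr_gt0 e0 (ltr0n R 2)).
have m0 : 0 < inv_succ m :> R by exact: inv_succ_gt0.
have [n hn] := hs x m0; exists (n, m).
have [_ /(_ (ex_intro2 _ _ x Cx hn)) h] := hc (n, m).
have := ler_normB (x - s n) (c (n, m) - s n); rewrite opprB addrA subrK.
by move: h => /=; lra.
Qed.

(** The comparison is tested on a dense sequence of C, with rational coefficients and a slack 1 / (m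
    + 1) that makes room for them; [order_ratio_closed] removes the slack and returns to all of
    C. *)
Lemma measurable_ratio_diam (dl : R) : 0 <= dl ->
  measurable [set w | ratio_diam C dl (T w)].
Proof.
move=> dl0; have [x0 [_ [Cx0 _ _]]] := nice_cone_generating hC 0.
have [c Cc hc] := dense_sequence_in Cx0.
have [Dc Dc1 hDc] := nice_cone_adapted hC.
rewrite (_ : mkset _ = \bigcap_(i : nat * nat) \bigcap_(j : nat * nat)
   \bigcap_(m : nat) \bigcup_(q in [set q : rat | 0 < ratr q :> R])
   ((setT `&` (fun w => T w (c j - ratr q *: c i)) @^-1` cone0 C) `&`
    (setT `&` (fun w => T w (((1 + dl + inv_succ m) * ratr q) *: c i - c j)) @^-1` cone0 C))).
  do 3 (apply: count_bigcap_measurable => ?); apply: count_bigcup_measurable => q _.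
  by apply: measurableI; apply: (norm_measurable_closed hs) => //;
    exact: nice_cone_closed hC.
have TB w := linear_funB _ _ (bT w).1; have TZ w := linear_funZ _ _ (bT w).1.
apply/seteqP; split => w /=.
  move=> h i _ j _ m _; have [a a0 [h1 h2]] := h _ _ (Cc i) (Cc j).
  have m0 : 0 < inv_succ m :> R by exact: inv_succ_gt0.
  (* Any rational q in between serves: q <= a keeps the lower inequality, and (1 + dl) a <= (1 + dl
     + 1 / (m + 1)) q keeps the upper one. *)
  have lt : (1 + dl) * a / (1 + dl + inv_succ m) < a.
    rewrite ltr_pdivrMr; last lra.
    have : 0 < a * inv_succ m by rewrite mulr_gt0.
    by lra.
  have [q] := rat_in_itvoo lt; rewrite in_itv /= => /andP[q1 q2].
  have q0 : 0 < ratr q :> R.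
    by apply: le_lt_trans q1; rewrite divr_ge0 ?mulr_ge0 ?(ltW a0)//; lra.
  have CT : cone0 C (T w (c i)) by left; exact: (pos_cone (posT (w := w))).
  exists q => //; split; split => //=; rewrite TB TZ.
    by apply: (cone_le_trans hC _ h1); apply: (cone_leZr hC) => //; exact: ltW.
  apply: (cone_le_trans hC h2); apply: (cone_leZr hC) => //.
  by rewrite ltW// mulrC [ltRHS]mulrC -ltr_pdivrMr ?(mulrC a)//; lra.
move=> h x y Cx Cy.
have CT z : C z -> C (T w z) by exact: (pos_cone (posT (w := w))).
apply: (order_ratio_closed hC Dc1 hDc) => //; do ?exact: CT.
move=> e e0.
have p : 0 < opnorm (T w) + 1 by have := opnorm_ge0 (bT w); lra.
have near z z' : `|z - z'| < e / (opnorm (T w) + 1) -> `|T w z - T w z'| < e.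
  rewrite ltr_pdivlMr// -TB => hz; apply: (le_lt_trans (opnorm_le _ (bT w))).
  by have := normr_ge0 (z - z'); lra.
have [i hi] := hc x _ Cx (divr_gt0 e0 p).
have [j hj] := hc y _ Cy (divr_gt0 e0 p).
have [m hm] := inv_succ_lt e0.
have [q /= q0 [[_ /= h1] [_ /= h2]]] := h i I j I m I.
rewrite !TB !TZ in h1 h2.
exists (T w (c i)), (T w (c j)); split; do ?[exact: CT|exact: near].
apply: (@order_ratio_le _ _ _ hC (dl + inv_succ m)); first by rewrite lerD2l ltW.
  by left; exact: CT.
by exists (ratr q) => //; split => //; rewrite addrA.
Qed.

End measurable_ratio_diam.

(** * Continuity on compact sets of almost full measure *)

Lemma measure_bigcup_small (R : realType) d (Omega : measurableType d)
    (mu : {measure set Omega -> \bar R}) (B : nat -> set Omega) (e : R) :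
  0 <= e -> (forall n, measurable (B n)) ->
  (forall n, mu (B n) <= (e / (2 ^ n.+1)%:R)%:E)%E ->
  (mu (\bigcup_n B n) <= e%:E)%E.
Proof.
move=> e0 mB hB; apply: le_trans (epsilon_trick0 xpredT e0).
apply: (@le_trans _ _ (\sum_(n <oo) mu (B n))%E); last exact: lee_nneseries.
by apply: measure_sigma_subadditive => //; exact: bigcupT_measurable.
Qed.

Lemma measure_decreasing_lt (R : realType) d (Omega : measurableType d)
    (mu : probability Omega R) (B : nat -> set Omega) (e : \bar R) :
  (forall n, measurable (B n)) -> nonincreasing_seq B ->
  (mu (\bigcap_n B n) < e)%E -> exists n, (mu (B n) < e)%E.
Proof.
move=> mB dB; apply: contraPP => /forallNP h; apply/negP; rewrite -leNgt.
have Boo : (mu (B 0%N) < +oo)%E by rewrite ltey_eq fin_num_measure.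
have := nonincreasing_cvg_mu Boo mB (bigcapT_measurable mB) dB.
apply: (@closed_cvg _ _ _ _ _ (fun v => (e <= v)%E)) => //.
  exact: closed_ereal_le_ereal.
by apply: nearW => n; rewrite leNgt; apply/negP; exact: h.
Qed.

Section compactly.
Variables (R : realType) (d : measure_display).
Variables (Omega : measurableTopologicalType d) (mu : probability Omega R).
Hypothesis borel : (@measurable d Omega : set (set Omega)) = <<s @open Omega >>.
Hypothesis polish : borel_subset_of_polish R Omega.

Lemma polish_hausdorff : hausdorff_space Omega.
Proof.
have [P [i [[hP _] inj _ hopen]]] := polish.
move=> p q pq; apply: inj; apply: hP => A B nA nB.
have pre x V : nbhs (i x) V -> nbhs x (i @^-1` V).
  move=> nV; have oW : nbhs x (i @^-1` V°).
    apply: open_nbhs_nbhs; split; last exact: nV.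
    by apply/hopen; exists V° => //; exact: open_interior.
  by apply: filterS oW => y; exact: interior_subset.
by have [x [Ax Bx]] := pq _ _ (pre _ _ nA) (pre _ _ nB); exists (i x).
Qed.

Lemma open_measurable (U : set Omega) : open U -> measurable U.
Proof. by move=> oU; rewrite borel; exact: sub_sigma_algebra. Qed.

Lemma closed_measurable (F : set Omega) : closed F -> measurable F.
Proof.
move=> cF; rewrite -[F]setCK; apply: measurableC; apply: open_measurable.
exact: closed_openC.
Qed.

(** F n consists of the points at distance about 1 / (n + 1) or more from the complement of V in the
    ambient metric; the interior in its definition is what makes it closed. *)
Lemma open_union_closed (U : set Omega) : open U -> exists F : nat -> set Omega,
  [/\ forall n, closed (F n), forall n m, (n <= m)%N -> F n `<=` F m &
      U = \bigcup_n F n].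
Proof.
have [P [i [_ _ _ hopen]]] := polish.
move=> /hopen[V oV ->].
pose W n := [set x : P | exists2 p, ~ V p & ball p (inv_succ n : R) x].
exists (fun n => ~` (i @^-1` (W n)°)); split.
- move=> n; apply: open_closedC; apply/hopen; exists (W n)° => //.
  exact: open_interior.
- move=> n m nm w /= h hw; apply: h.
  apply: (interiorS _ hw) => x [p Vp px]; exists p => //.
  apply: le_ball px; rewrite /inv_succ lef_pV2 ?posrE// ler_nat//.
- apply/seteqP; split => w /=.
    move=> Vw; have [r /= r0 hr] := (nbhs_ballP _ _).1 (open_nbhs_nbhs (conj oV Vw)).
    have [n hn] := inv_succ_lt r0; exists n => //= /interior_subset[p Vp pw].
    apply: Vp; apply: hr; apply: ball_sym; apply: le_ball pw; exact: ltW.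
  move=> [n _ /= h]; apply: contrapT => nV; apply: h.
  apply/nbhs_ballP; exists (inv_succ n); first exact: inv_succ_gt0.
  by move=> x wx; exists (i w).
Qed.

(** Approximation from inside and from outside at once makes the class stable under complements. *)
Definition regular_set (A : set Omega) : Prop :=
  forall e : R, 0 < e -> exists F U, [/\ closed F, open U, F `<=` A, A `<=` U &
    (mu (U `\` F) < e%:E)%E].

Lemma regular_open (U : set Omega) : open U -> regular_set U.
Proof.
move=> oU e e0; have [F [cF mF UE]] := open_union_closed oU.
have mU := open_measurable oU.
have [|||n hn] := @measure_decreasing_lt _ _ _ mu (fun n => U `\` F n) e%:E.
- by move=> n; apply: measurableD => //; exact: closed_measurable.
- move=> n m nm; apply/subsetPset => w /= [Uw h]; split => // Fw; apply: h.
  exact: (mF n m).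
- rewrite (_ : \bigcap_n _ = set0) ?measure0 ?lte_fin//.
  apply/seteqP; split => // w h; have [Uw _] := h 0%N I.
  by move: Uw; rewrite UE => -[n _ Fw]; have [] := h n I.
exists (F n), U; split => //.
by move=> w Fw; rewrite UE; exists n.
Qed.

(** For a countable union all outer sets are united, but only finitely many inner ones, since the
    union has to remain closed; continuity of mu along decreasing sets pays for the rest. *)
Lemma regular_measurable (A : set Omega) : measurable A -> regular_set A.
Proof.
rewrite borel => /(_ regular_set); apply; split; last exact: regular_open.
split.
- by apply: regular_open; exact: open0.
- move=> E rE e e0; have [F [U [cF oU FE EU h]]] := rE e e0.
  exists (~` U), (~` F); split; [exact: open_closedC|exact: closed_openC| | |].
  + by move=> w Uw; split => // /EU.
  + by move=> w [_ nE] /FE.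
  + by rewrite setDE setCK setIC -setDE.
- move=> E rE e e0.
  have e2 n : 0 < e / 2 / (2 ^ n.+1)%:R.
    by rewrite !divr_gt0// ltr0n expn_gt0.
  have /choice[FU hFU] : forall n, exists FU : set Omega * set Omega,
      [/\ closed FU.1, open FU.2, FU.1 `<=` E n, E n `<=` FU.2 &
        (mu (FU.2 `\` FU.1) < (e / 2 / (2 ^ n.+1)%:R)%:E)%E].
    by move=> n; have [F [U [? ? ? ? ?]]] := rE n _ (e2 n); exists (F, U).
  pose U := \bigcup_n (FU n).2; pose G k := (FU k).1; pose F n := \big[setU/set0]_(k < n) G k.
  have oU : open U by apply: bigcup_open => n _; case: (hFU n).
  have cF n : closed (F n).
    by rewrite /F; apply: closed_bigsetU => k _; case: (hFU k).
  have mFU n : measurable ((FU n).2 `\` (FU n).1).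
    by have [? ? _ _ _] := hFU n; apply: measurableD;
      [exact: open_measurable|exact: closed_measurable].
  have [|||n hn] := @measure_decreasing_lt _ _ _ mu (fun n => U `\` F n) e%:E.
  + by move=> n; apply: measurableD; [exact: open_measurable|exact: closed_measurable].
  + move=> n m nm; apply/subsetPset => w /= [Uw h]; split => // Fw; apply: h.
    by apply: subset_bigsetU Fw; exact: nm.
  + apply: (@le_lt_trans _ _ (e / 2)%:E); last by rewrite lte_fin; lra.
    apply: (@le_trans _ _ (mu (\bigcup_n ((FU n).2 `\` (FU n).1)))).
      apply: le_measure; rewrite ?inE//.
      * apply: bigcapT_measurable => n; apply: measurableD; [exact: open_measurable|exact: closed_measurable].
      * exact: bigcupT_measurable.
      move=> w h; have [[n _ Un] _] := h 0%N I; exists n => //; split => // Fw.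
      have [_] := h n.+1 I; apply; rewrite /F -bigcup_mkord; exists n => //=.
    apply: measure_bigcup_small => //; first by rewrite divr_ge0// ltW.
    by move=> n; apply: ltW; case: (hFU n).
  exists (F n), U; split => //.
    rewrite /F -bigcup_mkord => w [k _ Fw]; exists k => //.
    by have [_ _ + _ _] := hFU k; apply.
  move=> w [k _ Ek]; exists k => //.
  by have [_ _ _ + _] := hFU k; apply.
Qed.

(** The working form of mu-continuity: for hereditary properties it is stable under countable
    conjunctions, by intersecting compact sets with summable defects. *)
Definition compactly (P : set Omega -> Prop) : Prop :=
  forall e : R, 0 < e -> exists K, [/\ compact K, measurable K,
    (mu (~` K) < e%:E)%E & P K].

Definition hereditary (P : set Omega -> Prop) : Prop :=
  forall K K', K' `<=` K -> P K -> P K'.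

Lemma compactly_forall (P : nat -> set Omega -> Prop) :
  (forall n, hereditary (P n)) -> (forall n, compactly (P n)) ->
  compactly (fun K => forall n, P n K).
Proof.
move=> hP cP e e0.
have e2 n : 0 < e / 2 / (2 ^ n.+1)%:R.
  by rewrite !divr_gt0// ltr0n expn_gt0.
have /choice[K hK] : forall n, exists K, [/\ compact K, measurable K,
    (mu (~` K) < (e / 2 / (2 ^ n.+1)%:R)%:E)%E & P n K].
  by move=> n; exact: cP.
have cK n : closed (K n).
  by apply: compact_closed; [exact: polish_hausdorff|case: (hK n)].
exists (\bigcap_n K n); split.
- apply: (@subclosed_compact _ _ (K 0%N)); [exact: closed_bigI|by case: (hK 0%N)|].
  by move=> w; apply.
- by apply: bigcapT_measurable => n; case: (hK n).
- rewrite setC_bigcap; apply: (@le_lt_trans _ _ (e / 2)%:E); last by rewrite lte_fin; lra.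
  apply: measure_bigcup_small; first by rewrite divr_ge0// ltW.
    by move=> n; apply: measurableC; case: (hK n).
  by move=> n; apply: ltW; case: (hK n).
- by move=> n; apply: (hP n (K n)); [move=> w; apply|case: (hK n)].
Qed.

Lemma compactly_and (P Q : set Omega -> Prop) : hereditary P -> hereditary Q ->
  compactly P -> compactly Q -> compactly (fun K => P K /\ Q K).
Proof.
move=> hP hQ cP cQ e e0.
have [||K [cK mK muK PQ]] := @compactly_forall (fun n => if n is 0 then P else Q) _ _ e e0.
- by case.
- by case.
by exists K; split => //; split; [exact: PQ 0%N|exact: PQ 1%N].
Qed.

Lemma compactly_impl (P Q : set Omega -> Prop) : (forall K, compact K -> P K -> Q K) ->
  compactly P -> compactly Q.
Proof.
by move=> PQ cP e e0; have [K [? ? ? ?]] := cP e e0; exists K; split => //; exact: PQ.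
Qed.

Lemma hereditary_subset W : hereditary (fun K => K `<=` W).
Proof. by move=> K K' KK' KW w /KK'/KW. Qed.

(** Regularity of mu supplies closed sets only; intersecting them with the compact sets of [Q] makes
    them compact. In the applications to the cocycle these come from the mu-continuity of L. *)
Lemma compactly_of_measurable (P Q : set Omega -> Prop) : hereditary P ->
  compactly Q -> (forall e : R, 0 < e -> exists W, [/\ measurable W,
    (mu (~` W) < e%:E)%E & P W]) -> compactly P.
Proof.
move=> hP cQ h e e0.
have e2 : 0 < e / 2 by rewrite divr_gt0.
have e4 : 0 < e / 2 / 2 by rewrite divr_gt0.
have [K [cK mK muK _]] := cQ _ e2.
have [W [mW W0 PW]] := h _ e4.
have [F [U [cF oU FW WU hU]]] := regular_measurable mW e4.
have mF := closed_measurable cF; have mU := open_measurable oU.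
exists (F `&` K); split.
- by rewrite setIC; apply: compact_closedI.
- exact: measurableI.
- rewrite setCI; apply: (@le_lt_trans _ _ (mu (~` F) + mu (~` K))%E).
    by apply: measureU2; exact: measurableC.
  rewrite [e in e%:E]splitr EFinD lteD//.
  apply: (@le_lt_trans _ _ (mu (~` W) + mu (U `\` F))%E); last first.
    by rewrite [X in X%:E]splitr EFinD lteD.
  apply: le_trans; last by apply: measureU2; [exact: measurableC|exact: measurableD].
  apply: le_measure; rewrite ?inE; [exact: measurableC| |].
    by apply: measurableU; [exact: measurableC|exact: measurableD].
  move=> w Fw; have [Ww|nW] := pselect (W w); [right|left] => //.
  by split => //; exact: WU.
- by apply: hP PW => w [/FW].
Qed.

Lemma compactly_subset (P : set Omega -> Prop) (W : set Omega) : compactly P ->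
  measurable W -> mu (~` W) = 0%E -> compactly (fun K => K `<=` W).
Proof.
move=> cP mW W0; apply: (compactly_of_measurable (hereditary_subset (W := W)) cP).
by move=> e e0; exists W; split => //; rewrite W0 lte_fin.
Qed.

Section continuity.
Variables (T : Type) (dist : T -> T -> R).

Definition continuous_on (f : Omega -> T) (K : set Omega) : Prop :=
  forall w, K w -> forall e : R, 0 < e ->
    \forall w' \near within K (nbhs w), dist (f w) (f w') < e.

Lemma hereditary_continuous_on f : hereditary (continuous_on f).
Proof.
move=> K K' KK' cf w Kw e e0; have := cf w (KK' _ Kw) e e0.
by rewrite !near_withinE; apply: filterS => w' h /KK'.
Qed.

Lemma mu_continuous_compactly f D : mu_continuous mu dist D f ->
  compactly (continuous_on f).
Proof.
move=> [K [cK Kn _ muK cf]] e e0.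
have mK n : measurable (K n) by case: (cK n).
have nK n m : (n <= m)%N -> K n `<=` K m.
  move=> nm; rewrite -(subnKC nm); elim: (m - n)%N => [|j IH]; first by rewrite addn0.
  by rewrite addnS => w /IH/Kn.
have [|||n hn] := @measure_decreasing_lt _ _ _ mu (fun n => ~` K n) e%:E.
- by move=> n; exact: measurableC.
- by move=> n m nm; apply/subsetPset/subsetC; exact: nK.
- rewrite -setC_bigcup probability_setC; last exact: bigcupT_measurable.
  by rewrite muK subee// lte_fin.
by exists (K n); split => //; [case: (cK n)|exact: cf].
Qed.

(** [mu_continuous] asks for an increasing sequence, whence the finite unions U n. Continuity passes
    to a finite union of closed sets because a point outside one of them has a neighbourhood that
    misses it. *)
Lemma compactly_mu_continuous f (D : set Omega) :
  compactly (fun K => continuous_on f K /\ K `<=` D) -> mu_continuous mu dist D f.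
Proof.
move=> H; have /choice[K hK] : forall n, exists K, [/\ compact K, measurable K,
    (mu (~` K) < (inv_succ n)%:E)%E & continuous_on f K /\ K `<=` D].
  by move=> n; apply: H; exact: inv_succ_gt0.
have cK n : closed (K n).
  by apply: compact_closed; [exact: polish_hausdorff|case: (hK n)].
pose U n := \big[setU/set0]_(k < n) K k.
have mU n : measurable (U n).
  by apply: bigsetU_measurable => k _; case: (hK k).
have US n : U n.+1 = U n `|` K n by rewrite /U big_ord_recr.
exists U; split.
- move=> n; split => //; elim: n => [|n IH].
    by rewrite /U big_ord0; exact: compact0.
  by rewrite US; apply: compactU => //; case: (hK n).
- by move=> n w; rewrite US; left.
- move=> n; elim: n => [|n IH]; first by rewrite /U big_ord0.
  by rewrite US => w [/IH//|]; case: (hK n) => _ _ _ [_]; apply.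
- apply/eqP; rewrite eq_le; apply/andP; split.
    by apply: probability_le1; exact: bigcupT_measurable.
  apply/lee_addgt0Pr => e e0; have [n hn] := inv_succ_lt e0.
  have [_ mK muK _] := hK n.
  have mUU := bigcupT_measurable U mU.
  have h : (mu (~` (\bigcup_n U n) `|` \bigcup_n U n) <=
      mu (~` (\bigcup_n U n)) + mu (\bigcup_n U n))%E.
    by apply: measureU2 => //; exact: measurableC.
  rewrite setvU probability_setT in h; apply: (le_trans h); rewrite addeC.
  rewrite leeD2l//; apply: le_trans (ltW (lt_trans muK _)); last by rewrite lte_fin.
  apply: le_measure; rewrite ?inE; [exact: measurableC|exact: measurableC|].
  by apply: subsetC => w Kw; exists n.+1 => //; rewrite US; right.
- elim=> [|n IH] w; first by rewrite /U big_ord0.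
  move=> _ e e0; rewrite US.
  have near1 : \forall w' \near w, U n w' -> dist (f w) (f w') < e.
    have [Uw|nU] := pselect (U n w).
      by have := IH w Uw e e0; rewrite near_withinE.
    have : nbhs w (~` U n).
      apply: open_nbhs_nbhs; split => //; apply: closed_openC.
      by rewrite /U; apply: closed_bigsetU.
    by apply: filterS => w' h /h.
  have near2 : \forall w' \near w, K n w' -> dist (f w) (f w') < e.
    have [Kw|nK] := pselect (K n w).
      by have [_ _ _ [cf _]] := hK n; have := cf w Kw e e0; rewrite near_withinE.
    have : nbhs w (~` K n).
      by apply: open_nbhs_nbhs; split => //; exact: closed_openC.
    by apply: filterS => w' h /h.
  by rewrite near_withinE; apply: filterS2 near1 near2 => w' h1 h2 [/h1|/h2].
Qed.

End continuity.
End compactly.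

(** * Continuity on a set for vector-valued and operator-valued maps *)

Section continuous_on_maps.
Variables (R : realType) (d : measure_display).
Variables (Omega : measurableTopologicalType d).
Implicit Types (K : set Omega).

Lemma continuous_on_normP (X : normedModType R) (f : Omega -> X) K :
  continuous_on (@normdist R X) f K <->
  forall w, K w -> f w' @[w' --> within K (nbhs w)] --> f w.
Proof.
split=> h w Kw; first by apply/cvgrPdist_lt => e e0; exact: h.
by move=> e e0; have /cvgrPdist_lt := h w Kw; exact.
Qed.

Lemma continuous_on_comp (T : Type) (dist : T -> T -> R) (f : Omega -> T)
    (sigma : Omega -> Omega) K : continuous sigma -> continuous_on dist f K ->
  continuous_on dist (f \o sigma) (sigma @^-1` K).
Proof.
move=> cs cf w /= Kw e e0; have := cf _ Kw e e0.
rewrite !near_withinE => h; exact: (cs w _ h).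
Qed.

Lemma closed_sub_continuous K (Q : set Omega) : closed K ->
  (forall w, K w -> ~ Q w -> \forall w' \near within K (nbhs w), ~ Q w') ->
  closed (K `&` Q).
Proof.
move=> cK h w clw.
have Kw : K w by apply: cK; apply: closureS clw => w' [].
split => //; apply: contrapT => nQ; have := h w Kw nQ; rewrite near_withinE => hn.
by have [w' [[Kw' Qw'] hw']] := clw _ hn; exact: hw'.
Qed.

Lemma continuous_on_scale (X : normedModType R) (a : Omega -> R) (f : Omega -> X) K :
  continuous_on (@normdist R R^o) a K -> continuous_on (@normdist R X) f K ->
  continuous_on (@normdist R X) (fun w => a w *: f w) K.
Proof.
move=> /continuous_on_normP ca /continuous_on_normP cf.
by apply/continuous_on_normP => w Kw; apply: cvgZ; [exact: ca|exact: cf].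
Qed.

Lemma continuous_on_normr (X : normedModType R) (f : Omega -> X) K :
  continuous_on (@normdist R X) f K ->
  continuous_on (@normdist R R^o) (fun w => `|f w|) K.
Proof.
move=> /continuous_on_normP cf.
by apply/continuous_on_normP => w Kw; apply: (@cvg_norm _ X); exact: cf.
Qed.

Lemma continuous_on_inv_norm (X : normedModType R) (f : Omega -> X) K :
  (forall w, K w -> f w != 0) -> continuous_on (@normdist R X) f K ->
  continuous_on (@normdist R R^o) (fun w => `|f w|^-1) K.
Proof.
move=> f0 /continuous_on_normP cf.
apply/continuous_on_normP => w Kw; apply: cvgV; first by rewrite normr_eq0 f0.
by apply: (@cvg_norm _ X); exact: cf.
Qed.

Lemma continuous_on_uniform (X : normedModType R) (fn : nat -> Omega -> X)
    (f : Omega -> X) K : (forall n, continuous_on (@normdist R X) (fn n) K) ->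
  (forall e : R, 0 < e -> exists n, forall w, K w -> `|fn n w - f w| < e) ->
  continuous_on (@normdist R X) f K.
Proof.
move=> cfn unif w Kw e e0.
have e3 : 0 < e / 3 by rewrite divr_gt0.
have [n hn] := unif _ e3; have := cfn n w Kw _ e3.
rewrite !near_withinE; apply: filterS => w' h Kw'; rewrite /normdist.
have -> : f w - f w' = (fn n w - fn n w') - (fn n w - f w) + (fn n w' - f w').
  by linear_eq R.
apply: (le_lt_trans (ler_normD _ _)).
apply: (le_lt_trans (lerD (ler_normB _ _) (lexx _))).
have := h Kw'; rewrite /normdist; have := hn _ Kw; have := hn _ Kw'; lra.
Qed.

Section operators.
Variables (X Y Z : normedModType R).

Lemma continuous_on_apply (F : Omega -> X -> Y) (u : Omega -> X) K :
  (forall w, K w -> bounded_operator (F w)) ->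
  continuous_on (@opdist R X Y) F K -> continuous_on (@normdist R X) u K ->
  continuous_on (@normdist R Y) (fun w => F w (u w)) K.
Proof.
move=> bF cF cu w Kw e e0.
have M0 := opnorm_ge0 (bF w Kw).
(* The estimate below is e1 times [opnorm (F w) + |u w| + 1], which is less than e; the summand e in
   the denominator ensures e1 <= 1. The same device recurs in the next proofs. *)
pose e1 := e / (opnorm (F w) + `|u w| + 2 + e).
have u0 := normr_ge0 (u w).
have D0 : 0 < opnorm (F w) + `|u w| + 2 + e by lra.
have e10 : 0 < e1 by rewrite divr_gt0.
have e1e : e1 * (opnorm (F w) + `|u w| + 2 + e) = e by rewrite divfK ?gt_eqF.
have e11 : e1 <= 1 by rewrite ler_pdivrMr//; lra.
have := cF w Kw _ e10; have := cu w Kw _ e10; rewrite !near_withinE.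
apply: filterS2 => w' hu hF Kw'; move: (hu Kw') (hF Kw'); rewrite /normdist => {}hu {}hF.
have -> : F w (u w) - F w' (u w') =
  F w (u w - u w') + (F w (u w') - F w' (u w')).
  by rewrite (linear_funB _ _ (bF w Kw).1); linear_eq R.
apply: (le_lt_trans (ler_normD _ _)).
have h1 := opnorm_le (u w - u w') (bF w Kw).
have h2 := opdist_le (u w') (bF w Kw) (bF w' Kw').
have h3 : `|u w'| <= `|u w| + e1.
  have := ler_normB (u w) (u w - u w'); rewrite opprB addrC subrK.
  by lra.
have h4 : opnorm (F w) * `|u w - u w'| <= opnorm (F w) * e1.
  by rewrite ler_wpM2l// ltW.
have h5 : opdist (F w) (F w') * `|u w'| <= e1 * (`|u w| + e1).
  by apply: ler_pM => //; [apply: opnorm_ge0; apply: bounded_operatorB; exact: bF|exact: ltW].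
have h6 : e1 * e1 <= e1 * 1 by rewrite ler_wpM2l// ltW.
have : 0 < e1 * e by rewrite mulr_gt0.
by lra.
Qed.

Lemma continuous_on_compose (F : Omega -> Y -> Z) (G : Omega -> X -> Y) K :
  (forall w, K w -> bounded_operator (F w)) ->
  (forall w, K w -> bounded_operator (G w)) ->
  continuous_on (@opdist R Y Z) F K -> continuous_on (@opdist R X Y) G K ->
  continuous_on (@opdist R X Z) (fun w => F w \o G w) K.
Proof.
move=> bF bG cF cG w Kw e e0.
have MF := opnorm_ge0 (bF w Kw); have MG := opnorm_ge0 (bG w Kw).
pose e1 := e / (opnorm (F w) + opnorm (G w) + 2 + e).
have D0 : 0 < opnorm (F w) + opnorm (G w) + 2 + e by lra.
have e10 : 0 < e1 by rewrite divr_gt0.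
have e1e : e1 * (opnorm (F w) + opnorm (G w) + 2 + e) = e by rewrite divfK ?gt_eqF.
have e11 : e1 <= 1 by rewrite ler_pdivrMr//; lra.
have := cF w Kw _ e10; have := cG w Kw _ e10; rewrite !near_withinE.
apply: filterS2 => w' hG hF Kw'; move: (hG Kw') (hF Kw') => {}hG {}hF.
apply: (@le_lt_trans _ _ (e1 * (opnorm (F w) + opnorm (G w) + 1))); last first.
  have : 0 < e1 * e by rewrite mulr_gt0.
  by move: e1e; rewrite !mulrDr; lra.
apply: opdist_ub => [|x /=]; first by rewrite mulr_ge0 ?(ltW e10)//; lra.
have -> : F w (G w x) - F w' (G w' x) =
  F w (G w x - G w' x) + (F w (G w' x) - F w' (G w' x)).
  by rewrite (linear_funB _ _ (bF w Kw).1); linear_eq R.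
apply: (le_trans (ler_normD _ _)).
have x0 := normr_ge0 x.
have h1 := opnorm_le (G w x - G w' x) (bF w Kw).
have h2 := opdist_le (G w' x) (bF w Kw) (bF w' Kw').
have h0 := opdist_le x (bG w Kw) (bG w' Kw').
have h0' : `|G w x - G w' x| <= e1 * `|x|.
  by apply: (le_trans h0); rewrite ler_wpM2r// ltW.
have h3 : `|G w' x| <= (opnorm (G w) + 1) * `|x|.
  have := ler_normB (G w x) (G w x - G w' x); rewrite opprB addrC subrK.
  have := opnorm_le x (bG w Kw).
  have : e1 * `|x| <= 1 * `|x| by rewrite ler_wpM2r.
  by lra.
have h4 : opnorm (F w) * `|G w x - G w' x| <= opnorm (F w) * (e1 * `|x|).
  by rewrite ler_wpM2l.
have h5 : opdist (F w) (F w') * `|G w' x| <= e1 * ((opnorm (G w) + 1) * `|x|).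
  by apply: ler_pM => //; [apply: opnorm_ge0; apply: bounded_operatorB; exact: bF|exact: ltW].
by lra.
Qed.

Lemma continuous_on_scale_op (a : Omega -> R) (F : Omega -> X -> Y) K :
  (forall w, K w -> bounded_operator (F w)) ->
  continuous_on (@normdist R R^o) a K -> continuous_on (@opdist R X Y) F K ->
  continuous_on (@opdist R X Y) (fun w x => a w *: F w x) K.
Proof.
move=> bF ca cF.
have bZ (c : R) : bounded_operator (fun y : Y => c *: y).
  split; first by move=> k x y; linear_eq R.
  by exists `|c| => x; rewrite normrZ.
move=> w Kw e e0.
have M0 := opnorm_ge0 (bF w Kw).
pose e1 := e / (opnorm (F w) + `|a w| + 2 + e).
have u0 := normr_ge0 (a w).
have D0 : 0 < opnorm (F w) + `|a w| + 2 + e by lra.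
have e10 : 0 < e1 by rewrite divr_gt0.
have e1e : e1 * (opnorm (F w) + `|a w| + 2 + e) = e by rewrite divfK ?gt_eqF.
have e11 : e1 <= 1 by rewrite ler_pdivrMr//; lra.
have := cF w Kw _ e10; have := ca w Kw _ e10; rewrite !near_withinE.
apply: filterS2 => w' ha hF Kw'; move: (ha Kw') (hF Kw'); rewrite /normdist => {}ha {}hF.
apply: (@le_lt_trans _ _ (e1 * (opnorm (F w) + `|a w| + 1))); last first.
  have : 0 < e1 * e by rewrite mulr_gt0.
  by move: e1e; rewrite !mulrDr; lra.
apply: opdist_ub => [|x /=]; first by rewrite mulr_ge0 ?(ltW e10)//; lra.
have -> : a w *: F w x - a w' *: F w' x =
  (a w - a w') *: F w x + a w' *: (F w x - F w' x) by linear_eq R.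
apply: (le_trans (ler_normD _ _)); rewrite !normrZ.
have x0 := normr_ge0 x.
have h1 := opnorm_le x (bF w Kw).
have h2 := opdist_le x (bF w Kw) (bF w' Kw').
have h3 : `|a w'| <= `|a w| + 1.
  have := ler_normB (a w) (a w - a w'); rewrite opprB addrC subrK.
  by lra.
have h4 : `|a w - a w'| * `|F w x| <= e1 * (opnorm (F w) * `|x|).
  by apply: ler_pM => //; exact: ltW.
have h5 : `|a w'| * `|F w x - F w' x| <= (`|a w| + 1) * (e1 * `|x|).
  by apply: ler_pM => //; apply: (le_trans h2); rewrite ler_wpM2r// ltW.
by lra.
Qed.

End operators.

Lemma continuous_on_opnorm (X Y : normedModType R) (F : Omega -> X -> Y) K :
  (forall w, K w -> bounded_operator (F w)) -> continuous_on (@opdist R X Y) F K ->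
  continuous_on (@normdist R R^o) (fun w => opnorm (F w)) K.
Proof.
move=> bF cF w Kw e e0; have := cF w Kw _ e0; rewrite !near_withinE.
apply: filterS => w' h Kw'; apply: le_lt_trans (h Kw').
have od0 : 0 <= opdist (F w) (F w').
  by apply: opnorm_ge0; apply: bounded_operatorB; exact: bF.
have bd x := opdist_le x (bF w Kw) (bF w' Kw').
rewrite /normdist ler_norml; apply/andP; split.
  rewrite lerBrDl -lerBrDr opprK.
  apply: opnorm_ub => [|x]; first by rewrite addr_ge0// opnorm_ge0//; exact: bF.
  have := ler_normB (F w x) (F w x - F w' x); rewrite opprB addrC subrK.
  by have := bd x; have := opnorm_le x (bF w Kw); lra.
rewrite lerBlDl.
apply: opnorm_ub => [|x]; first by rewrite addr_ge0// opnorm_ge0//; exact: bF.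
have := ler_normD (F w x - F w' x) (F w' x); rewrite subrK.
by have := bd x; have := opnorm_le x (bF w' Kw'); lra.
Qed.

End continuous_on_maps.

Section mu_continuity.
Variables (R : realType) (d : measure_display).
Variables (Omega : measurableTopologicalType d) (mu : probability Omega R).
Hypothesis borel : (@measurable d Omega : set (set Omega)) = <<s @open Omega >>.
Hypothesis polish : borel_subset_of_polish R Omega.

Lemma compactly_pullback (P Q : set Omega -> Prop) (sigma sigmaV : Omega -> Omega) :
  ergodic_invertible mu sigma sigmaV -> continuous sigma -> continuous sigmaV ->
  (forall K, P K -> Q (sigma @^-1` K)) -> compactly mu P -> compactly mu Q.
Proof.
move=> hs cs csV PQ cP e e0; have [K [cK mK muK PK]] := cP e e0.
have E : sigma @^-1` K = sigmaV @` K.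
  apply/seteqP; split => w /=.
    by move=> Kw; exists (sigma w) => //; rewrite (ergodic_cancel hs).
  by move=> [u Ku <-]; rewrite (ergodic_cancelV hs).
exists (sigma @^-1` K); split.
- by rewrite E; apply: continuous_compact => //; exact: continuous_subspaceT.
- by rewrite -[X in measurable X]setTI; exact: (ergodic_measurable hs).
- rewrite preimage_setC (ergodic_preserving hs)//; exact: measurableC.
- exact: PQ.
Qed.

Lemma compactly_iter (T : Type) (dist : T -> T -> R) (f : Omega -> T)
    (sigma sigmaV : Omega -> Omega) n :
  ergodic_invertible mu sigma sigmaV -> continuous sigma -> continuous sigmaV ->
  compactly mu (continuous_on dist f) ->
  compactly mu (continuous_on dist (fun w => f (iter n sigma w))).
Proof.
move=> hs cs csV cf; elim: n => [//|n IH].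
apply: (compactly_pullback hs cs csV _ IH) => K.
move=> /(continuous_on_comp cs); congr (continuous_on _ _ _).
by apply/funext => w; rewrite /= -iterSr.
Qed.

(** Egorov's theorem: for each j the sets B j n decrease to a null set, so one of small measure can
    be discarded, and convergence is uniform on what remains. *)
Lemma compactly_egorov (delta : nat -> Omega -> R) (W : set Omega)
    (P : set Omega -> Prop) : compactly mu P ->
  (forall n, measurable_fun setT (delta n)) -> measurable W -> mu (~` W) = 0%E ->
  (forall w, W w -> delta n w @[n --> \oo] --> (0 : R)) ->
  compactly mu (fun K => forall e : R, 0 < e ->
    exists N, forall n, (N <= n)%N -> forall w, K w -> `|delta n w| < e).
Proof.
move=> cP md mW W0 hW.
apply: (compactly_of_measurable borel polish _ cP).
  move=> K K' KK' h e /h[N hN]; exists N => n Nn w /KK'; exact: hN.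
move=> e e0.
pose B j n := \bigcup_(m in [set m | (n <= m)%N]) [set w | inv_succ j <= `|delta m w|].
have mB j n : measurable (B j n).
  apply: bigcup_measurable => m _; rewrite -[X in measurable X]setTI.
  apply: measurable_fun_ge => //; apply: measurableT_comp => //.
have e2 j : 0 < e / 2 / (2 ^ j.+1)%:R.
  by rewrite !divr_gt0// ltr0n expn_gt0.
have /choice[N hN] : forall j, exists n, (mu (B j n) < (e / 2 / (2 ^ j.+1)%:R)%:E)%E.
  move=> j; apply: measure_decreasing_lt => //.
    move=> n m nm; apply/subsetPset => w [i /= mi hi]; exists i => //=.
    exact: leq_trans mi.
  apply: (@le_lt_trans _ _ (mu (~` W))); last by rewrite W0 lte_fin.
  apply: le_measure; rewrite ?inE; [exact: bigcapT_measurable|exact: measurableC|].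
  move=> w h Ww; have /cvgrPdist_lt/(_ _ (inv_succ_gt0 R j))[M _ hM] := hW w Ww.
  have [m /= Mm] := h M I; have := hM m Mm; rewrite /= sub0r normrN => h1.
  by rewrite leNgt h1.
exists (~` (\bigcup_j B j (N j))); split.
- by apply: measurableC; exact: bigcupT_measurable.
- rewrite setCK; apply: (@le_lt_trans _ _ (e / 2)%:E); last by rewrite lte_fin; lra.
  apply: measure_bigcup_small => //; first by rewrite divr_ge0// ltW.
  by move=> j; exact/ltW/hN.
- move=> r r0; have [j hj] := inv_succ_lt r0.
  exists (N j) => n Nn w nB; apply: lt_trans hj; rewrite ltNge; apply/negP => h.
  by apply: nB; exists j => //; exists n.
Qed.

(** Nothing is known of f off the compact sets, so measurability is obtained on their union, which
    has full measure: inside each of them the set where c <= f is closed. *)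
Lemma compactly_ae_measurable (f : Omega -> R) :
  compactly mu (continuous_on (@normdist R R^o) f) ->
  exists W, [/\ measurable W, mu (~` W) = 0%E & measurable_fun W f].
Proof.
move=> cf; have [] : mu_continuous mu (@normdist R R^o) setT f.
  apply: (compactly_mu_continuous polish); apply: compactly_impl cf => K _ h.
  by split.
move=> K [cK _ _ muK cfK].
have mK n : measurable (K n) by case: (cK n).
have clK n : closed (K n).
  by apply: compact_closed; [exact: polish_hausdorff polish|case: (cK n)].
have mU := bigcupT_measurable K mK.
exists (\bigcup_n K n); split => //.
  by rewrite probability_setC// muK subee.
apply: measurable_fun_lt_sets => c; rewrite setI_bigcupl.
apply: bigcupT_measurable => n.
rewrite (_ : _ `&` _ = K n `\` (K n `&` [set w | c <= f w])); last first.
  apply/seteqP; split => w /=; first by move=> [Kw h]; split => // -[_]; rewrite leNgt h.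
  by move=> [Kw h]; split => //; rewrite ltNge; apply/negP => ch; exact: h.
apply: measurableD => //; apply: (closed_measurable borel).
apply: closed_sub_continuous => // w Kw /= /negP; rewrite -ltNge => fc.
have := cfK n w Kw (c - f w); rewrite subr_gt0 => /(_ fc); rewrite !near_withinE.
apply: filterS => w' h Kw' /=; apply/negP; rewrite -ltNge.
by have := h Kw'; rewrite /normdist ltr_norml => /andP[]; lra.
Qed.

End mu_continuity.

(** * Regularity of the equivariant vector and functional *)

Lemma measurable_fun_inv_gt0 (R : realType) d (Omega : measurableType d)
    (D : set Omega) (f : Omega -> R) : (forall w, D w -> 0 < f w) ->
  measurable_fun D f -> measurable_fun D (fun w => (f w)^-1).
Proof.
move=> f0 mf.
have : measurable_fun D (fun w => expR (- ln (f w))).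
  apply: measurableT_comp => //; apply: measurable_funN.
  by apply: (measurableT_comp (f := @ln R)).
apply: eq_measurable_fun => w; rewrite inE => Dw.
by rewrite expRN lnK// posrE; exact: f0.
Qed.

Section perron_regularity.
Variables (R : realType) (d : measure_display).
Variables (Omega : measurableTopologicalType d) (X : completeNormedModType R).
Variables (sigma sigmaV : Omega -> Omega) (L : Omega -> X -> X) (C : set X).
Hypothesis sigmaVK : cancel sigmaV sigma.
Hypothesis hL : forall w, bounded_operator (L w).
Hypothesis hLC : forall w, L w @` C `<=` C.
Hypothesis hC : nice_cone C.
Variables (Dc kappa : R).
Hypotheses (Dc1 : 1 <= Dc) (hDc : D_adapted C Dc).
Hypothesis kappa0 : 0 < kappa.
Hypothesis hkappa : forall x, exists y z, [/\ cone0 C y, cone0 C z,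
  `|y| <= kappa * `|x|, `|z| <= kappa * `|x| & x = y - z].
Variables (delta : nat -> Omega -> R) (c0 : R).
Hypothesis c0_gt0 : 0 < c0.
Hypothesis delta_ge0 : forall n w, 0 <= delta n w.

Local Notation A := (cocycle sigma L).
Local Notation back n w := (iter n sigmaV w).

Hypothesis hdelta : forall n w, delta n w < c0 -> ratio_diam C (delta n w) (A n w).
Variable x0 : X.
Hypothesis Cx0 : C x0.
Variable W : set Omega.
Hypothesis hWb : forall w, W w -> delta n (back n w) @[n --> \oo] --> (0 : R).
Hypothesis hWf : forall w, W w -> delta n w @[n --> \oo] --> (0 : R).

Local Notation approx := (perron_approx sigma sigmaV L x0).
Local Notation v := (perron_vector sigma sigmaV L x0).
Local Notation eta w := (perron_functional sigma L w (v w)).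

Let Dc0 : 0 < Dc. Proof. exact: lt_le_trans Dc1. Qed.

Let v_C w : W w -> C (v w).
Proof.
by move=> /hWb h; exact: (perron_vector_C sigmaVK hLC hC Dc1 hDc c0_gt0 delta_ge0 hdelta Cx0 h).
Qed.

Let Av_gt0 n w : W w -> 0 < `|A n w (v w)|.
Proof. by move=> Ww; apply: (cone_norm_gt0 hC); apply: cocycle_C => //; exact: v_C. Qed.

Let eta_approx w x n m : W w -> delta n w < c0 -> delta m w < c0 ->
  `|A m w x - (eta w x : R) *: A m w (v w)| <=
    Dc * delta m w * (functional_bound sigma L Dc kappa delta n w (v w) * `|x|) *
    `|A m w (v w)|.
Proof.
move=> Ww; exact: (perron_functional_approx hL hLC hC Dc1 hDc hkappa c0_gt0 delta_ge0 hdelta (v_C Ww) (hWf Ww)).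
Qed.

Let eta_linear w : W w -> linear (eta w).
Proof.
move=> Ww; exact: (perron_functional_linear hL hLC hC Dc1 hDc hkappa c0_gt0 delta_ge0 hdelta (v_C Ww) (hWf Ww)).
Qed.

Lemma perron_functional_cone_ge0 w x : W w -> cone0 C x -> 0 <= (eta w x : R).
Proof.
move=> Ww [Cx|->]; last by rewrite (linear_fun0 (eta_linear Ww)).
apply: ltW; exact: (perron_functional_gt0 hL hLC hC hDc c0_gt0 delta_ge0 hdelta (v_C Ww) (hWf Ww) Cx).
Qed.

(** On the cone eta is nonnegative, so it can be recovered from norms alone, as the limit of |A m x|
    / |A m v|. This formula, unlike the definition by [xget], displays measurability and continuity
    in w. *)
Lemma perron_functional_ratio w x n m : W w -> cone0 C x ->
  delta n w < c0 -> delta m w < c0 ->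
  `| `|A m w x| / `|A m w (v w)| - (eta w x : R) | <=
    Dc * delta m w * (functional_bound sigma L Dc kappa delta n w (v w) * `|x|).
Proof.
move=> Ww Cx dn dm; have Av := Av_gt0 m Ww.
have e0 := perron_functional_cone_ge0 Ww Cx.
have -> : `|A m w x| / `|A m w (v w)| - (eta w x : R) =
  (`|A m w x| - `|(eta w x : R) *: A m w (v w)|) / `|A m w (v w)|.
  by rewrite normrZ ger0_norm// mulrBl mulfK// gt_eqF.
rewrite normrM normfV normr_id ler_pdivrMr//.
apply: (le_trans (ler_dist_dist _ _)); exact: eta_approx.
Qed.

Lemma perron_functional_ratio_cvg w x : W w -> cone0 C x ->
  `|A n w x| / `|A n w (v w)| @[n --> \oo] --> (eta w x : R).
Proof.
move=> Ww Cx; have hw := hWf Ww.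
have [n dn] := delta_good c0_gt0 delta_ge0 hw.
pose K := Dc * (functional_bound sigma L Dc kappa delta n w (v w) * `|x|).
have h0 : K * delta m w @[m --> \oo] --> (0 : R).
  by rewrite -[X in _ --> X](mulr0 K); apply: cvgM => //; exact: cvg_cst.
apply/cvgrPdist_le => e e0.
have /cvgrPdist_le/(_ _ e0) H1 := h0.
have /cvgrPdist_lt/(_ _ c0_gt0) H2 := hw.
apply: filterS2 H1 H2 => m; rewrite !sub0r !normrN (ger0_norm (delta_ge0 _ _)) => h1 dm.
rewrite distrC; apply: (le_trans (perron_functional_ratio Ww Cx dn dm)).
by apply: le_trans h1; apply: le_trans (ler_norm _); rewrite /K mulrAC.
Qed.

Section strong.
Variable s : nat -> X.
Hypothesis hs : forall x e, 0 < e -> exists n, `|x - s n| < e.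
Hypothesis mW : measurable W.
Hypotheses (ms : measurable_fun setT sigma) (msV : measurable_fun setT sigmaV).
Hypothesis mL : forall x, norm_measurable setT (L ^~ x).

Lemma norm_measurable_cocycle n x : norm_measurable setT (fun w => A n w x).
Proof.
elim: n => [|n IH]; first by move=> y /=; exact: measurable_cst.
apply: (norm_measurable_apply hs measurableT (F := fun w => L (iter n sigma w))) => //.
  move=> y z; exact: (measurableT_comp (mL y z) (measurable_iter n ms)).
by move=> w _; exact: bounded_operator_continuous.
Qed.

Lemma norm_measurable_perron_approx n : norm_measurable setT (approx n).
Proof.
have h : norm_measurable setT (fun w => A n (back n w) x0).
  move=> y; exact: (measurableT_comp (norm_measurable_cocycle n x0 y) (measurable_iter n msV)).
apply: (norm_measurableZ hs measurableT) => //.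
apply: measurable_fun_inv_gt0; last exact: norm_measurable_norm.
by move=> w _; apply: (cone_norm_gt0 hC); exact: cocycle_C.
Qed.

Lemma norm_measurable_perron_vector : norm_measurable W v.
Proof.
apply: (norm_measurable_lim (fn := approx)).
  by move=> n x; apply: measurable_funTS; exact: norm_measurable_perron_approx.
by move=> w /hWb h; exact: (perron_vector_cvg sigmaVK hLC hC Dc1 hDc c0_gt0 delta_ge0 hdelta Cx0 h).
Qed.

Lemma measurable_perron_functional x : measurable_fun W (fun w => eta w x : R).
Proof.
have cone_case y : cone0 C y -> measurable_fun W (fun w => eta w y : R).
  move=> Cy.
  apply: (measurable_fun_cvg (h := fun n w => `|A n w y| / `|A n w (v w)|)); last first.
    by move=> w Ww; exact: perron_functional_ratio_cvg.
  move=> n; apply: measurable_funM.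
    apply: (norm_measurable_norm (f := fun w => A n w y)) => z.
    by apply: measurable_funTS; exact: norm_measurable_cocycle.
  apply: measurable_fun_inv_gt0; first by move=> w Ww; exact: Av_gt0.
  apply: norm_measurable_norm.
  apply: (norm_measurable_apply hs mW (F := fun w => A n w)).
  - exact: norm_measurable_perron_vector.
  - by move=> z t; apply: measurable_funTS; exact: norm_measurable_cocycle.
  - by move=> w _; apply: bounded_operator_continuous; exact: cocycle_bounded.
have [y [z [Cy Cz _ _ ->]]] := hkappa x.
have := measurable_funB (cone_case _ Cy) (cone_case _ Cz).
apply: eq_measurable_fun => w; rewrite inE => Ww /=.
by rewrite (linear_funB _ _ (eta_linear Ww)).
Qed.

End strong.

Section continuity.
Variable K : set Omega.
Hypothesis KW : K `<=` W.
Hypothesis cLf : forall n, continuous_on (@opdist R X X) (fun w => L (iter n sigma w)) K.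
Hypothesis cLb : forall n, continuous_on (@opdist R X X) (fun w => L (back n w)) K.
Hypothesis ub : forall e : R, 0 < e -> exists N, forall n, (N <= n)%N ->
  forall w, K w -> `|delta n (back n w)| < e.
Hypothesis uf : forall e : R, 0 < e -> exists N, forall n, (N <= n)%N ->
  forall w, K w -> `|delta n w| < e.

Lemma continuous_on_cocycle n : continuous_on (@opdist R X X) (A n) K.
Proof.
elim: n => [|n IH].
  move=> w Kw e e0; apply: filterE => w' /=; apply: le_lt_trans e0.
  by apply: opdist_ub => // x; rewrite subrr normr0 mul0r.
apply: continuous_on_compose => // w _; exact: cocycle_bounded.
Qed.

(** The starting point at time -n is fixed and the induction adds factors one at a time; each of
    them is L at a time between -n and -1. *)
Lemma continuous_on_cocycle_back n i : (i <= n)%N ->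
  continuous_on (@opdist R X X) (fun w => A i (back n w)) K.
Proof.
elim: i => [|i IH] ni.
  move=> w Kw e e0; apply: filterE => w' /=; apply: le_lt_trans e0.
  by apply: opdist_ub => // x; rewrite subrr normr0 mul0r.
apply: (continuous_on_compose (F := fun w => L (iter i sigma (back n w)))) => //.
- by move=> w _; exact: cocycle_bounded.
- have := cLb (n - i); congr (continuous_on _ _ _); apply/funext => w.
  have nin : (n - i <= n)%N by rewrite leq_subr.
  by rewrite -(iter_back_sub sigmaVK w nin) subKn// ltnW.
- exact/IH/ltnW.
Qed.

Lemma continuous_on_perron_approx n : continuous_on (@normdist R X) (approx n) K.
Proof.
have h : continuous_on (@normdist R X) (fun w => A n (back n w) x0) K.
  apply: (continuous_on_apply (F := fun w => A n (back n w))).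
  - by move=> w _; exact: cocycle_bounded.
  - exact: continuous_on_cocycle_back.
  - by move=> w Kw e e0; apply: filterE => w'; rewrite /normdist subrr normr0.
apply: continuous_on_scale => //; apply: continuous_on_inv_norm => // w _.
by apply: (cone_neq0 hC); exact: cocycle_C.
Qed.

Lemma continuous_on_perron_vector : continuous_on (@normdist R X) v K.
Proof.
apply: (continuous_on_uniform continuous_on_perron_approx) => e e0.
have K0 : 0 < 2 * Dc ^+ 2 by rewrite mulr_gt0// exprn_gt0.
have [|N /(_ N (leqnn N)) hN] := @ub (Num.min c0 (e / (2 * Dc ^+ 2))).
  by rewrite lt_min c0_gt0 divr_gt0.
exists N => w Kw; have := hN w Kw; rewrite ger0_norm// lt_min => /andP[h1 h2].
have hw := hWb (KW Kw).
apply: (le_lt_trans (perron_vector_dist sigmaVK hLC hC Dc1 hDc c0_gt0 delta_ge0 hdelta Cx0 hw h1)).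
by rewrite mulrC -ltr_pdivlMr.
Qed.

Let cAv n : continuous_on (@normdist R X) (fun w => A n w (v w)) K.
Proof.
apply: continuous_on_apply; [by move=> w _; exact: cocycle_bounded| |].
  exact: continuous_on_cocycle.
exact: continuous_on_perron_vector.
Qed.

(** Since delta is only assumed to converge uniformly on K, and not to be continuous, the factor 1 +
    delta stays outside M and is bounded later by that uniform smallness. *)
Lemma functional_bound_locally n w : K w -> exists M, 0 < M /\
  \forall w' \near within K (nbhs w),
    functional_bound sigma L Dc kappa delta n w' (v w') <= (1 + delta n w') * M.
Proof.
move=> Kw; have Av := Av_gt0 n (KW Kw).
pose a := `|A n w (v w)|; pose M1 := opnorm (A n w) + 1.
have M10 : 0 < M1 by have := opnorm_ge0 (cocycle_bounded sigma hL n w); rewrite /M1; lra.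
exists (2 * kappa * Dc * M1 * (2 / a)); split.
  by rewrite !mulr_gt0 ?invr_gt0.
have a2 : 0 < a / 2 by rewrite divr_gt0.
have := cAv n Kw a2.
have := continuous_on_opnorm (fun w _ => cocycle_bounded sigma hL n w)
  (continuous_on_cocycle n) Kw ltr01.
rewrite !near_withinE; apply: filterS2 => w' h1 h2 Kw'.
move: (h1 Kw') (h2 Kw'); rewrite /normdist => {}h1 {}h2.
have Av' := Av_gt0 n (KW Kw').
have h3 : a / 2 <= `|A n w' (v w')|.
  have := ler_normD (A n w (v w) - A n w' (v w')) (A n w' (v w')).
  by rewrite subrK -/a; lra.
have h4 : opnorm (A n w') <= M1.
  by move: h1; rewrite ltr_norml => /andP[h1 _]; rewrite /M1; lra.
rewrite /functional_bound.
have -> : (1 + delta n w') * (2 * kappa * Dc * M1 * (2 / a)) =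
   2 * kappa * Dc * (1 + delta n w') * (M1 * (a / 2)^-1) by field; rewrite gt_eqF.
rewrite -mulrA ler_wpM2l//.
  by rewrite !mulr_ge0 ?(ltW kappa0) ?(ltW Dc0)//; have := delta_ge0 n w'; lra.
apply: ler_pM => //; first exact/opnorm_ge0/cocycle_bounded.
by rewrite lef_pV2// posrE.
Qed.

Let T n w (x : X) : X := `|A n w (v w)|^-1 *: A n w x.

Let T_bounded n w : bounded_operator (T n w).
Proof.
split; first by move=> k x y; rewrite /T (cocycle_linear sigma hL n w); linear_eq R.
exists (`|A n w (v w)|^-1 * opnorm (A n w)) => x.
rewrite normrZ ger0_norm ?invr_ge0// -mulrA ler_wpM2l ?invr_ge0//.
exact/opnorm_le/cocycle_bounded.
Qed.

Let cT n : continuous_on (@opdist R X X) (T n) K.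
Proof.
apply: continuous_on_scale_op.
- by move=> w _; exact: cocycle_bounded.
- apply: continuous_on_inv_norm (cAv n) => w Kw.
  by rewrite -normr_gt0; exact: Av_gt0 (KW Kw).
- exact: continuous_on_cocycle.
Qed.

(** On the cone, eta is within e1 of the norm of T n, uniformly near w, and T n is continuous in
    operator norm. The bounded decomposition into cone vectors extends the estimate to all x. The
    time n1 bounds the functional; the time n makes the error small. *)
Lemma continuous_on_perron_functional :
  continuous_on (@opdist R X R^o) (fun w => eta w) K.
Proof.
move=> w Kw e e0.
have [|n1 /(_ n1 (leqnn n1)) dn1] := @uf (Num.min c0 1).
  by rewrite lt_min c0_gt0 ltr01.
have [M [M0 nM]] := functional_bound_locally n1 Kw.
(* Two cone vectors of norm at most kappa |x|, with error 3 e1 on each, give 6 kappa e1 < e. The 1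
   in [Num.min c0 1] yields 1 + delta <= 2, which is the 2 in e2. *)
pose e1 := e / (8 * kappa).
have e10 : 0 < e1 by rewrite divr_gt0// mulr_gt0.
pose e2 := e1 / (2 * Dc * M).
have e20 : 0 < e2 by rewrite divr_gt0// !mulr_gt0.
have [|n /(_ n (leqnn n)) dn] := @uf (Num.min c0 e2).
  by rewrite lt_min c0_gt0 e20.
rewrite near_withinE in nM; have := cT n Kw e10; rewrite !near_withinE.
apply: filterS2 (nM) => w' hM hT Kw'.
apply: (@le_lt_trans _ _ (6 * kappa * e1)); last first.
  have -> : e = 8 * kappa * e1 by rewrite /e1; field; rewrite gt_eqF.
  by rewrite ltr_pM2r// ltr_pM2r// ltr_nat.
have {}hT := ltW (hT Kw').
have ratio u y : K u -> functional_bound sigma L Dc kappa delta n1 u (v u) <=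
    (1 + delta n1 u) * M -> cone0 C y ->
    `| `|T n u y| - (eta u y : R) | <= e1 * `|y|.
  move=> Ku hB Cy.
  have := dn1 u Ku; rewrite ger0_norm// lt_min => /andP[d1 d1'].
  have := dn u Ku; rewrite ger0_norm// lt_min => /andP[d2 d2'].
  have -> : `|T n u y| = `|A n u y| / `|A n u (v u)|.
    by rewrite /T normrZ ger0_norm ?invr_ge0// mulrC.
  apply: (le_trans (perron_functional_ratio (KW Ku) Cy d1 d2)).
  rewrite mulrA ler_wpM2r//.
  have hB2 : functional_bound sigma L Dc kappa delta n1 u (v u) <= 2 * M.
    by apply: (le_trans hB); rewrite ler_pM2r//; lra.
  apply: (@le_trans _ _ (Dc * e2 * (2 * M))); last first.
    by rewrite /e2 le_eqVlt; apply/orP; left; apply/eqP; field; rewrite !gt_eqF.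
  apply: ler_pM => //.
  - by rewrite mulr_ge0// ltW.
  - exact: functional_bound_ge0.
  - by rewrite ler_wpM2l// ltW.
have Bw : functional_bound sigma L Dc kappa delta n1 w (v w) <= (1 + delta n1 w) * M.
  by have := nbhs_singleton nM; exact.
have cone_case y : cone0 C y -> `|(eta w y : R) - (eta w' y : R)| <= 3 * e1 * `|y|.
  move=> Cy; have h1 := ratio w y Kw Bw Cy; have h2 := ratio w' y Kw' (hM Kw') Cy.
  have h3 : `|T n w y - T n w' y| <= e1 * `|y|.
    apply: (le_trans (opdist_le _ (T_bounded n w) (T_bounded n w'))).
    by rewrite ler_wpM2r.
  have h4 := le_trans (ler_dist_dist _ _) h3.
  have -> : (eta w y : R) - (eta w' y : R) =
    (`|T n w y| - `|T n w' y|) - (`|T n w y| - (eta w y : R)) +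
    (`|T n w' y| - (eta w' y : R)) by ring.
  apply: (le_trans (ler_normD _ _)).
  apply: (le_trans (lerD (ler_normB _ _) (lexx _))); lra.
apply: opdist_ub => [|x].
  by apply: mulr_ge0; [rewrite mulr_ge0// ltW|exact: ltW].
have [y [z [Cy Cz ny nz xE]]] := hkappa x; rewrite [in X in X <= _]xE.
rewrite (linear_funB _ _ (eta_linear (KW Kw))) (linear_funB _ _ (eta_linear (KW Kw'))).
have hy := cone_case _ Cy; have hz := cone_case _ Cz.
have -> : (eta w y - eta w z - (eta w' y - eta w' z) : R) =
  ((eta w y : R) - (eta w' y : R)) - ((eta w z : R) - (eta w' z : R)) by ring.
apply: (le_trans (ler_normB _ _)); apply: (le_trans (lerD hy hz)).
have k1 : 3 * e1 * `|y| <= 3 * e1 * (kappa * `|x|) by rewrite ler_wpM2l// mulr_ge0// ltW.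
have k2 : 3 * e1 * `|z| <= 3 * e1 * (kappa * `|x|) by rewrite ler_wpM2l// mulr_ge0// ltW.
lra.
Qed.

End continuity.
End perron_regularity.

(** * Rank-one projections and the Grassmannian *)

Section grassmannian.
Variables (R : realType) (X : normedModType R).
Implicit Types (v x y : X) (E F : set X) (f g : X -> R^o).

Lemma line_self v : line v v.
Proof. by exists 1 => //; rewrite scale1r. Qed.

Lemma rank_one_proj_bounded (Omega : Type) (v : Omega -> X) (eta : Omega -> X -> R^o) w :
  bounded_operator (eta w) -> bounded_operator (rank_one_proj v eta w).
Proof.
move=> bf; split.
  move=> a x y; rewrite /rank_one_proj bf.1 scalerDl scalerA.
  by [].
exists (opnorm (eta w) * `|v w|) => x; rewrite /rank_one_proj normrZ mulrAC.
by rewrite ler_wpM2r//; exact: opnorm_le.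
Qed.

Lemma rank_one_coproj_bounded (Omega : Type) (v : Omega -> X) (eta : Omega -> X -> R^o) w :
  bounded_operator (eta w) -> bounded_operator (rank_one_coproj v eta w).
Proof.
move=> bf; apply: bounded_operatorB; first exact: bounded_operator_id.
exact: rank_one_proj_bounded.
Qed.

Section pair.
Variables (v : X) (f : X -> R^o).
Hypotheses (bf : bounded_operator f) (fv : f v = 1).

Let lf : linear f. Proof. by case: bf. Qed.

Lemma functional_scale_self (a : R) : f (a *: v) = a.
Proof. by rewrite (linear_funZ _ _ lf) fv; exact: mulr1. Qed.

Lemma functional_complement x : f (x - (f x : R) *: v) = 0.
Proof. by rewrite (linear_funB _ _ lf) functional_scale_self subrr. Qed.

Lemma closed_line : closed (line v).
Proof.
have b : bounded_operator (rank_one_coproj (fun _ : unit => v) (fun=> f) tt).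
  exact: rank_one_coproj_bounded.
have -> : line v = rank_one_coproj (fun _ : unit => v) (fun=> f) tt @^-1` [set 0].
  apply/seteqP; split => x /=.
    by move=> [a _ <-]; rewrite /rank_one_coproj /rank_one_proj functional_scale_self subrr.
  by move=> /eqP; rewrite subr_eq0 => /eqP ->; exists (f x).
apply: closed_comp; last exact/accessible_closed_set1/hausdorff_accessible/norm_hausdorff.
by move=> x _; exact: bounded_operator_continuous.
Qed.

Lemma closed_kernel : closed (kernel_set f).
Proof.
rewrite (_ : kernel_set f = f @^-1` [set 0])//.
apply: closed_comp; last exact/accessible_closed_set1/hausdorff_accessible/norm_hausdorff.
by move=> x _; exact: bounded_operator_continuous.
Qed.

Lemma line_kernel_direct_sum : closed_direct_sum (line v) (kernel_set f).
Proof.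
split.
- split; last exact: closed_line.
  split; first by exists 0 => //; rewrite scale0r.
  move=> a x y [b _ <-] [c _ <-]; exists (a * b + c) => //.
  by rewrite scalerDl scalerA.
- split; last exact: closed_kernel.
  split; first exact: (linear_fun0 lf).
  by move=> a x y fx fy; rewrite /kernel_set /= lf fx fy scaler0 addr0.
- apply/seteqP; split => x /=.
    move=> [[a _ <-]]; rewrite /kernel_set /= functional_scale_self => ->.
    by rewrite scale0r.
  move=> ->; split; first by exists 0 => //; rewrite scale0r.
  exact: (linear_fun0 lf).
- move=> x; exists ((f x : R) *: v), (x - (f x : R) *: v); split.
  + by exists (f x).
  + exact: functional_complement.
  + by rewrite addrC subrK.
Qed.

Lemma line_grassmannian : grassmannian (line v).
Proof. by exists (kernel_set f); exact: line_kernel_direct_sum. Qed.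

Lemma line_has_dim : has_dim (line v) 1.
Proof.
have v0 : v != 0.
  by apply/eqP => v0; move: fv; rewrite v0 (linear_fun0 lf) => /esym/eqP; rewrite oner_eq0.
exists (fun=> v); split.
  move=> c; rewrite big_ord1 => /eqP; rewrite scaler_eq0 (negPf v0) orbF => /eqP c0 i.
  by rewrite ord1.
apply/seteqP; split => x /=.
  by move=> [a _ <-]; exists (fun=> a) => //; rewrite big_ord1.
by move=> [c _ <-]; exists (c ord0) => //; rewrite big_ord1.
Qed.

End pair.

Lemma rank_one_continuous_projection (Omega : Type) (v : Omega -> X)
    (eta : Omega -> X -> R^o) w : bounded_operator (eta w) -> eta w (v w) = 1 ->
  continuous_projection (rank_one_proj v eta w) (line (v w)) (kernel_set (eta w)).
Proof.
move=> bf fv; split.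
- exact: rank_one_proj_bounded.
- by move=> x; rewrite /rank_one_proj (functional_scale_self bf fv).
- apply/seteqP; split => x /=.
    by move=> [y _ <-]; exists (eta w y).
  move=> [a _ <-]; exists (a *: v w) => //.
  by rewrite /rank_one_proj (functional_scale_self bf fv).
- apply/seteqP; split => x; rewrite /kernel_set /= /rank_one_proj.
    by move=> /(congr1 (eta w)); rewrite (functional_scale_self bf fv) (linear_fun0 bf.1).
  by move=> ->; rewrite scale0r.
Qed.

Lemma hausdorff_dist_le (A B : set X) (e : R) : A !=set0 -> B !=set0 ->
  (forall a, A a -> exists2 b, B b & `|a - b| <= e) ->
  (forall b, B b -> exists2 a, A a & `|b - a| <= e) ->
  hausdorff_dist A B <= e.
Proof.
have dist_le a (S : set X) b : S b -> `|a - b| <= e -> dist_to a S <= e.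
  move=> Sb; apply: le_trans; apply: ge_inf; last by exists b.
  by exists 0 => _ [c _ <-].
move=> [a0 Aa0] [b0 Bb0] h1 h2; rewrite /hausdorff_dist ge_max; apply/andP; split.
  apply: ge_sup; first by exists (dist_to a0 B), a0.
  by move=> _ [a Aa <-]; have [b Bb ab] := h1 a Aa; exact: dist_le ab.
apply: ge_sup; first by exists (dist_to b0 A), b0.
by move=> _ [b Bb <-]; have [a Aa ab] := h2 b Bb; exact: dist_le ab.
Qed.

Lemma grassmannian_dist_line x y : `|x| = 1 -> `|y| = 1 ->
  grassmannian_dist (line x) (line y) <= `|x - y|.
Proof.
have half u z : `|u| = 1 -> `|z| = 1 -> forall a, unit_ball_of (line u) a ->
    exists2 b, unit_ball_of (line z) b & `|a - b| <= `|u - z|.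
  move=> u1 z1 _ [[a _ <-]]; rewrite normrZ u1 mulr1 => a1.
  exists (a *: z); first by split; [exists a|rewrite normrZ z1 mulr1].
  by rewrite -scalerBr normrZ ler_piMl.
move=> x1 y1; apply: hausdorff_dist_le.
- by exists x; split; [exact: line_self|rewrite x1].
- by exists y; split; [exact: line_self|rewrite y1].
- exact: half.
- by rewrite distrC; exact: half.
Qed.

(** A vector a of the unit ball of ker p is moved into ker q by subtracting q(a) z, where |q(a)| is
    at most the distance of p and q. The result may leave the unit ball, and rescaling it costs the
    same amount again, whence the 2. *)
Lemma grassmannian_dist_kernel f g x y : bounded_operator f -> bounded_operator g ->
  `|x| = 1 -> `|y| = 1 -> f x = 1 -> g y = 1 ->
  grassmannian_dist (kernel_set f) (kernel_set g) <= 2 * opdist f g.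
Proof.
have half (p q : X -> R^o) z : bounded_operator p -> bounded_operator q ->
    `|z| = 1 -> q z = 1 -> forall a, unit_ball_of (kernel_set p) a ->
    exists2 b, unit_ball_of (kernel_set q) b & `|a - b| <= 2 * opdist p q.
  move=> bp bq z1 qz a [pa a1].
  pose c := a - (q a : R) *: z.
  have qc : q c = 0 by exact: functional_complement.
  have od := opdist_le a bp bq.
  rewrite (pa : p a = 0) sub0r normrN in od.
  have od0 : 0 <= opdist p q by apply: opnorm_ge0; exact: bounded_operatorB.
  have qa : `|q a| <= opdist p q by apply: (le_trans od); rewrite ler_piMr.
  have ac : `|a - c| <= opdist p q.
    by rewrite /c opprB addrC subrK normrZ z1 mulr1.
  pose m := Num.max 1 `|c|.
  have m1 : 1 <= m by rewrite le_max lexx.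
  have m0 : 0 < m by exact: lt_le_trans m1.
  have mc : `|c| <= m by rewrite le_max lexx orbT.
  exists (m^-1 *: c).
    split; first by rewrite /kernel_set /= (linear_funZ _ _ bq.1) qc scaler0.
    by rewrite normrZ ger0_norm ?invr_ge0 ?(ltW m0)// mulrC ler_pdivrMr// mul1r.
  have -> : a - m^-1 *: c = (a - c) + (1 - m^-1) *: c by linear_eq R.
  apply: (le_trans (ler_normD _ _)); rewrite normrZ.
  have mi : m^-1 <= 1 by rewrite invf_le1.
  rewrite ger0_norm ?subr_ge0//.
  have : (1 - m^-1) * `|c| <= (1 - m^-1) * m by rewrite ler_wpM2l// subr_ge0.
  have -> : (1 - m^-1) * m = m - 1 by rewrite mulrBl mul1r mulVf// gt_eqF.
  have : m <= 1 + opdist p q.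
    rewrite ge_max lerDl od0 /=.
    have := ler_normB a (a - c); rewrite opprB addrC subrK.
    lra.
  lra.
move=> bf bg x1 y1 fx gy; apply: hausdorff_dist_le.
- by exists 0; split; [exact: (linear_fun0 bf.1)|rewrite normr0].
- by exists 0; split; [exact: (linear_fun0 bg.1)|rewrite normr0].
- exact: half bf bg y1 gy.
- have -> : opdist f g = opdist g f.
    rewrite /opdist /opnorm /opnorm_on; congr (sup _).
    by apply/seteqP; split => _ [a ha <-]; exists a => //; rewrite distrC.
  exact: half bg bf x1 fx.
Qed.

(** The line of a vector is controlled for unit vectors only, so O is not pulled back directly: U is
    an open set of X constructed to have the right trace on the values of v. *)
Lemma grassmannian_measurable_line (s : nat -> X)
    (hs : forall x e, 0 < e -> exists n, `|x - s n| < e) d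
    (Omega : measurableType d) (D : set Omega) (v : Omega -> X) : measurable D ->
  norm_measurable D v -> (forall w, D w -> `|v w| = 1) ->
  (forall w, D w -> grassmannian (line (v w))) ->
  grassmannian_measurable D (fun w => line (v w)).
Proof.
move=> mD mv v1 gv; split => //.
apply: (measurable_preimage_generated mD gv) => O [_ oO].
pose U := [set x | exists y e, [/\ `|y| = 1, `|y - x| < e &
  forall F, grassmannian F -> grassmannian_dist (line y) F < e -> O F]].
have oU : open U.
  rewrite openE => x [y [e [y1 yx hO]]]; apply/nbhs_ballP.
  exists (e - `|y - x|) => /=; first by rewrite subr_gt0.
  move=> z; rewrite -ball_normE /= => xz; exists y, e; split => //.
  have := ler_normD (y - x) (x - z); rewrite addrA subrK; lra.
rewrite (_ : _ `&` _ = D `&` v @^-1` U); first exact: (norm_measurable_open hs).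
apply/seteqP; split => w /= [Dw h]; split => //.
  have [e e0 he] := oO _ h; exists (v w), e; split => //; first exact: v1.
  by rewrite subrr normr0.
have [y [e [y1 yx hO]]] := h; apply: hO; first exact: gv.
by apply: le_lt_trans yx; apply: grassmannian_dist_line => //; exact: v1.
Qed.

Lemma opnorm_functional_ge1 f v : bounded_operator f -> f v = 1 -> `|v| = 1 ->
  1 <= opnorm f.
Proof.
move=> bf fv v1; have := opnorm_le v bf.
by rewrite fv v1 mulr1 normr1.
Qed.

Lemma opnorm_rank_one_proj (Omega : Type) (v : Omega -> X) (eta : Omega -> X -> R^o) w :
  bounded_operator (eta w) -> eta w (v w) = 1 -> `|v w| = 1 ->
  1 <= opnorm (rank_one_proj v eta w) <= 2 * opnorm (eta w).
Proof.
move=> bf fv v1; have o1 := opnorm_functional_ge1 bf fv v1.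
have bp := rank_one_proj_bounded v bf.
apply/andP; split.
  by have := opnorm_le (v w) bp; rewrite /rank_one_proj fv scale1r v1 mulr1.
apply: opnorm_ub => [|x]; first lra.
rewrite /rank_one_proj normrZ v1 mulr1.
by have := opnorm_le x bf; have := normr_ge0 (eta w x); lra.
Qed.

(** The lower bound comes from a nonzero vector of the kernel, which I - pi fixes; there is one
    unless X is the line through v w. *)
Lemma opnorm_rank_one_coproj (Omega : Type) (v : Omega -> X) (eta : Omega -> X -> R^o) w :
  bounded_operator (eta w) -> eta w (v w) = 1 -> `|v w| = 1 ->
  ~ has_dim [set: X] 1 ->
  1 <= opnorm (rank_one_coproj v eta w) <= 2 * opnorm (eta w).
Proof.
move=> bf fv v1 nd; have o1 := opnorm_functional_ge1 bf fv v1.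
have bp := rank_one_coproj_bounded v bf.
apply/andP; split.
  have [x [x0 fx]] : exists x, x != 0 /\ eta w x = 0.
    apply: contrapT => h; apply: nd.
    rewrite (_ : [set: X] = line (v w)); first exact: line_has_dim bf fv.
    apply/seteqP; split => // x _; exists (eta w x) => //.
    apply/eqP; rewrite eq_sym -subr_eq0; apply/eqP; apply: contrapT => /eqP nx.
    apply: h; exists (x - (eta w x : R) *: v w); split => //.
    exact: functional_complement.
  have := opnorm_le x bp; rewrite /rank_one_coproj /rank_one_proj fx scale0r subr0.
  by rewrite -[leLHS]mul1r ler_pM2r// normr_gt0.
apply: opnorm_ub => [|x]; first lra.
rewrite /rank_one_coproj; apply: (le_trans (ler_normB _ _)).
rewrite /rank_one_proj normrZ v1 mulr1.
have : 1 * `|x| <= opnorm (eta w) * `|x| by rewrite ler_wpM2r.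
by have := opnorm_le x bf; lra.
Qed.

End grassmannian.

Section rank_one_continuity.
Variables (R : realType) (d : measure_display).
Variables (Omega : measurableTopologicalType d) (X : normedModType R).
Variables (v : Omega -> X) (eta : Omega -> X -> R^o) (K : set Omega).
Hypotheses (beta : forall w, K w -> bounded_operator (eta w)).
Hypothesis cv : continuous_on (@normdist R X) v K.
Hypothesis ceta : continuous_on (@opdist R X R^o) eta K.

Lemma continuous_on_rank_one_proj :
  continuous_on (@opdist R X X) (rank_one_proj v eta) K.
Proof.
move=> w Kw e e0.
have M0 := opnorm_ge0 (beta Kw).
pose e1 := e / (opnorm (eta w) + `|v w| + 2 + e).
have u0 := normr_ge0 (v w).
have D0 : 0 < opnorm (eta w) + `|v w| + 2 + e by lra.
have e10 : 0 < e1 by rewrite divr_gt0.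
have e1e : e1 * (opnorm (eta w) + `|v w| + 2 + e) = e by rewrite divfK ?gt_eqF.
have e11 : e1 <= 1 by rewrite ler_pdivrMr//; lra.
have := ceta Kw e10; have := cv Kw e10; rewrite !near_withinE.
apply: filterS2 => w' ha hF Kw'; move: (ha Kw') (hF Kw'); rewrite /normdist => {}ha {}hF.
apply: (@le_lt_trans _ _ (e1 * (opnorm (eta w) + `|v w| + 1))); last first.
  have : 0 < e1 * e by rewrite mulr_gt0.
  by move: e1e; rewrite !mulrDr; lra.
apply: opdist_ub => [|x /=]; first by rewrite mulr_ge0 ?(ltW e10)//; lra.
rewrite /rank_one_proj.
have -> : (eta w x : R) *: v w - (eta w' x : R) *: v w' =
  (eta w x : R) *: (v w - v w') + ((eta w x : R) - (eta w' x : R)) *: v w'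
  by linear_eq R.
apply: (le_trans (ler_normD _ _)); rewrite !normrZ.
have x0 := normr_ge0 x.
have h1 := opnorm_le x (beta Kw).
have h2 := opdist_le x (beta Kw) (beta Kw').
have h3 : `|v w'| <= `|v w| + 1.
  have := ler_normB (v w) (v w - v w'); rewrite opprB addrC subrK.
  by lra.
have h4 : `|(eta w x : R)| * `|v w - v w'| <= (opnorm (eta w) * `|x|) * e1.
  by apply: ler_pM => //; exact: ltW.
have h5 : `|(eta w x : R) - (eta w' x : R)| * `|v w'| <= (e1 * `|x|) * (`|v w| + 1).
  by apply: ler_pM => //; apply: (le_trans h2); rewrite ler_wpM2r// ltW.
by lra.
Qed.

Lemma continuous_on_rank_one_coproj :
  continuous_on (@opdist R X X) (rank_one_coproj v eta) K.
Proof.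
move=> w Kw e e0; have := continuous_on_rank_one_proj Kw e0.
rewrite !near_withinE; apply: filterS => w' h Kw'; have := h Kw'.
congr (_ < _); rewrite /opdist /opnorm /opnorm_on; congr (sup _).
have E a : `|rank_one_proj v eta w a - rank_one_proj v eta w' a| =
    `|rank_one_coproj v eta w a - rank_one_coproj v eta w' a|.
  rewrite /rank_one_coproj; move: (rank_one_proj _ _ _ _) (rank_one_proj _ _ _ _).
  by move=> p q; rewrite distrC; congr (`| _ |); linear_eq R.
by apply/seteqP; split => _ [a ha <-]; exists a.
Qed.

End rank_one_continuity.

(** * Growth rates *)

Section growth_rates.
Variable R : realType.
Implicit Types (u w s : nat -> R) (l K : R).

Lemma log_rate_pos u n : 0 < u n -> log_rate u n = (n%:R^-1 * ln (u n))%:E.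
Proof. by move=> u0; rewrite /log_rate lne_EFin. Qed.

Lemma cvg_nat_inv : n%:R^-1 @[n --> \oo] --> (0 : R).
Proof.
by rewrite -(cvg_shiftS (fun n => n%:R^-1 : R)); exact: cvg_harmonic.
Qed.

Lemma cvg_average_cst (c : R) : n%:R^-1 * c @[n --> \oo] --> (0 : R).
Proof.
by rewrite -[X in _ --> X](mul0r c); apply: cvgM; [exact: cvg_nat_inv|exact: cvg_cst].
Qed.

Lemma limn_esup_le_fin (u : nat -> \bar R) l :
  (forall e, 0 < e -> \forall n \near \oo, (u n <= (l + e)%:E)%E) ->
  (limn_esup u <= l%:E)%E.
Proof.
move=> h; apply/lee_addgt0Pr => e e0.
have [N _ hN] := h e e0.
apply: (@le_trans _ _ (ereal_sup (u @` [set n | (N <= n)%N]))).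
  by apply: ereal_inf_lbound; exists [set n | (N <= n)%N] => //; exists N.
by apply: ge_ereal_sup => _ [n /= Nn <-]; exact: hN.
Qed.

(* u may vanish, in which case its logarithmic rate is -oo. *)
Lemma limn_esup_log_rate u w s K l : 0 < K -> (forall n, 0 <= u n) ->
  (forall n, 0 < w n) ->
  (\forall n \near \oo, u n <= K * expR (s n) * w n) ->
  (n%:R^-1 * s n @[n --> \oo] --> l) ->
  (limn_esup (fun n => log_rate u n - (n%:R^-1 * ln (w n))%:E) <= l%:E)%E.
Proof.
move=> K0 u0 w0 uKw sl; apply: limn_esup_le_fin => e e0.
have : n%:R^-1 * ln K + n%:R^-1 * s n @[n --> \oo] --> l.
  by rewrite -[X in _ --> X]add0r; apply: cvgD => //; exact: cvg_average_cst.
move=> /cvgrPdist_le/(_ e e0) hd.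
(* At n = 0 the factor n^-1 is 0 and would turn the rate -oo of a vanishing u into 0. *)
have n0 : \forall n \near \oo, (0 < n)%N by exists 1%N.
apply: filterS3 uKw hd n0 => n uKw hd n0.
have := u0 n; rewrite le_eqVlt => /predU1P[un|un].
  have ni : (0 < (n%:R^-1 : R)%:E)%E by rewrite lte_fin invr_gt0 ltr0n.
  by rewrite /log_rate -un le0_lneNy// gt0_muleNy// addNye leNye.
rewrite log_rate_pos// -EFinB lee_fin -mulrBr.
have h : ln (u n) <= ln K + s n + ln (w n).
  have -> : ln K + s n + ln (w n) = ln (K * expR (s n) * w n).
    have E0 := expR_gt0 (s n).
    by rewrite lnM ?posrE ?mulr_gt0// lnM ?posrE// expRK.
  by rewrite ler_ln ?posrE ?mulr_gt0 ?expR_gt0.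
have : n%:R^-1 * (ln (u n) - ln (w n)) <= n%:R^-1 * (ln K + s n).
  by apply: ler_wpM2l; [rewrite invr_ge0|lra].
move: hd; rewrite -mulrDr ler_norml => /andP[hd _].
lra.
Qed.

Lemma log_rate_comparable u w K (lam : \bar R) : 0 < K ->
  (forall n, 0 < w n) -> (forall n, w n <= u n) ->
  (\forall n \near \oo, u n <= K * w n) ->
  (n%:R^-1 * ln (w n))%:E @[n --> \oo] --> lam -> log_rate u @ \oo --> lam.
Proof.
move=> K0 w0 wu uK wl.
have u0 n : 0 < u n by exact: lt_le_trans (wu n).
have up : ((n%:R^-1 * ln K)%:E + (n%:R^-1 * ln (w n))%:E)%E @[n --> \oo] --> lam.
  rewrite -[X in _ --> X]add0e; apply: cvgeD => //.
  by apply: cvg_EFin; [exact: nearW|exact: cvg_average_cst].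
apply: (squeeze_cvge _ wl up); apply: filterS uK => n uK.
rewrite log_rate_pos// -EFinD !lee_fin -mulrDr !ler_wpM2l ?invr_ge0//.
  by rewrite -lnM ?posrE// ler_ln ?posrE ?mulr_gt0//.
by rewrite ler_ln ?posrE.
Qed.

Lemma log_rate_tempered u w K : 0 < K -> (forall n, 1 <= u n <= K * w n) ->
  n%:R^-1 * ln (w n) @[n --> \oo] --> (0 : R) -> log_rate u @ \oo --> 0%E.
Proof.
move=> K0 h wl.
have u0 n : 0 < u n by have /andP[h1 _] := h n; exact: lt_le_trans h1.
have w0 n : 0 < w n.
  by have /andP[_ h2] := h n; have := lt_le_trans (u0 n) h2; rewrite pmulr_rgt0.
rewrite (_ : log_rate u = EFin \o (fun n => n%:R^-1 * ln (u n))); last first.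
  by apply/funext => n; rewrite log_rate_pos.
apply: cvg_EFin; first exact: nearW.
have up : n%:R^-1 * ln K + n%:R^-1 * ln (w n) @[n --> \oo] --> (0 : R).
  by rewrite -[X in _ --> X]add0r; apply: cvgD => //; exact: cvg_average_cst.
apply: (squeeze_cvgr _ (cvg_cst 0) up); apply: nearW => n.
have /andP[h1 h2] := h n.
rewrite mulr_ge0 ?invr_ge0 ?ln_ge0//= -mulrDr ler_wpM2l ?invr_ge0//.
by rewrite -lnM ?posrE// ler_ln ?posrE// mulr_gt0.
Qed.

(** The limit exists beforehand, possibly infinite; along the times when s is bounded by M the
    averages tend to 0, which identifies it. *)
Lemma recurrent_average_cvg0 s (M : R) (c : \bar R) :
  (n%:R^-1 * s n)%:E @[n --> \oo] --> c ->
  (forall N, exists2 n, (N <= n)%N & `|s n| <= M) ->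
  n%:R^-1 * s n @[n --> \oo] --> (0 : R).
Proof.
move=> sc rec; have /choice[f hf] : forall N, exists n, (N <= n)%N /\ `|s n| <= M.
  by move=> N; have [n] := rec N; exists n.
have fn n : (n <= f n)%N by case: (hf n).
have foo : f n @[n --> \oo] --> \oo.
  by move=> A [N _ hN]; exists N => // n /= Nn; apply: hN; exact: leq_trans (fn n).
have h1 : ((f n)%:R^-1 * s (f n))%:E @[n --> \oo] --> c.
  exact: (cvg_comp _ _ foo sc).
have h2 : ((f n)%:R^-1 * s (f n))%:E @[n --> \oo] --> (0%:E : \bar R).
  apply: cvg_EFin; first exact: nearW.
  apply/norm_cvg0P.
  apply: (squeeze_cvgr _ (cvg_cst 0) (cvg_average_cst M)).
  have n0 : \forall n \near \oo, (0 < n)%N by exists 1%N.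
  apply: filterS n0 => n n0; rewrite normr_ge0/= normrM normfV normr_nat.
  have [nf sM] := hf n.
  apply: ler_pM => //; rewrite ?invr_ge0// lef_pV2 ?ler_nat// posrE ltr0n//.
  exact: leq_trans nf.
have c0 : c = 0%:E by exact: (cvg_unique _ h1 h2).
by rewrite c0 in sc; exact: (fine_cvg sc).
Qed.

Lemma frequency_cvg_infty (a : nat -> nat) (p : R) : 0 < p ->
  n%:R^-1 * (a n)%:R @[n --> \oo] --> p -> a n @[n --> \oo] --> \oo.
Proof.
move=> p0 ap A [M _ hM].
have p2 : 0 < p / 2 by rewrite divr_gt0.
have /cvgrPdist_lt/(_ _ p2) h1 := ap.
have /cvgrPdist_lt/(_ _ p2) h2 := cvg_average_cst M%:R.
have n0 : \forall n \near \oo, (0 < n)%N by exists 1%N.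
apply: filterS3 h1 h2 n0 => n h1 h2 n0; apply: hM => /=.
rewrite leqNgt; apply/negP => aM.
have ni : 0 < n%:R^-1 :> R by rewrite invr_gt0 ltr0n.
have : n%:R^-1 * (a n)%:R <= n%:R^-1 * M%:R :> R.
  by rewrite ler_pM2l// ler_nat ltnW.
move: h1 h2; rewrite sub0r normrN => /ltr_normlP[_ h1] /ltr_normlP[h2 h3].
move: h1 h2 h3; move: (n%:R^-1 * _) (n%:R^-1 * _) => x y h1 h2 h3 h4.
lra.
Qed.

Lemma cvg_geometric_rate (c r : R) (a : nat -> nat) : 0 <= r < 1 ->
  a n @[n --> \oo] --> \oo -> c * r ^+ a n @[n --> \oo] --> (0 : R).
Proof.
move=> /andP[r0 r1] aoo; rewrite -[X in _ --> X](mulr0 c).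
apply: cvgM; first exact: cvg_cst.
apply: (cvg_comp _ _ aoo); apply: cvg_expr; rewrite ger0_norm//.
Qed.

End growth_rates.

(** * Recurrence and invariant sets *)

Section recurrence.
Variables (R : realType) (d : measure_display) (Omega : measurableType d).
Variable mu : probability Omega R.

Lemma ae_setT_mu1 (W : set Omega) : measurable W -> mu (~` W) = 0%E -> mu W = 1%E.
Proof.
by move=> mW W0; rewrite -(setCK W) probability_setC ?W0 ?sube0//; exact: measurableC.
Qed.

Lemma quasi_integrable_fin (f : Omega -> R) : measurable_fun setT f ->
  mu.-integrable setT (EFin \o (fun w => Num.max 0 (f w))) ->
  (-oo < \int[mu]_w (f w)%:E)%E -> mu.-integrable setT (EFin \o f).
Proof.
move=> mf fp foo.
have mp : measurable_fun setT (EFin \o f) by exact/measurable_EFinP.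
have pE w : (EFin \o f)^\+%E w = (Num.max 0 (f w))%:E.
  by rewrite funeposE /= EFin_max maxC.
have pfin : (\int[mu]_w (EFin \o f)^\+%E w < +oo)%E.
  under eq_integral do rewrite pE.
  have /integrableP[_] := fp; apply: le_lt_trans; apply: ge0_le_integral => //.
  - by move=> w _; rewrite lee_fin le_max lexx.
  - by have /integrableP[] := fp.
  - by apply: measurableT_comp => //; have /integrableP[] := fp.
  - by move=> w _; exact: lee_abs.
have nfin : (\int[mu]_w (EFin \o f)^\-%E w < +oo)%E.
  rewrite ltey; apply: contraTneq foo => noo.
  by rewrite integralE /= noo addeNy.
apply/integrableP; split => //.
rewrite (eq_integral (fun w => (EFin \o f)^\+%E w + (EFin \o f)^\-%E w)%E); last first.
  by move=> w _; rewrite -[RHS]/(((EFin \o f)^\+ \+ (EFin \o f)^\-)%E w) -fune_abse.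
rewrite ge0_integralD//; first exact: lte_add_pinfty.
- exact: measurable_funepos.
- exact: measurable_funeneg.
Qed.

Variables T TV : Omega -> Omega.
Hypothesis hT : ergodic_invertible mu T TV.

Lemma ae_frequency (G : set Omega) : measurable G ->
  {ae mu, forall w, n%:R^-1 * (visits T G n w)%:R @[n --> \oo] --> fine (mu G)}.
Proof.
move=> mG; have iG : mu.-integrable setT (EFin \o (\1_G : Omega -> R)).
  by apply: integrable_indic => //; exact: fin_num_fun_lty.
have := birkhoff hT iG; apply: filterS => w.
rewrite integral_indic// setIT.
apply: cvg_trans; apply: near_eq_cvg; apply: nearW => n; congr (_ * _).
rewrite /birkhoff_sum /visits natr_sum; apply: eq_bigr => i _.
by rewrite indicE; congr (_%:R); congr nat_of_bool; apply/idP/idP; rewrite in_setE => /asboolP.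
Qed.

Lemma frequency_recurrent (G : set Omega) (p : R) w : 0 < p ->
  n%:R^-1 * (visits T G n w)%:R @[n --> \oo] --> p ->
  forall N, exists2 n, (N <= n)%N & G (iter n T w).
Proof.
move=> p0 /(frequency_cvg_infty p0) h N; apply: contrapT => nG.
have [n _ hn] := h _ (nbhs_infty_gt (visits T G N w)).
have := hn (maxn N n) (leq_maxr _ _); rewrite /= ltnNge; apply/negP; rewrite negbK.
rewrite -(subnKC (leq_maxl N n)) visitsD -[leqRHS]addn0 leq_add2l leqn0.
rewrite /visits big1 // => i _; rewrite asboolF// -iterD => Gi.
by apply: nG; exists (i + N)%N => //; exact: leq_addl.
Qed.

Lemma telescoping_average_cvg0 (h : Omega -> R) : measurable_fun setT h ->
  mu.-integrable setT (EFin \o (fun w => Num.max 0 (h w - h (T w)))) ->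
  {ae mu, forall w, n%:R^-1 * h (iter n T w) @[n --> \oo] --> (0 : R)}.
Proof.
move=> mh ih.
have mhT : measurable_fun setT (fun w => h w - h (T w)).
  apply: measurable_funB => //.
  exact: (measurableT_comp mh (ergodic_measurable hT)).
pose S M := [set w | `|h w| <= M%:R].
have mS M : measurable (S M).
  rewrite -[X in measurable X]setTI; apply: measurable_fun_le => //.
  exact: measurableT_comp.
have [M S0] : exists M, mu (S M) != 0%E.
  apply: contrapT => /forallNP S0.
  suff : mu setT = 0%E by rewrite probability_setT => -[] /eqP; rewrite oner_eq0.
  rewrite (_ : setT = \bigcup_M S M); last first.
    apply/seteqP; split => // w _; exists (Num.truncn `|h w|).+1 => //.
    by rewrite /S/= ltW// truncnS_gt.
  apply/eqP; rewrite -measure_le0; apply: le_trans (measure_sigma_subadditive _ _ _ (@subset_refl _ _)) _.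
  - exact: mS.
  - exact: bigcupT_measurable.
  - by rewrite eseries0// => i _ _; apply/eqP; have /negP := S0 i; rewrite negbK.
have p0 : 0 < fine (mu (S M)).
  by rewrite fine_gt0// lt0e S0 measure_ge0 /= ltey_eq fin_num_measure.
apply: filterS2 (birkhoff_quasi_integrable hT mhT ih) (ae_frequency (mS M)) => w hB hV.
pose s n := h w - h (iter n T w).
have sE n : birkhoff_sum T (fun w => h w - h (T w)) n w = s n.
  elim: n => [|n IH]; first by rewrite birkhoff_sum0 /s subrr.
  by rewrite birkhoff_sumSr IH /s /=; ring.
have hs : n%:R^-1 * s n @[n --> \oo] --> (0 : R).
  apply: (@recurrent_average_cvg0 _ s (`|h w| + M%:R)).
    by move: hB; under eq_fun do rewrite sE; exact.
  move=> N; have [n Nn Sn] := frequency_recurrent p0 hV N.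
  by exists n => //; apply: (le_trans (ler_normB _ _)); rewrite lerD2l.
rewrite (_ : (fun n => n%:R^-1 * h (iter n T w)) =
  fun n => n%:R^-1 * h w - n%:R^-1 * s n); last by apply/funext => n; rewrite /s; ring.
by rewrite -[X in _ --> X](subr0 0); apply: cvgB => //; exact: cvg_average_cst.
Qed.

Lemma telescoping_average_cvg0_le (h b : Omega -> R) : measurable_fun setT h ->
  mu.-integrable setT (EFin \o b) -> (forall w, 0 <= b w) ->
  (forall w, h w - h (T w) <= b w) ->
  {ae mu, forall w, n%:R^-1 * h (iter n T w) @[n --> \oo] --> (0 : R)}.
Proof.
move=> mh ib b0 hb; apply: telescoping_average_cvg0 => //.
apply: (le_integrable measurableT _ _ ib).
  apply/measurable_EFinP; apply: measurable_maxr; first exact: measurable_cst.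
  apply: measurable_funB => //.
  exact: (measurableT_comp mh (ergodic_measurable hT)).
move=> w _ /=; rewrite lee_fin ger0_norm ?le_max ?lexx// ger0_norm//.
by rewrite ge_max b0 hb.
Qed.

(** The preimages of the exceptional null set under all forward and backward iterates are discarded.
    Invariance is exact, and not only up to null sets, because later statements are made at every
    point of an orbit. *)
Lemma invariant_core (P : Omega -> Prop) : {ae mu, forall w, P w} ->
  exists O : set Omega, [/\ measurable O, mu (~` O) = 0%E, T @^-1` O = O,
    TV @^-1` O = O & forall w, O w -> P w].
Proof.
move=> [N [mN N0 PN]].
have nullT (F : Omega -> Omega) FV : ergodic_invertible mu F FV -> forall n,
    measurable (iter n F @^-1` N) /\ mu (iter n F @^-1` N) = 0%E.
  move=> hF; elim=> [|n [m0 mE]] //.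
  rewrite (_ : iter n.+1 F @^-1` N = F @^-1` (iter n F @^-1` N)); last first.
    by apply/seteqP; split => w /=; rewrite -iterSr.
  rewrite (ergodic_preserving hF)//; split => //.
  by rewrite -[X in measurable X]setTI; exact: (ergodic_measurable hF).
pose Z n := iter n T @^-1` N `|` iter n TV @^-1` N.
have mZ n : measurable (Z n).
  by apply: measurableU; [case: (nullT _ _ hT n)|case: (nullT _ _ (ergodic_inverse hT) n)].
have Z0 n : mu (Z n) = 0%E.
  apply/eqP; rewrite -measure_le0.
  have [m1 e1] := nullT _ _ hT n; have [m2 e2] := nullT _ _ (ergodic_inverse hT) n.
  by apply: (le_trans (measureU2 _ m1 m2)); rewrite [X in (X + _)%E]e1 [X in (_ + X)%E]e2 adde0.
have mU : measurable (\bigcup_n Z n) by exact: bigcupT_measurable.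
have U0 : mu (\bigcup_n Z n) = 0%E.
  apply/eqP; rewrite -measure_le0.
  apply: le_trans (measure_sigma_subadditive _ _ _ (@subset_refl _ _)) _ => //.
  by rewrite eseries0// => i _ _; exact: Z0.
have TK := ergodic_cancel hT; have VK := ergodic_cancelV hT.
have iT w : (\bigcup_n Z n) (T w) -> (\bigcup_n Z n) w.
  move=> [n _ [h|h]]; first by exists n.+1 => //; left; rewrite /preimage/= -iterS iterSr.
  case: n h => [|n]; rewrite /preimage /= => h; first by exists 1%N => //; left.
  by exists n => //; right; rewrite -iterS iterSr TK in h.
have iV w : (\bigcup_n Z n) (TV w) -> (\bigcup_n Z n) w.
  move=> [n _ [h|h]]; last by exists n.+1 => //; right; rewrite /preimage/= -iterS iterSr.
  case: n h => [|n]; rewrite /preimage /= => h; first by exists 1%N => //; right.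
  by exists n => //; left; rewrite -iterS iterSr VK in h.
exists (~` \bigcup_n Z n); split.
- exact: measurableC.
- by rewrite setCK.
- apply/seteqP; split => w /= h1 h2; apply: h1; last exact: iT.
  by apply: iV; rewrite TK.
- apply/seteqP; split => w /= h1 h2; apply: h1; last exact: iV.
  by apply: iT; rewrite VK.
- by move=> w h; apply: contrapT => nP; apply: h; exists 0%N => //; left; exact: PN.
Qed.

End recurrence.

(** A one-sided bound on the increments serves both directions of time: for the inverse map it is a
    bound on the increments of - h by b \o TV. *)
Lemma tempered_of_increments (R : realType) d (Omega : measurableType d)
    (mu : probability Omega R) (T TV : Omega -> Omega) (h b : Omega -> R) :
  ergodic_invertible mu T TV -> measurable_fun setT h ->
  mu.-integrable setT (EFin \o b) -> (forall w, 0 <= b w) ->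
  (forall w, h w - h (T w) <= b w) ->
  {ae mu, forall w, n%:R^-1 * h (iter n T w) @[n --> \oo] --> (0 : R) /\
                    n%:R^-1 * h (iter n TV w) @[n --> \oo] --> (0 : R)}.
Proof.
move=> hT mh ib b0 hb; have hV := ergodic_inverse hT.
have F := telescoping_average_cvg0_le hT mh ib b0 hb.
have mhN : measurable_fun setT (fun w => - h w) by exact: measurable_funN.
have hbV w : - h w - - h (TV w) <= (b \o TV) w.
  by have := hb (TV w); rewrite (ergodic_cancelV hT) opprK addrC.
have B := telescoping_average_cvg0_le hV mhN (preserving_integrable hV ib)
  (fun w => b0 (TV w)) hbV.
apply: filterS2 F B => w hF hB; split => //.
rewrite (_ : (fun n => _) = fun n => - (n%:R^-1 * - h (iter n TV w))).
  by rewrite -[X in _ --> X]oppr0; exact: cvgN.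
by apply/funext => n; rewrite mulrN opprK.
Qed.

(** * The contracting set *)

Section contracting_set.
Variables (R : realType) (d : measure_display).
Variables (Omega : measurableTopologicalType d) (mu : probability Omega R).
Variables (sigma sigmaV : Omega -> Omega) (X : completeNormedModType R).
Variables (L : Omega -> X -> X) (C : set X).
Hypothesis hsigma : ergodic_invertible mu sigma sigmaV.
Hypothesis hL : forall w, bounded_operator (L w).
Hypothesis hLC : forall w, L w @` C `<=` C.
Hypothesis hC : nice_cone C.

Local Notation A := (cocycle sigma L).

Lemma strongly_measurable_contracting k (dl : R) : 0 <= dl ->
  strongly_measurable_rds L -> measurable [set w | ratio_diam C dl (A k w)].
Proof.
move=> dl0 [/dense_sequence[s hs] mL].
apply: (measurable_ratio_diam hC hs) => //.
- by move=> w; exact: cocycle_bounded.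
- by move=> w; exact: cocycle_cone.
- move=> x; apply: (norm_measurable_cocycle hL hs (ergodic_measurable hsigma)).
  by move=> y; exact: strongly_measurable_eval.
Qed.

(** The contrapositive of [order_ratio_closed]: failure is witnessed by one pair of vectors and
    persists as long as their images move little. *)
Lemma ratio_diam_far (T : X -> X) (dl : R) : 0 <= dl -> T @` C `<=` C ->
  ~ ratio_diam C dl T -> exists x y e, [/\ C x, C y, 0 < e & forall T' : X -> X,
    T' @` C `<=` C -> `|T x - T' x| < e -> `|T y - T' y| < e ->
    ~ ratio_diam C dl T'].
Proof.
move=> dl0 posT nT; apply: contrapT => H; apply: nT => x y Cx Cy.
have [Dc Dc1 hDc] := nice_cone_adapted hC.
have TC (T' : X -> X) z : T' @` C `<=` C -> C z -> C (T' z).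
  by move=> pos Cz; apply: pos; exists z.
apply: (order_ratio_closed hC Dc1 hDc dl0); [exact: TC|exact: TC|] => e e0.
apply: contrapT => H'; apply: H; exists x, y, e; split => // T' pos h1 h2 hT'.
apply: H'; exists (T' x), (T' y); split => //; [exact: TC|exact: TC|].
apply: (order_ratio_le hC _ _ (hT' _ _ Cx Cy)); first by rewrite lerDl ltW.
by left; exact: TC.
Qed.

(** The contracting set is relatively closed in each compact set on which the cocycle is continuous;
    its part outside their union is contained in a null set but is not shown to be measurable. *)
Lemma mu_continuous_contracting k (dl : R) : 0 <= dl ->
  mu_continuous_rds mu sigma sigmaV L ->
  exists E, [/\ measurable E, E `<=` [set w | ratio_diam C dl (A k w)] &
    exists2 N, measurable N /\ mu N = 0%E &
      [set w | ratio_diam C dl (A k w)] `<=` E `|` N].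
Proof.
move=> dl0 [polish borel [cs csV] cL].
have {}cL := mu_continuous_compactly cL.
have cA : compactly mu (continuous_on (@opdist R X X) (A k)).
  have cLn n : compactly mu (continuous_on (@opdist R X X)
    (fun w => L (iter n sigma w))) by apply: compactly_iter hsigma cs csV cL.
  have := compactly_forall polish (fun n => hereditary_continuous_on (f := _)) cLn.
  by apply: compactly_impl => K _ h; exact: continuous_on_cocycle.
have /choice[K hK] : forall n, exists K, [/\ compact K, measurable K,
    (mu (~` K) < (inv_succ n)%:E)%E & continuous_on (@opdist R X X) (A k) K].
  by move=> n; apply: cA; exact: inv_succ_gt0.
have mK n : measurable (K n) by case: (hK n).
pose S := [set w | ratio_diam C dl (A k w)].
have mKS n : measurable (K n `&` S).
  apply: (closed_measurable borel); apply: closed_sub_continuous.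
    by apply: compact_closed; [exact: (polish_hausdorff polish)|case: (hK n)].
  move=> w Kw nS; have [_ _ _ cAn] := hK n.
  have [x [y [e [Cx Cy e0 he]]]] := ratio_diam_far dl0 (cocycle_cone hLC (n := k) (w := w)) nS.
  have D0 : 0 < `|x| + `|y| + 1 by have := normr_ge0 x; have := normr_ge0 y; lra.
  have := cAn w Kw _ (divr_gt0 e0 D0).
  rewrite !near_withinE; apply: filterS => w' h Kw'.
  have close z : `|z| < `|x| + `|y| + 1 -> `|A k w z - A k w' z| < e.
    move=> zD; have [bw bw'] := (cocycle_bounded sigma hL k w, cocycle_bounded sigma hL k w').
    apply: (le_lt_trans (opdist_le z bw bw')).
    have := h Kw'; rewrite ltr_pdivlMr//; apply: le_lt_trans.
    by apply: ler_wpM2l (ltW zD); apply: opnorm_ge0; exact: bounded_operatorB.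
  have nx := normr_ge0 x; have ny := normr_ge0 y.
  apply: he; first exact: cocycle_cone.
  - by apply: close; lra.
  - by apply: close; lra.
exists (\bigcup_n (K n `&` S)); split.
- exact: bigcupT_measurable.
- by move=> w [n _ []].
exists (\bigcap_n ~` K n); first split.
- by apply: bigcapT_measurable => n; exact: measurableC.
- apply/eqP; rewrite -measure_le0; apply/lee_addgt0Pr => e e0; rewrite add0e.
  have [n hn] := inv_succ_lt e0; have [_ _ muK _] := hK n.
  apply: (@le_trans _ _ (mu (~` K n))).
    apply: le_measure; rewrite ?inE; [|exact: measurableC|exact: bigcap_inf].
    by apply: bigcapT_measurable => m; exact: measurableC.
  by apply: ltW; apply: lt_trans muK _; rewrite lte_fin.
move=> w Sw; have [|nK] := pselect (exists n, K n w).
  by move=> [n Kw]; left; exists n.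
by right => n _ Kw; apply: nK; exists n.
Qed.

Lemma nP_lty w : (nP sigma L C w < +oo)%E -> exists k n : nat, (0 < k)%N /\
  ratio_diam C (expR n.+1%:R - 1) (A k w).
Proof.
move=> /ereal_inf_lt[_ [k [k1 hk] <-] _]; exists k.
have posA : A k w @` C `<=` C by exact: cocycle_cone.
have [n hn] := diam_theta_lty_ratio hC posA hk; exists n; split => // x y Cx Cy.
apply: (order_ratio_le hC _ _ (hn _ _ Cx Cy)); last by left; apply: posA; exists x.
by rewrite lerD2r ler_expR ler_nat.
Qed.

(** The image of C at time j + k is contained in the image under the window starting at time j, so
    one contracting window on the orbit suffices. *)
Lemma nP_visit w j k (D : R) : (0 < k)%N -> 0 <= D ->
  ratio_diam C (expR D - 1) (A k (iter j sigma w)) -> (nP sigma L C w < +oo)%E.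
Proof.
move=> k0 D0 h; apply: le_lt_trans (ltry (j + k)%:R).
apply: ereal_inf_lbound; exists (j + k)%N => //; split; first by rewrite addn_gt0 k0 orbT.
apply: le_lt_trans (ltry D).
apply: le_trans (ratio_diam_theta hC (cocycle_cone hLC (w := iter j sigma w)) D0 h).
apply: le_ereal_sup => _ [[x y] [/= [x' Cx' <-] [y' Cy' <-]] <-].
exists (A (j + k) w x', A (j + k) w y') => //=; rewrite !cocycleD.
by split; [exists (A j w x')|exists (A j w y')] => //; exact: cocycle_C.
Qed.

Hypothesis hrds : strongly_measurable_rds L \/ mu_continuous_rds mu sigma sigmaV L.

(** Finiteness of nP on S is covered by countably many conditions, indexed by a time k and an
    integer bound. Each is measurable up to a null set, so if all were null then S would be null
    too. *)
Lemma exists_contracting_set :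
  (exists S : set Omega, [/\ measurable S, (0 < mu S)%E &
     forall w, S w -> (nP sigma L C w < +oo)%E]) ->
  exists G k (D : R), [/\ measurable G, (0 < mu G)%E, (0 < k)%N, 0 < D &
    forall w, G w -> ratio_diam C (expR D - 1) (A k w)].
Proof.
move=> [S0 [mS0 S00 hS0]].
have dl0 (n : nat) : 0 <= expR n.+1%:R - 1 :> R by rewrite subr_ge0 ltW// expR_gt1.
have /choice[E hE] : forall i : nat * nat, exists E, [/\ measurable E,
    E `<=` [set w | ratio_diam C (expR i.2.+1%:R - 1) (A i.1 w)] &
    exists2 N, measurable N /\ mu N = 0%E &
      [set w | ratio_diam C (expR i.2.+1%:R - 1) (A i.1 w)] `<=` E `|` N].
  move=> [k n]; case: hrds => [hA|hB]; last exact: mu_continuous_contracting.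
  exists [set w | ratio_diam C (expR n.+1%:R - 1) (A k w)]; split => //.
    exact: strongly_measurable_contracting.
  by exists set0 => //; rewrite measure0.
have mE i : measurable (E i) by case: (hE i).
have /choice[N hN] : forall i, exists N, [/\ measurable N, mu N = 0%E &
    [set w | ratio_diam C (expR i.2.+1%:R - 1) (A i.1 w)] `<=` E i `|` N].
  by move=> i; have [_ _ [N [mN N0] h]] := hE i; exists N.
have [[k n] [k0 En]] : exists i, (0 < i.1)%N /\ mu (E i) != 0%E.
  apply: contrapT => /forallNP h0.
  have En i : (0 < i.1)%N -> mu (E i) = 0%E.
    by move=> i0; apply/eqP; apply: contrapT => /negP ?; exact: (h0 i).
  pose Z (i : nat * nat) := if (0 < i.1)%N then E i `|` N i else set0.
  have mZ i : measurable (Z i).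
    by rewrite /Z; case: ifP => _ //; apply: measurableU => //; case: (hN i).
  have Z0 i : mu.-negligible (Z i).
    rewrite /Z; case: ifP => i0; last exact: negligible_set0.
    have [mN N0 _] := hN i.
    by apply: negligibleU; apply/negligibleP => //; exact: En.
  have : mu.-negligible S0.
    pose F j := if unpickle j is Some i then Z i else set0.
    apply: (@negligibleS _ _ _ mu (\bigcup_j F j)).
      move=> w /hS0/nP_lty[k [n [k0 h]]]; exists (pickle (k, n)) => //.
      rewrite /F pickleK /Z /= k0; have [_ _] := hN (k, n); exact.
    apply: negligible_bigcup => j; rewrite /F; case: unpickle => [i|].
      exact: Z0.
    exact: negligible_set0.
  by move=> /(negligibleP mu mS0) S0E; rewrite S0E ltxx in S00.
exists (E (k, n)), k, n.+1%:R; split => //.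
  by rewrite lt0e En measure_ge0.
by move=> w; case: (hE (k, n)) => _ /(_ w).
Qed.

End contracting_set.

(** * Iterates of the equivariant line and of the kernel *)

Lemma dense_sequence_real (R : realType) :
  exists q : nat -> R^o, forall x e, 0 < e -> exists n, `|x - q n| < e.
Proof.
exists (fun n => if unpickle n is Some u then ratr u else 0) => x e e0.
have [u] : exists u : rat, ratr u \in `](x - e), (x + e)[.
  by apply: rat_in_itvoo; lra.
rewrite in_itv /= => /andP[h1 h2]; exists (pickle u); rewrite pickleK ltr_norml.
by apply/andP; split; lra.
Qed.

Section patch0.
Variables (R : realType) (d : measure_display) (Omega : measurableType d).
Variables (O : set Omega) (f : Omega -> R).

(** The ergodic theorem is stated for functions measurable on all of Omega, whereas phi and eta are
    controlled on O only. *)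
Definition patch0 w : R := if w \in O then f w else 0.

Lemma patch0_in w : O w -> patch0 w = f w.
Proof. by move=> Ow; rewrite /patch0 mem_set. Qed.

Lemma patch0_out w : ~ O w -> patch0 w = 0.
Proof. by move=> nOw; rewrite /patch0 memNset. Qed.

Lemma measurable_patch0 : measurable O -> measurable_fun O f ->
  measurable_fun setT patch0.
Proof. by move=> mO /(measurable_restrictT _ mO). Qed.

End patch0.

Section spectral_gap.
Variables (R : realType) (d : measure_display).
Variables (Omega : measurableTopologicalType d) (mu : probability Omega R).
Variables (sigma sigmaV : Omega -> Omega) (X : completeNormedModType R).
Variables (L : Omega -> X -> X) (C : set X).
Hypothesis hsigma : ergodic_invertible mu sigma sigmaV.
Hypothesis hL : forall w, bounded_operator (L w).
Hypothesis hLC : forall w, L w @` C `<=` C.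
Hypothesis hC : nice_cone C.
Variables (G : set Omega) (k : nat) (D : R).
Hypotheses (mG : measurable G) (G0 : (0 < mu G)%E) (k0 : (0 < k)%N) (D0 : 0 < D).

Local Notation A := (cocycle sigma L).
Local Notation back n w := (iter n sigmaV w).

Hypothesis hG : forall w, G w -> ratio_diam C (expR D - 1) (A k w).
Variables (Dc kappa : R).
Hypotheses (Dc1 : 1 <= Dc) (hDc : D_adapted C Dc) (kappa0 : 0 < kappa).
Hypothesis hkappa : forall x, exists y z, [/\ cone0 C y, cone0 C z,
  `|y| <= kappa * `|x|, `|z| <= kappa * `|x| & x = y - z].
Variable x0 : X.
Hypothesis Cx0 : C x0.

Let p : R := fine (mu G).
Let t : R := Defs.tanh (D / 4).
(** The k-th root of the contraction factor of one window; p * ln r is then the rate of the spectral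
    gap. *)
Let r : R := expR (ln t / k%:R).
(** The value of [contraction_rate] before any visit: delta < c0 says that at least one window has
    been met, as [ratio_diam_cocycle] requires. *)
Let c0 : R := (expR D - 1) / t.
Let delta := contraction_rate sigma G k D r.

Definition pf_vector := perron_vector sigma sigmaV L x0.
Definition pf_functional w : X -> R^o := perron_functional sigma L w (pf_vector w).
Definition pf_multiplier w : R := `|L w (pf_vector w)|.

Local Notation v := pf_vector.
Local Notation eta := pf_functional.
Local Notation phi := pf_multiplier.

Definition pf_good w : Prop :=
  [/\ n%:R^-1 * (visits sigma G n w)%:R @[n --> \oo] --> p,
      delta n w @[n --> \oo] --> (0 : R) &
      delta n (back n w) @[n --> \oo] --> (0 : R)].

Let p0 : 0 < p.
Proof. by rewrite fine_gt0// G0 /= ltey_eq fin_num_measure. Qed.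

Let t0 : 0 < t. Proof. exact: tanh_quarter_gt0. Qed.
Let t1 : t < 1. Proof. exact: tanh_quarter_lt1. Qed.
Let r0 : 0 < r. Proof. exact: expR_gt0. Qed.

Let k0R : 0 < k%:R :> R. Proof. by rewrite ltr0n. Qed.

Let lnr : ln r = ln t / k%:R. Proof. exact: expRK. Qed.

Let lnt : ln t < 0. Proof. by rewrite ln_lt0// t0 t1. Qed.

Let r1 : r < 1.
Proof. by rewrite -expR0 ltr_expR pmulr_llt0// invr_gt0. Qed.

Let rk : r ^+ k = t.
Proof. by rewrite -expRM_natl mulrC divfK ?gt_eqF// lnK// posrE. Qed.

Let c0_gt0 : 0 < c0.
Proof. by rewrite divr_gt0// subr_gt0 expR_gt1. Qed.

Let delta_ge0 n w : 0 <= delta n w.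
Proof. exact: contraction_rate_ge0. Qed.

Let hdelta n w : delta n w < c0 -> ratio_diam C (delta n w) (A n w).
Proof.
move=> dn; apply: (ratio_diam_cocycle hL hLC hC k0 D0 r0 (ltW r1) rk hG).
rewrite lt0n; apply: contraTneq dn => v0.
by rewrite /delta /contraction_rate v0 expr0 mulr1 ltxx.
Qed.

Lemma pf_rateE : - (p / k%:R * ln (1 / t)) = p * ln r.
Proof. by rewrite lnr div1r lnV ?posrE//; field; rewrite gt_eqF. Qed.

Lemma pf_rate_lt0 : p * ln r < 0.
Proof. by rewrite pmulr_rlt0// lnr pmulr_llt0// invr_gt0. Qed.

Lemma measurable_visits n : measurable_fun setT (fun w => (visits sigma G n w)%:R : R).
Proof.
have : measurable_fun setT (birkhoff_sum sigma (\1_G : Omega -> R) n).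
  by apply: (measurable_birkhoff_sum hsigma); exact: measurable_indic.
congr (measurable_fun _ _); apply/funext => w.
rewrite /birkhoff_sum /visits natr_sum; apply: eq_bigr => i _.
by rewrite indicE; congr (_%:R); congr nat_of_bool; apply/idP/idP; rewrite in_setE => /asboolP.
Qed.

Lemma measurable_contraction_rate n : measurable_fun setT (delta n).
Proof.
rewrite /delta /contraction_rate.
rewrite (_ : (fun w => _) = fun w => c0 * expR (ln r * (visits sigma G (n.+1 - k) w)%:R)); last first.
  by apply/funext => w; rewrite (mulrC (ln r)) expRM_natl lnK ?posrE.
apply: measurable_funM; first exact: measurable_cst.
apply: measurableT_comp => //; apply: measurable_funM; first exact: measurable_cst.
exact: measurable_visits.
Qed.

(** The times -n, ..., -1 are listed in reverse order. Time 0 is not among them, so the backward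
    orbit starts at sigmaV w, and the ergodic theorem for the inverse applies. *)
Lemma visits_back n w :
  visits sigma G n (back n w) = visits sigmaV G n (sigmaV w).
Proof.
rewrite /visits (reindex_inj rev_ord_inj) /=; apply: eq_bigr => i _.
rewrite -iterSr; congr (nat_of_bool `[< G _ >]).
by rewrite -(iter_back_sub (ergodic_cancelV hsigma) w (ltn_ord i)).
Qed.

(** The base point depends on n so that forward orbits (constant y) and pullbacks (y n at time -n)
    are treated together. *)
Let rate_cvg0 (y : nat -> Omega) :
  n%:R^-1 * (visits sigma G n (y n))%:R @[n --> \oo] --> p ->
  delta n (y n) @[n --> \oo] --> (0 : R).
Proof.
move=> hp; apply: (@cvg_geometric_rate _ c0 r (fun n => visits sigma G (n.+1 - k) (y n))).
  by rewrite (ltW r0).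
move=> S [N _ hN].
have [M _ hM] := frequency_cvg_infty p0 hp (nbhs_infty_ge (N + k)).
exists M => // n /= Mn; apply: hN => /=.
have := hM n Mn; rewrite /= => h.
by have := leq_trans h (visits_window _ _ n k (y n)); rewrite leq_add2r.
Qed.

Lemma ae_pf_good : {ae mu, forall w, pf_good w}.
Proof.
have hV := ergodic_inverse hsigma.
apply: filterS2 (ae_frequency hsigma mG) (preserving_ae hV (ae_frequency hV mG)) => w h1 h2.
split; first exact: h1.
  exact: (rate_cvg0 (y := fun=> w) h1).
by apply: rate_cvg0; under eq_fun do rewrite visits_back; exact: h2.
Qed.

Section invariant.
Variable O : set Omega.
Hypothesis OG : forall w, O w -> pf_good w.
Hypotheses (sO : sigma @^-1` O = O) (sVO : sigmaV @^-1` O = O).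

Let O_sigma w : O w -> O (sigma w). Proof. by rewrite -{1}sO. Qed.

Let O_iter n w : O w -> O (iter n sigma w).
Proof. by move=> Ow; elim: n => //= n; exact: O_sigma. Qed.

Let hf w : O w -> delta n w @[n --> \oo] --> (0 : R).
Proof. by move=> /OG[]. Qed.

Let hb w : O w -> delta n (back n w) @[n --> \oo] --> (0 : R).
Proof. by move=> /OG[]. Qed.

Let sVK := ergodic_cancelV hsigma.

Lemma pf_vector_C w : O w -> C (v w).
Proof.
by move=> /hb h; exact: (perron_vector_C sVK hLC hC Dc1 hDc c0_gt0 delta_ge0 hdelta Cx0 h).
Qed.

Lemma pf_vector_norm w : O w -> `|v w| = 1.
Proof.
by move=> /hb h; exact: (perron_vector_norm sVK hLC hC Dc1 hDc c0_gt0 delta_ge0 hdelta Cx0 h).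
Qed.

Lemma pf_multiplier_gt0 w : O w -> 0 < phi w.
Proof.
by move=> /pf_vector_C Cv; apply: (cone_norm_gt0 hC); apply: hLC; exists (v w).
Qed.

Lemma pf_vector_equivariant w : O w -> L w (v w) = phi w *: v (sigma w).
Proof.
move=> Ow; exact: (perron_vector_equivariant (ergodic_cancel hsigma) sVK hL hLC hC
  Dc1 hDc c0_gt0 delta_ge0 hdelta Cx0 (hb Ow) (hb (O_sigma Ow))).
Qed.

(** By equivariance v' w is a positive multiple of the image of its own value at time -n, so it lies
    in every image cone. *)
Lemma pf_vector_unique (v' : Omega -> X) (phi' : Omega -> R) :
  (forall w, O w -> C (v' w) /\ `|v' w| = 1) -> (forall w, O w -> 0 < phi' w) ->
  (forall w, O w -> L w (v' w) = phi' w *: v' (sigma w)) ->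
  forall w, O w -> v' w = v w.
Proof.
move=> hv' hp' he w Ow; have [Cv' v'1] := hv' w Ow.
apply: (perron_vector_unique sVK hLC hC Dc1 hDc c0_gt0 delta_ge0 hdelta Cx0 (hb Ow) v'1) => n.
have Ob : O (back n w).
  by elim: n => //= n; rewrite -{1}sVO.
have fwd m u : O u -> exists2 s, 0 < s & A m u (v' u) = s *: v' (iter m sigma u).
  move=> Ou; elim: m => [|m [s s0 IH]]; first by exists 1 => //; rewrite scale1r.
  have Om := O_iter m Ou.
  exists (s * phi' (iter m sigma u)); first by rewrite mulr_gt0// hp'.
  by rewrite cocycleS IH (linear_funZ _ _ (hL _).1) he// scalerA.
have [s s0 E] := fwd n _ Ob.
exists s^-1; first by rewrite invr_gt0.
exists (v' (back n w)); first by case: (hv' _ Ob).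
by rewrite E (iter_backK sVK) scalerA mulVf ?scale1r// gt_eqF.
Qed.

Lemma pf_functional_bounded w : O w -> bounded_operator (eta w).
Proof.
move=> Ow; exact: (perron_functional_bounded hL hLC hC Dc1 hDc hkappa c0_gt0
  delta_ge0 hdelta (pf_vector_C Ow) (hf Ow)).
Qed.

Lemma pf_functional_gt0 w x : O w -> C x -> 0 < (eta w x : R).
Proof.
move=> Ow Cx; exact: (perron_functional_gt0 hL hLC hC hDc c0_gt0 delta_ge0 hdelta
  (pf_vector_C Ow) (hf Ow) Cx).
Qed.

Lemma pf_functional_self w : O w -> eta w (v w) = 1.
Proof.
move=> Ow; exact: (perron_functional_self sigma hLC hC c0_gt0 delta_ge0
  (pf_vector_C Ow) (hf Ow)).
Qed.

Lemma pf_functional_equivariant w x : O w ->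
  eta (sigma w) (L w x) = phi w * eta w x.
Proof.
move=> Ow; exact: (perron_functional_equivariant hL hLC hC Dc1 hDc hkappa c0_gt0
  delta_ge0 hdelta x (pf_vector_C Ow) (pf_vector_C (O_sigma Ow)) (hf Ow)
  (hf (O_sigma Ow)) (pf_multiplier_gt0 Ow) (pf_vector_equivariant Ow)).
Qed.

Lemma pf_cocycle_vector w n : O w -> 0 < `|A n w (v w)| /\
  n%:R^-1 * ln `|A n w (v w)| = log_average sigma phi w n.
Proof.
move=> Ow; suff [s [s0 As lns]] : exists s, [/\ 0 < s,
    A n w (v w) = s *: v (iter n sigma w) &
    ln s = \sum_(i < n) ln (phi (iter i sigma w))].
  by rewrite As normrZ pf_vector_norm ?mulr1 ?gtr0_norm ?lns//; exact: O_iter.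
elim: n => [|n [s [s0 IH lns]]].
  by exists 1; split; rewrite ?scale1r ?ln1 ?big_ord0.
have On := O_iter n Ow; have ph := pf_multiplier_gt0 On.
exists (s * phi (iter n sigma w)); split; first by rewrite mulr_gt0.
  by rewrite cocycleS IH (linear_funZ _ _ (hL _).1) pf_vector_equivariant// scalerA.
by rewrite lnM ?posrE// big_ord_recr /= lns.
Qed.

Lemma pf_opnorm_growth w : O w -> exists2 K, 0 < K &
  \forall n \near \oo, opnorm (A n w) <= K * `|A n w (v w)|.
Proof.
move=> Ow; have Cv := pf_vector_C Ow; have hw := hf Ow.
have [m dm] := delta_good c0_gt0 delta_ge0 hw.
pose B := functional_bound sigma L Dc kappa delta m w (v w).
have B0 : 0 <= B by exact: functional_bound_ge0.
have Dc0 : 0 < Dc by exact: lt_le_trans Dc1.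
have K0 : 0 <= Dc * c0 * B by apply: mulr_ge0 => //; apply: mulr_ge0; exact: ltW.
exists (B + Dc * c0 * B + 1); first lra.
have /cvgrPdist_lt/(_ _ c0_gt0) := hw; apply: filterS => n.
rewrite sub0r normrN ger0_norm// => dn.
apply: opnorm_ub => [|x]; first by rewrite mulr_ge0//; lra.
have h1 := perron_functional_approx hL hLC hC Dc1 hDc hkappa c0_gt0 delta_ge0
  hdelta Cv hw x dm dn.
have h2 := perron_functional_bound hL hLC hC Dc1 hDc hkappa c0_gt0 delta_ge0
  hdelta Cv hw x dm.
have a0 : 0 <= `|A n w (v w)| by []; have nx : 0 <= `|x| by [].
have h3 : Dc * delta n w * (B * `|x|) * `|A n w (v w)| <=
    Dc * c0 * (B * `|x|) * `|A n w (v w)|.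
  apply: ler_wpM2r => //; apply: ler_wpM2r; first exact: mulr_ge0.
  by apply: ler_wpM2l; exact: ltW.
have h4 : `|(eta w x : R)| * `|A n w (v w)| <= B * `|x| * `|A n w (v w)|.
  by rewrite ler_wpM2r.
have h5 := ler_normD (A n w x - (eta w x : R) *: A n w (v w)) ((eta w x : R) *: A n w (v w)).
rewrite subrK normrZ in h5.
have h6 : 0 <= `|A n w (v w)| * `|x| by rewrite mulr_ge0.
apply: (le_trans h5); apply: (le_trans (lerD (le_trans h1 h3) h4)).
rewrite -/B; lra.
Qed.

Lemma pf_kernel_growth w : O w -> exists2 K, 0 < K &
  \forall n \near \oo, forall x, kernel_set (eta w) x ->
    `|A n w x| <= K * expR ((visits sigma G n w)%:R * ln r) *
      `|A n w (v w)| * `|x|.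
Proof.
move=> Ow; have Cv := pf_vector_C Ow; have hw := hf Ow.
have [m dm] := delta_good c0_gt0 delta_ge0 hw.
pose B := functional_bound sigma L Dc kappa delta m w (v w).
have B0 : 0 <= B by exact: functional_bound_ge0.
have Dc0 : 0 < Dc by exact: lt_le_trans Dc1.
have K0 : 0 <= Dc * (c0 / t) * B.
  by apply: mulr_ge0 => //; apply: mulr_ge0; [exact: ltW|apply: divr_ge0; exact: ltW].
exists (Dc * (c0 / t) * B + 1); first lra.
have /cvgrPdist_lt/(_ _ c0_gt0) := hw; apply: filterS => n.
rewrite sub0r normrN ger0_norm// => dn x ex.
have h1 := perron_functional_approx hL hLC hC Dc1 hDc hkappa c0_gt0 delta_ge0
  hdelta Cv hw x dm dn.
rewrite (ex : perron_functional _ _ _ _ _ = 0) scale0r subr0 -/B in h1.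
have E : expR ((visits sigma G n w)%:R * ln r) = r ^+ visits sigma G n w.
  by rewrite expRM_natl lnK ?posrE.
(* The exponent in delta counts visits before n.+1 - k; passing to all visits before n costs at most
   k of them, that is, the factor r ^- k = 1 / t. *)
have dE : delta n w <= c0 / t * r ^+ visits sigma G n w.
  rewrite /delta /contraction_rate -/t -/c0 -(mulrA c0 t^-1).
  apply: ler_wpM2l; first exact: ltW.
  rewrite mulrC ler_pdivlMr// -rk -exprD ler_wiXn2l ?(ltW r0) ?(ltW r1)//.
  exact: visits_window.
rewrite E; apply: (le_trans h1).
have q0 : 0 <= r ^+ visits sigma G n w by rewrite exprn_ge0// ltW.
have h2 : Dc * delta n w * (B * `|x|) * `|A n w (v w)| <=
    Dc * (c0 / t * r ^+ visits sigma G n w) * (B * `|x|) * `|A n w (v w)|.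
  apply: ler_wpM2r => //; apply: ler_wpM2r; first exact: mulr_ge0.
  by apply: ler_wpM2l => //; exact: ltW.
have h3 : 0 <= r ^+ visits sigma G n w * `|A n w (v w)| * `|x|.
  by rewrite !mulr_ge0.
apply: (le_trans h2).
have -> : (Dc * (c0 / t) * B + 1) * r ^+ visits sigma G n w * `|A n w (v w)| * `|x| =
  Dc * (c0 / t * r ^+ visits sigma G n w) * (B * `|x|) * `|A n w (v w)| +
  r ^+ visits sigma G n w * `|A n w (v w)| * `|x| by ring.
by rewrite lerDl.
Qed.

Let visits_rate w : O w ->
  n%:R^-1 * ((visits sigma G n w)%:R * ln r) @[n --> \oo] --> p * ln r.
Proof.
move=> /OG[h _ _]; under eq_fun do rewrite mulrA.
by apply: cvgM => //; exact: cvg_cst.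
Qed.

Lemma pf_kernel_limsup w : O w ->
  (limn_esup (fun n => log_rate (fun m => opnorm_on (kernel_set (eta w)) (A m w)) n
     - (log_average sigma phi w n)%:E) <= (p * ln r)%:E)%E.
Proof.
move=> Ow; have [K K0 hK] := pf_kernel_growth Ow.
have e0 : kernel_set (eta w) 0 by exact: (linear_fun0 (pf_functional_bounded Ow).1).
have Av n : 0 < `|A n w (v w)| by case: (pf_cocycle_vector n Ow).
under eq_fun => n do rewrite -(pf_cocycle_vector n Ow).2.
apply: (@limn_esup_log_rate _ _ (fun n => `|A n w (v w)|) _ K (p * ln r) K0 _ Av _
  (visits_rate Ow)).
  by move=> n; apply: opnorm_on_ge0 => //; exact: cocycle_bounded.
apply: filterS hK => n hn; apply: opnorm_on_ub => //.
  by rewrite !mulr_ge0 ?expR_ge0// ltW.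
Qed.

Lemma pf_kernel_vector_limsup w x (lam : R) : O w -> kernel_set (eta w) x ->
  (log_average sigma phi w n)%:E @[n --> \oo] --> lam%:E ->
  (limn_esup (log_rate (fun n => `|A n w x|%R)) <= (p * ln r + lam)%:E)%E.
Proof.
move=> Ow ex hlam; have [K K0 hK] := pf_kernel_growth Ow.
have K'0 : 0 < K * (`|x| + 1) by rewrite mulr_gt0//; have := normr_ge0 x; lra.
pose s n := (visits sigma G n w)%:R * ln r + ln `|A n w (v w)|.
have hs : n%:R^-1 * s n @[n --> \oo] --> p * ln r + lam.
  under eq_fun do rewrite /s mulrDr; apply: cvgD; first exact: visits_rate.
  under eq_fun => n do rewrite (pf_cocycle_vector n Ow).2.
  exact: (fine_cvg hlam).
have near_le : \forall n \near \oo, `|A n w x| <= K * (`|x| + 1) * expR (s n) * 1.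
  apply: filterS hK => n /(_ x ex) h.
  have [Av _] := pf_cocycle_vector n Ow.
  rewrite mulr1 /s expRD lnK ?posrE//; apply: (le_trans h).
  have E0 := expR_gt0 ((visits sigma G n w)%:R * ln r).
  have -> : K * (`|x| + 1) * (expR ((visits sigma G n w)%:R * ln r) * `|A n w (v w)|) =
    K * expR ((visits sigma G n w)%:R * ln r) * `|A n w (v w)| * `|x| +
    K * expR ((visits sigma G n w)%:R * ln r) * `|A n w (v w)| by ring.
  by rewrite lerDl !mulr_ge0// ltW.
have := @limn_esup_log_rate R (fun n => `|A n w x|%R) (fun=> 1) s _ _ K'0
  (fun n => normr_ge0 _) (fun=> ltr01) near_le hs.
congr (limn_esup _ <= _)%E; apply/funext => n.
by rewrite ln1 mulr0 sube0.
Qed.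

Section measurability.
Hypothesis mO : measurable O.
Hypothesis strong : strongly_measurable_rds L.

Let mL x : norm_measurable setT (L ^~ x).
Proof. by case: strong => _ h; exact: strongly_measurable_eval. Qed.

Let norm_measurable_pf_vector : norm_measurable O v.
Proof.
have [s hs] := dense_sequence strong.1.
exact: (norm_measurable_perron_vector sVK hL hLC hC Dc1 hDc c0_gt0 delta_ge0 hdelta
  Cx0 hb hs (ergodic_measurable hsigma) (ergodic_measurableV hsigma) mL).
Qed.

Let measurable_pf_functional x : measurable_fun O (fun w => eta w x : R).
Proof.
have [s hs] := dense_sequence strong.1.
exact: (measurable_perron_functional sVK hL hLC hC Dc1 hDc hkappa c0_gt0 delta_ge0
  hdelta Cx0 hb hf hs mO (ergodic_measurable hsigma) (ergodic_measurableV hsigma) mL).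
Qed.

Lemma pf_strongly_measurable :
  [/\ borel_measurable O v, strongly_measurable O eta,
      strongly_measurable O (rank_one_proj v eta),
      strongly_measurable O (rank_one_coproj v eta) &
      grassmannian_measurable O (fun w => line (v w))].
Proof.
have [s hs] := dense_sequence strong.1; have [q hq] := dense_sequence_real R.
have mproj x : norm_measurable O (rank_one_proj v eta ^~ x).
  exact: (norm_measurableZ hs mO).
split.
- exact: (norm_measurable_borel hs mO).
- apply: (strongly_measurable_pointwise hs hq mO).
    by move=> w; exact: pf_functional_bounded.
  by move=> x; exact: norm_measurable_real.
- apply: (strongly_measurable_pointwise hs hs mO _ mproj).
  by move=> w /pf_functional_bounded; exact: rank_one_proj_bounded.
- apply: (strongly_measurable_pointwise hs hs mO).
    by move=> w /pf_functional_bounded; exact: rank_one_coproj_bounded.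
  by move=> x; apply: (norm_measurableB hs mO).
- apply: (grassmannian_measurable_line hs mO norm_measurable_pf_vector pf_vector_norm).
  move=> w Ow; exact: (line_grassmannian (pf_functional_bounded Ow) (pf_functional_self Ow)).
Qed.

Lemma pf_strongly_measurable_norms :
  measurable_fun O phi /\ measurable_fun O (fun w => opnorm (eta w)).
Proof.
have [s hs] := dense_sequence strong.1; split.
  apply: norm_measurable_norm; apply: (norm_measurable_apply hs mO) => //.
    by move=> x y; apply: measurable_funTS; exact: mL.
  by move=> w _; exact: bounded_operator_continuous.
apply: (measurable_opnorm hs mO); first by move=> w; exact: pf_functional_bounded.
by move=> x; exact: norm_measurable_real.
Qed.

End measurability.

Section continuity.
Hypotheses (mO : measurable O) (O1 : mu (~` O) = 0%E).
Hypothesis cont : mu_continuous_rds mu sigma sigmaV L.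

Let pf_regular_on K := [/\ K `<=` O, continuous_on (@opdist R X X) L K,
  continuous_on (@normdist R X) v K & continuous_on (@opdist R X R^o) eta K].

Let compactly_regular : compactly mu pf_regular_on.
Proof.
have [polish borel [cs csV] cL] := cont.
have {}cL := mu_continuous_compactly cL.
have her (f : Omega -> X -> X) : hereditary (continuous_on (@opdist R X X) f).
  exact: hereditary_continuous_on.
have uher (f : nat -> Omega -> R) : hereditary (fun K => forall e : R, 0 < e ->
    exists N, forall n, (N <= n)%N -> forall w, K w -> `|f n w| < e).
  by move=> K K' KK' h e e0; have [N hN] := h e e0; exists N => n Nn w /KK'; exact: hN.
have allher (f : nat -> Omega -> X -> X) :
    hereditary (fun K => forall n, continuous_on (@opdist R X X) (f n) K).
  by move=> K K' KK' h n; exact: her (h n).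
have h1 : compactly mu (fun K => K `<=` O) by exact: (compactly_subset borel polish cL).
have h2 : compactly mu (fun K => forall n,
    continuous_on (@opdist R X X) (fun w => L (iter n sigma w)) K).
  by apply: (compactly_forall polish) => n; [exact: her|exact: compactly_iter hsigma cs csV cL].
have h3 : compactly mu (fun K => forall n,
    continuous_on (@opdist R X X) (fun w => L (back n w)) K).
  apply: (compactly_forall polish) => n; first exact: her.
  exact: compactly_iter (ergodic_inverse hsigma) csV cs cL.
have h4 := compactly_egorov borel polish cL measurable_contraction_rate mO O1 hf.
have h5 : compactly mu (fun K => forall e : R, 0 < e ->
    exists N, forall n, (N <= n)%N -> forall w, K w -> `|delta n (back n w)| < e).
  apply: (compactly_egorov borel polish cL _ mO O1 hb) => n.
  apply: (measurableT_comp (measurable_contraction_rate n)).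
  exact: measurable_iter (ergodic_measurableV hsigma).
have her_and (P Q : set Omega -> Prop) : hereditary P -> hereditary Q ->
    hereditary (fun K => P K /\ Q K).
  by move=> hP hQ K K' KK' [h h']; split; [exact: hP h|exact: hQ h'].
have hO := hereditary_subset (W := O).
have h12 := compactly_and polish hO (allher _) h1 h2.
have h123 := compactly_and polish (her_and _ _ hO (allher _)) (allher _) h12 h3.
have h45 := compactly_and polish (uher _) (uher _) h4 h5.
have := compactly_and polish (her_and _ _ (her_and _ _ hO (allher _)) (allher _))
  (her_and _ _ (uher _) (uher _)) h123 h45.
apply: compactly_impl => K _ [[[KO cf] cb] [uf ub]].
split => //; first exact: (cf 0%N).
  exact: (continuous_on_perron_vector sVK hL hLC hC Dc1 hDc c0_gt0 delta_ge0 hdelta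
    Cx0 hb KO cb ub).
exact: (continuous_on_perron_functional sVK hL hLC hC Dc1 hDc kappa0 hkappa c0_gt0
  delta_ge0 hdelta Cx0 hb hf KO cf cb ub uf).
Qed.

Lemma pf_mu_continuous :
  [/\ mu_continuous mu (@normdist R X) O v,
      mu_continuous mu (@opdist R X R^o) O eta,
      mu_continuous mu (@opdist R X X) O (rank_one_proj v eta) /\
      mu_continuous mu (@opdist R X X) O (rank_one_coproj v eta),
      mu_continuous mu (@grassmannian_dist R X) O (fun w => line (v w)) &
      mu_continuous mu (@grassmannian_dist R X) O (fun w => kernel_set (eta w))].
Proof.
have [polish _ _ _] := cont.
have imp T (dist : T -> T -> R) f : (forall K, pf_regular_on K -> continuous_on dist f K) ->
    mu_continuous mu dist O f.
  move=> h; apply: (compactly_mu_continuous polish).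
  by apply: compactly_impl compactly_regular => K _ hK; split; [exact: h|case: hK].
split; [| |split| |]; apply: imp => K [KO _ cv ceta] //.
- by apply: continuous_on_rank_one_proj => // w /KO; exact: pf_functional_bounded.
- by apply: continuous_on_rank_one_coproj => // w /KO; exact: pf_functional_bounded.
- move=> w Kw e e0; have := cv w Kw e e0; rewrite !near_withinE.
  apply: filterS => w' h Kw'; apply: le_lt_trans (h Kw').
  by apply: grassmannian_dist_line; apply: pf_vector_norm; exact: KO.
- move=> w Kw e e0; have e2 : 0 < e / 2 by rewrite divr_gt0.
  have := ceta w Kw _ e2; rewrite !near_withinE.
  apply: filterS => w' h Kw'; apply: (@le_lt_trans _ _ (2 * opdist (eta w) (eta w'))).
    have bd u : K u -> bounded_operator (eta u) by move=> /KO; exact: pf_functional_bounded.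
    have nv u : K u -> `|v u| = 1 by move=> /KO; exact: pf_vector_norm.
    have sv u : K u -> eta u (v u) = 1 by move=> /KO; exact: pf_functional_self.
    exact: (grassmannian_dist_kernel (bd w Kw) (bd w' Kw') (nv w Kw) (nv w' Kw')
      (sv w Kw) (sv w' Kw')).
  by rewrite mulrC -ltr_pdivlMr//; exact: h.
Qed.

Lemma pf_mu_continuous_norms : exists W, [/\ measurable W, mu (~` W) = 0%E,
  measurable_fun W phi & measurable_fun W (fun w => opnorm (eta w))].
Proof.
have [polish borel _ _] := cont.
have [|W1 [mW1 W10 mphi]] := @compactly_ae_measurable _ _ _ mu borel polish phi.
  apply: compactly_impl compactly_regular => K _ [KO cL cv _].
  by apply: continuous_on_normr; exact: continuous_on_apply.
have [|W2 [mW2 W20 meta]] := @compactly_ae_measurable _ _ _ mu borel polish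
    (fun w => opnorm (eta w)).
  apply: compactly_impl compactly_regular => K _ [KO _ _ ceta].
  by apply: continuous_on_opnorm => // w /KO; exact: pf_functional_bounded.
exists (W1 `&` W2); split.
- exact: measurableI.
- apply/eqP; rewrite -measure_le0 setCI.
  apply: (le_trans (measureU2 mu (measurableC mW1) (measurableC mW2))).
  by rewrite [X in (X + _)%E]W10 [X in (_ + X)%E]W20 adde0.
- by apply: measurable_funS mphi => //; exact: subIsetl.
- by apply: measurable_funS meta => //; exact: subIsetr.
Qed.

End continuity.

Section exponents.
Hypotheses (mO : measurable O) (O1 : mu (~` O) = 0%E).
Hypotheses (mphi : measurable_fun O phi)
  (meta : measurable_fun O (fun w => opnorm (eta w))).
Variable g : Omega -> R.
Hypothesis ig : mu.-integrable setT (EFin \o g).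
Hypothesis hg : forall w, O w -> log_plus (opnorm (L w)) = g w.

Let f w : R := patch0 O (fun w => ln (phi w)) w.
Let h w : R := patch0 O (fun w => ln (opnorm (eta w))) w.

Definition pf_exponent : \bar R := (\int[mu]_w (f w)%:E)%E.

Let mf : measurable_fun setT f.
Proof. by apply: measurable_patch0 => //; exact: measurableT_comp. Qed.

Let mh : measurable_fun setT h.
Proof. by apply: measurable_patch0 => //; exact: measurableT_comp. Qed.

Let fO w : O w -> f w = ln (phi w).
Proof. exact: (@patch0_in _ _ _ O (fun w => ln (phi w))). Qed.

Let hO w : O w -> h w = ln (opnorm (eta w)).
Proof. exact: (@patch0_in _ _ _ O (fun w => ln (opnorm (eta w)))). Qed.

Let phi_le w : O w -> phi w <= opnorm (L w).
Proof.
by move=> Ow; have := opnorm_le (v w) (hL w); rewrite pf_vector_norm// mulr1.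
Qed.

Let ln_opnorm_le w : O w -> ln (opnorm (L w)) <= g w.
Proof. by move=> Ow; rewrite -hg// /log_plus le_max lexx orbT. Qed.

Let ln_phi_le w : O w -> ln (phi w) <= g w.
Proof.
move=> Ow; apply: le_trans (ln_opnorm_le Ow).
have phi0 := pf_multiplier_gt0 Ow; have le := phi_le Ow.
by rewrite ler_ln ?posrE//; exact: lt_le_trans le.
Qed.

Let ifp : mu.-integrable setT (EFin \o (fun w => Num.max 0 (f w))).
Proof.
apply: (le_integrable measurableT _ _ ig).
  by apply/measurable_EFinP; apply: measurable_maxr => //; exact: measurable_cst.
move=> w _ /=; rewrite lee_fin ger0_norm ?le_max ?lexx// ge_max normr_ge0 /=.
have [Ow|nOw] := pselect (O w); last by rewrite /f patch0_out.
by rewrite fO//; apply: le_trans (ln_phi_le Ow) (ler_norm _).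
Qed.

Lemma pf_exponent_lty : (pf_exponent < +oo)%E.
Proof.
apply: (@le_lt_trans _ _ (\int[mu]_w (Num.max 0 (f w))%:E)%E); last first.
  by rewrite ltey_eq integrable_fin_num.
rewrite /pf_exponent integralE.
apply: (@le_trans _ _ (\int[mu]_w ((fun w => (f w)%:E)^\+ w))%E).
  by rewrite -[leRHS]adde0 leeD2l// oppe_le0; apply: integral_ge0.
by rewrite le_eqVlt (eq_integral (fun w => (Num.max 0 (f w))%:E)) ?eqxx// => w _;
  rewrite funeposE -EFin_max maxC.
Qed.

Let integrable_f : (-oo < pf_exponent)%E -> mu.-integrable setT (EFin \o f).
Proof. exact: quasi_integrable_fin. Qed.

Let birkhoff_f n w : O w ->
  n%:R^-1 * birkhoff_sum sigma f n w = log_average sigma phi w n.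
Proof.
by move=> Ow; congr (_ * _); apply: eq_bigr => i _; apply: fO; exact: O_iter.
Qed.

Lemma ae_pf_log_average : {ae mu, forall w, O w ->
  (log_average sigma phi w n)%:E @[n --> \oo] --> pf_exponent}.
Proof.
apply: filterS (birkhoff_quasi_integrable hsigma mf ifp) => w hw Ow.
by under eq_fun => n do rewrite -(birkhoff_f n Ow); exact: hw.
Qed.

(** Equivariance expresses eta at w through eta at sigma w; its logarithm is the upper bound on
    increments from which temperedness is derived. *)
Let opnorm_functional_step w : O w ->
  opnorm (eta w) <= opnorm (eta (sigma w)) * opnorm (L w) / phi w.
Proof.
move=> Ow; have phi0 := pf_multiplier_gt0 Ow.
have bs := pf_functional_bounded (O_sigma Ow).
apply: opnorm_ub => [|x].
  by rewrite divr_ge0 ?(ltW phi0)// mulr_ge0//; exact: opnorm_ge0.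
have -> : eta w x = (phi w)^-1 * eta (sigma w) (L w x) :> R.
  by rewrite pf_functional_equivariant// mulrA mulVf ?mul1r// gt_eqF.
rewrite normrM normfV (gtr0_norm phi0) mulrAC [leRHS]mulrC ler_wpM2l ?invr_ge0 ?(ltW phi0)//.
apply: (le_trans (opnorm_le _ bs)); rewrite -mulrA ler_wpM2l//; last exact: opnorm_le.
exact: opnorm_ge0.
Qed.

Let functional_ge1 w : O w -> 1 <= opnorm (eta w).
Proof.
move=> Ow; exact: (opnorm_functional_ge1 (pf_functional_bounded Ow)
  (pf_functional_self Ow) (pf_vector_norm Ow)).
Qed.

Let h_step w : h w - h (sigma w) <= `|g w| + `|f w|.
Proof.
have [Ow|nOw] := pselect (O w); last first.
  (* The bound is required at every point: off O both values of h are 0, because O is invariant. *)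
  rewrite /h !patch0_out ?subrr ?addr_ge0// => Os; apply: nOw.
  by move: Os; rewrite -{2}sO.
have Os := O_sigma Ow; have phi0 := pf_multiplier_gt0 Ow.
have e1 := functional_ge1 Ow; have e2 := functional_ge1 Os.
have Lp : 0 < opnorm (L w) by apply: lt_le_trans (phi_le Ow).
have e1' : 0 < opnorm (eta w) by exact: lt_le_trans e1.
have e2' : 0 < opnorm (eta (sigma w)) by exact: lt_le_trans e2.
have := opnorm_functional_step Ow.
rewrite -ler_ln ?posrE ?divr_gt0 ?mulr_gt0// ln_div ?posrE ?mulr_gt0// lnM ?posrE//.
rewrite (hO Ow) (hO Os) (fO Ow) => step; rewrite lerBlDl; apply: (le_trans step).
rewrite -addrA lerD2l; apply: lerD; first exact: le_trans (ln_opnorm_le Ow) (ler_norm _).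
by rewrite -normrN ler_norm.
Qed.

Lemma ae_pf_tempered : (-oo < pf_exponent)%E -> {ae mu, forall w, O w ->
  n%:R^-1 * ln (opnorm (eta (iter n sigma w))) @[n --> \oo] --> (0 : R) /\
  n%:R^-1 * ln (opnorm (eta (back n w))) @[n --> \oo] --> (0 : R)}.
Proof.
move=> lam.
have ib : mu.-integrable setT (EFin \o (fun w => `|g w| + `|f w|)).
  exact: (integrableD measurableT (integrable_norm ig) (integrable_norm (integrable_f lam))).
have b0 w : 0 <= `|g w| + `|f w| by exact: addr_ge0.
have O_back n w : O w -> O (back n w).
  by move=> Ow; elim: n => //= n; rewrite -{1}sVO.
apply: filterS (tempered_of_increments hsigma mh ib b0 h_step) => w [hF hB] Ow; split.
  by under eq_fun => n do rewrite -(hO (O_iter n Ow)); exact: hF.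
by under eq_fun => n do rewrite -(hO (O_back n _ Ow)); exact: hB.
Qed.

Lemma pf_multiplier_in_L1 (O' : set Omega) : measurable O' -> O' `<=` O ->
  in_L1 mu O' (fun w => log_plus (phi w)).
Proof.
move=> mO' OO; exists (fun w => Num.max 0 (f w)).
  exact: (integrableS measurableT mO').
by apply: aeW => w /OO Ow; rewrite fO.
Qed.

Lemma pf_exponent_integral (O' : set Omega) : measurable O' -> O' `<=` O ->
  mu (~` O') = 0%E -> (-oo < pf_exponent)%E ->
  pf_exponent = (\int[mu]_(w in O') (ln (phi w))%:E)%E.
Proof.
move=> mO' OO O'1 lam.
rewrite /pf_exponent (negligible_integral (measurableC mO') measurableT (integrable_f lam) O'1).
rewrite setTD setCK; apply: eq_integral => w; rewrite inE => /OO Ow.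
by rewrite /= fO.
Qed.

End exponents.

End invariant.

Hypothesis hrds : strongly_measurable_rds L \/ mu_continuous_rds mu sigma sigmaV L.

Let ae_of_conull (W : set Omega) : measurable W -> mu (~` W) = 0%E ->
  {ae mu, forall w, W w}.
Proof. by move=> mW W0; exists (~` W); split => //; exact: measurableC. Qed.

(** Three invariant sets of full measure are taken in turn: U1 for convergence of the visits, U2 for
    measurability of phi and of the norm of eta together with the integrable representative of log
    L, and U3 for the averages and temperedness. The arguments for U2 and U3 already use invariance
    of the preceding set. *)
Lemma exists_pf_domain : in_L1 mu setT (fun w => log_plus (opnorm (L w))) ->
  exists O (lam : \bar R),
  [/\ [/\ measurable O, mu (~` O) = 0%E, sigma @^-1` O = O & sigmaV @^-1` O = O],
      (forall w, O w -> pf_good w) /\ (lam < +oo)%E,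
      measurable_fun O phi /\ in_L1 mu O (fun w => log_plus (phi w)),
      forall w, O w -> (log_average sigma phi w n)%:E @[n --> \oo] --> lam &
      (-oo < lam)%E -> lam = (\int[mu]_(w in O) (ln (phi w))%:E)%E /\
        forall w, O w ->
        n%:R^-1 * ln (opnorm (eta (iter n sigma w))) @[n --> \oo] --> (0 : R) /\
        n%:R^-1 * ln (opnorm (eta (back n w))) @[n --> \oo] --> (0 : R)].
Proof.
move=> [g ig ae_g].
have [U1 [mU1 U10 sU1 sVU1 U1G]] := invariant_core hsigma ae_pf_good.
have [W [mW W0 mphi meta]] : exists W, [/\ measurable W, mu (~` W) = 0%E,
    measurable_fun W phi & measurable_fun W (fun w => opnorm (eta w))].
  case: hrds => [hA|hB]; last exact: (pf_mu_continuous_norms U1G mU1 U10 hB).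
  by have [h1 h2] := pf_strongly_measurable_norms U1G mU1 hA; exists U1.
have ae2 : {ae mu, forall w, [/\ U1 w, W w & log_plus (opnorm (L w)) = g w]}.
  by apply: filterS3 (ae_of_conull mU1 U10) (ae_of_conull mW W0) ae_g => w ? ? h; split => //; exact: h.
have [U2 [mU2 U20 sU2 sVU2 U2P]] := invariant_core hsigma ae2.
have U2G w : U2 w -> pf_good w by move=> /U2P[/U1G].
have hg w : U2 w -> log_plus (opnorm (L w)) = g w by case/U2P.
have mphi2 : measurable_fun U2 phi.
  by apply: measurable_funS mphi => // w /U2P[].
have meta2 : measurable_fun U2 (fun w => opnorm (eta w)).
  by apply: measurable_funS meta => // w /U2P[].
pose lam := pf_exponent U2.
have ae3 : {ae mu, forall w, [/\ U2 w,
    (log_average sigma phi w n)%:E @[n --> \oo] --> lam &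
    (-oo < lam)%E ->
      n%:R^-1 * ln (opnorm (eta (iter n sigma w))) @[n --> \oo] --> (0 : R) /\
      n%:R^-1 * ln (opnorm (eta (back n w))) @[n --> \oo] --> (0 : R)]}.
  have h1 := ae_pf_log_average U2G sU2 mU2 mphi2 ig hg.
  have h2 : {ae mu, forall w, (-oo < lam)%E -> U2 w ->
      n%:R^-1 * ln (opnorm (eta (iter n sigma w))) @[n --> \oo] --> (0 : R) /\
      n%:R^-1 * ln (opnorm (eta (back n w))) @[n --> \oo] --> (0 : R)}.
    have [hl|nl] := pselect (-oo < lam)%E; last by apply: aeW => w /nl.
    have := ae_pf_tempered U2G sU2 sVU2 mU2 mphi2 meta2 ig hg hl.
    by apply: filterS => w h _.
  apply: filterS3 (ae_of_conull mU2 U20) h1 h2 => w Ow h1 h2; split => //.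
    exact: h1.
  by move=> hl; exact: h2.
have [U3 [mU3 U30 sU3 sVU3 U3P]] := invariant_core hsigma ae3.
have U32 : U3 `<=` U2 by move=> w /U3P[].
exists U3, lam; split.
- by split.
- split; first by move=> w /U32; exact: U2G.
  exact: (pf_exponent_lty U2G mU2 mphi2 ig hg).
- split; first exact: measurable_funS mphi2.
  exact: (pf_multiplier_in_L1 U2G mU2 mphi2 ig hg mU3 U32).
- by move=> w /U3P[].
- move=> hl; split; last by move=> w /U3P[_ _]; exact.
  exact: (pf_exponent_integral U2G mU2 mphi2 ig hg mU3 U32 U30 hl).
Qed.

End spectral_gap.

Theorem corollary2p19 (R : realType) (d : measure_display)
  (Omega : measurableTopologicalType d) (mu : probability Omega R)
  (sigma sigmaV : Omega -> Omega) (X : completeNormedModType R)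
  (L : Omega -> X -> X) (C : set X)
  (hsigma : ergodic_invertible mu sigma sigmaV)
  (hL : forall w, bounded_operator (L w))
  (hrds : strongly_measurable_rds L \/
          mu_continuous_rds mu sigma sigmaV L)
  (hC : nice_cone C)
  (hLC : forall w, L w @` C `<=` C)
  (hnP : exists A : set Omega,
     [/\ measurable A, (0 < mu A)%E &
         forall w, A w -> (nP sigma L C w < +oo)%E]) :
  {ae mu, forall w, (nP sigma L C w < +oo)%E} /\
  exists (GP : set Omega) (kP : nat) (DP : R),
    [/\ measurable GP /\ (0 < mu GP)%E,
        (0 < kP)%N,
        0 < DP,
        forall w, GP w -> (cone_diam sigma L C kP w <= DP%:E)%E &
    in_L1 mu setT (fun w => log_plus (opnorm (L w))) ->
    exists Omt : set Omega,
      [/\ measurable Omt, mu Omt = 1%E, sigma @^-1` Omt = Omt &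
    exists (v : Omega -> X) (phi : Omega -> R) (eta : Omega -> X -> R^o),
      [/\
       perron_frobenius_pair mu sigma L C Omt v phi /\
       (forall (v' : Omega -> X) (phi' : Omega -> R),
          perron_frobenius_pair mu sigma L C Omt v' phi' ->
          forall w, Omt w -> v' w = v w),
       [/\ forall w, Omt w -> bounded_operator (eta w),
           forall w x, Omt w -> C x -> 0 < (eta w x : R),
           forall w x, Omt w -> eta (sigma w) (L w x) = phi w * eta w x,
           forall w, Omt w -> eta w (v w) = 1 &
           [/\ forall w, Omt w ->
                 closed_direct_sum (line (v w)) (kernel_set (eta w)),
               equivariant sigma L Omt (fun w => line (v w)),
               equivariant sigma L Omt (fun w => kernel_set (eta w)) &
               forall w, Omt w ->
                 continuous_projection (rank_one_proj v eta w)
                   (line (v w)) (kernel_set (eta w))]],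
       (strongly_measurable_rds L ->
          [/\ borel_measurable Omt v,
              strongly_measurable Omt eta,
              strongly_measurable Omt (rank_one_proj v eta),
              strongly_measurable Omt (rank_one_coproj v eta) &
              grassmannian_measurable Omt (fun w => line (v w))]) /\
       (mu_continuous_rds mu sigma sigmaV L ->
          [/\ mu_continuous mu (@normdist R X) Omt v,
              mu_continuous mu (@opdist R X R^o) Omt eta,
              mu_continuous mu (@opdist R X X) Omt (rank_one_proj v eta) /\
              mu_continuous mu (@opdist R X X) Omt (rank_one_coproj v eta),
              mu_continuous mu (@grassmannian_dist R X) Omt
                (fun w => line (v w)) &
              mu_continuous mu (@grassmannian_dist R X) Omt
                (fun w => kernel_set (eta w))]) &
       exists lambda1 : \bar R,
         [/\ (lambda1 < +oo)%E,
             forall w, Omt w ->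
               [/\ log_rate (fun n => `|cocycle sigma L n w (v w)|)
                     @ \oo --> lambda1,
                   (fun n => (log_average sigma phi w n)%:E)
                     @ \oo --> lambda1 &
                   log_rate (fun n => opnorm (cocycle sigma L n w))
                     @ \oo --> lambda1],
             forall w, Omt w ->
               (limn_esup (fun n =>
                  log_rate (fun m => opnorm_on (kernel_set (eta w))
                                       (cocycle sigma L m w)) n
                  - (log_average sigma phi w n)%:E)
                <= (- (fine (mu GP) / kP%:R * ln (1 / tanh (DP / 4))))%:E)%E,
             - (fine (mu GP) / kP%:R * ln (1 / tanh (DP / 4))) < 0 &
             (-oo < lambda1)%E ->
               [/\ top_exponent_multiplicity sigma L Omt lambda1 1
                     (fun w => line (v w)),
                   lambda1 = (\int[mu]_(w in Omt) (ln (phi w))%:E)%E,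
                   norm_tempered sigma sigmaV Omt (rank_one_proj v eta) &
                   (* for dim X = 1 the family I - pi is identically 0 *)
                   ~ has_dim [set: X] 1 ->
                   norm_tempered sigma sigmaV Omt (rank_one_coproj v eta)]]]]].
Proof.
have [G [k [D [mG G0 k0 D0 hG]]]] := exists_contracting_set hsigma hL hLC hC hrds hnP.
have p0 : 0 < fine (mu G) by rewrite fine_gt0// G0 /= ltey_eq fin_num_measure.
split.
  (* One visit to G makes nP finite, and by ergodicity almost every orbit has one. *)
  apply: filterS (ae_frequency hsigma mG) => w /(frequency_recurrent p0)/(_ 0%N)[j _ Gj].
  exact: (nP_visit hLC hC k0 (ltW D0) (hG _ Gj)).
exists G, k, D; split => //.
  move=> w Gw; apply: (ratio_diam_theta hC _ (ltW D0) (hG w Gw)).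
  exact: cocycle_cone.
move=> logL.
have [Dc Dc1 hDc] := nice_cone_adapted hC.
have [kappa kappa0 hkappa] := cone_decomposition hC.
have [x0 [_ [Cx0 _ _]]] := nice_cone_generating hC 0.
have [Omt [lam [[mO O0 sO sVO] [OG lam_lty] [mphi iphi] hlam hfin]]] :=
  exists_pf_domain hsigma hL hLC hC mG G0 k0 D0 hG Dc1 hDc kappa0 hkappa Cx0 hrds logL.
pose v := pf_vector sigma sigmaV L x0.
pose phi := pf_multiplier sigma sigmaV L x0.
pose eta := pf_functional sigma sigmaV L x0.
have vC := pf_vector_C hsigma hL hLC hC k0 D0 hG Dc1 hDc Cx0 OG.
have v1 := pf_vector_norm hsigma hL hLC hC k0 D0 hG Dc1 hDc Cx0 OG.
have phi0 := pf_multiplier_gt0 hsigma hL hLC hC k0 D0 hG Dc1 hDc Cx0 OG.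
have vE := pf_vector_equivariant hsigma hL hLC hC k0 D0 hG Dc1 hDc Cx0 OG sO.
have eb := pf_functional_bounded hsigma hL hLC hC k0 D0 hG Dc1 hDc hkappa Cx0 OG.
have ev := pf_functional_self hsigma hL hLC hC k0 D0 hG Dc1 hDc Cx0 OG.
have eE := pf_functional_equivariant hsigma hL hLC hC k0 D0 hG Dc1 hDc hkappa Cx0 OG sO.
have Av := pf_cocycle_vector hsigma hL hLC hC k0 D0 hG Dc1 hDc Cx0 OG sO.
have Oiter n w : Omt w -> Omt (iter n sigma w).
  by move=> Ow; elim: n => //= n; rewrite -{1}sO.
have Oback n w : Omt w -> Omt (iter n sigmaV w).
  by move=> Ow; elim: n => //= n; rewrite -{1}sVO.
have eqv_line : equivariant sigma L Omt (fun w => line (v w)).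
  move=> w Ow _ [_ [a _ <-] <-]; exists (a * phi w) => //.
  by rewrite (linear_funZ _ _ (hL w).1) vE// scalerA.
have eqv_ker : equivariant sigma L Omt (fun w => kernel_set (eta w)).
  move=> w Ow _ [x ex <-]; rewrite /kernel_set /= /eta eE//.
  by rewrite (ex : pf_functional _ _ _ _ _ _ = 0) mulr0.
have dsum w : Omt w -> closed_direct_sum (line (v w)) (kernel_set (eta w)).
  by move=> Ow; exact: line_kernel_direct_sum (eb w Ow) (ev w Ow).
have rate_v w a : Omt w -> a != 0 ->
    log_rate (fun n => `|cocycle sigma L n w (a *: v w)|) @ \oo --> lam.
  move=> Ow a0; have na : 0 < `|a| by rewrite normr_gt0.
  have Aa n : `|cocycle sigma L n w (a *: v w)| = `|a| * `|cocycle sigma L n w (v w)|.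
    by rewrite (linear_funZ _ _ (cocycle_linear sigma hL n w)) normrZ.
  have up : ((n%:R^-1 * ln `|a|)%:E + (log_average sigma phi w n)%:E)%E
      @[n --> \oo] --> lam.
    rewrite -[X in _ --> X]add0e; apply: cvgeD => //; last exact: hlam.
    by apply: cvg_EFin; [exact: nearW|exact: cvg_average_cst].
  rewrite (_ : log_rate _ =
    fun n => ((n%:R^-1 * ln `|a|)%:E + (log_average sigma phi w n)%:E)%E)//.
  apply/funext => n; have [An E] := Av w n Ow.
  by rewrite log_rate_pos Aa ?mulr_gt0// lnM ?posrE// mulrDr E EFinD.
exists Omt; split => //; first exact: ae_setT_mu1.
exists v, phi, eta; split.
- split.
    by split => // w Ow; split; [exact: vC|exact: v1].
  move=> v' phi' [hv' hp' _ _ hE'] w Ow.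
  exact: (pf_vector_unique hsigma hL hLC hC k0 D0 hG Dc1 hDc Cx0 OG sO sVO hv' hp' hE').
- split => //.
  + move=> w x Ow Cx.
    exact: (pf_functional_gt0 hsigma hL hLC hC k0 D0 hG Dc1 hDc Cx0 OG Ow Cx).
  + split => // w Ow.
    exact: rank_one_continuous_projection (eb w Ow) (ev w Ow).
- split=> [hA|hB].
    exact: (pf_strongly_measurable hsigma hL hLC hC k0 D0 hG Dc1 hDc hkappa Cx0 OG mO hA).
  exact: (pf_mu_continuous hsigma hL hLC hC mG k0 D0 hG Dc1 hDc kappa0 hkappa Cx0 OG mO O0 hB).
exists lam; split => //.
- move=> w Ow; split; last 2 first.
  + exact: hlam.
  + have [K K0 hK] := pf_opnorm_growth hsigma hL hLC hC k0 D0 hG Dc1 hDc kappa0 hkappa Cx0 OG Ow.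
    apply: (log_rate_comparable K0 _ _ hK).
    * by move=> n; case: (Av w n Ow).
    * move=> n; have := opnorm_le (v w) (cocycle_bounded sigma hL n w).
      by rewrite v1// mulr1.
    * by under eq_fun => n do rewrite (Av w n Ow).2; exact: hlam.
  + by have := rate_v w 1 Ow (oner_neq0 R); rewrite scale1r.
- move=> w Ow; rewrite (pf_rateE mu G k0 D0).
  exact: (pf_kernel_limsup hsigma hL hLC hC k0 D0 hG Dc1 hDc kappa0 hkappa Cx0 OG sO Ow).
- by rewrite (pf_rateE mu G k0 D0); exact: pf_rate_lt0.
move=> lamNy; have [lamE temp] := hfin lamNy.
(* Finiteness of lam is what makes p ln r + lam strictly smaller than lam, hence the growth on the
   kernel strictly slower. *)
have lamF : lam = (fine lam)%:E by rewrite fineK// fin_real// lamNy.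
have e1 w : Omt w -> 1 <= opnorm (eta w).
  by move=> Ow; exact: opnorm_functional_ge1 (eb w Ow) (ev w Ow) (v1 w Ow).
(* Both projection norms lie between 1 and twice the norm of eta: the lower bound keeps the
   logarithm nonnegative, and temperedness of eta gives the upper estimate. *)
have tempered_le (f : Omega -> R) : (forall w, Omt w -> 1 <= f w <= 2 * opnorm (eta w)) ->
    tempered sigma sigmaV Omt f.
  move=> hf w Ow; have [tf tb] := temp w Ow.
  have f0 u : Omt u -> `|f u| = f u.
    by move=> Ou; rewrite ger0_norm//; have /andP[h _] := hf u Ou; exact: le_trans h.
  split.
    apply: (log_rate_tempered (ltr0Sn R 1) _ tf) => n.
    by rewrite f0; [apply: hf|]; exact: Oiter.
  apply: (log_rate_tempered (ltr0Sn R 1) _ tb) => n.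
  by rewrite f0; [apply: hf|]; exact: Oback.
split => //.
- exists (fun w => kernel_set (eta w)); split => //.
  + by move=> w Ow; split; [exact: dsum|exact: line_has_dim (eb w Ow) (ev w Ow)].
  + move=> w _ Ow [a _ <-] ax; apply: rate_v => //.
    by apply: contra_not_neq ax => ->; rewrite scale0r.
  + move=> w x Ow ex; rewrite lamF in hlam *.
    apply: le_lt_trans (pf_kernel_vector_limsup hsigma hL hLC hC k0 D0 hG Dc1 hDc
      kappa0 hkappa Cx0 OG sO Ow ex (hlam w Ow)) _.
    by rewrite lte_fin gtrDr; exact: pf_rate_lt0.
- apply: tempered_le => w Ow.
  exact: opnorm_rank_one_proj (eb w Ow) (ev w Ow) (v1 w Ow).
- move=> nd; apply: tempered_le => w Ow.
  exact: opnorm_rank_one_coproj (eb w Ow) (ev w Ow) (v1 w Ow) nd.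
Qed.
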